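(* Let $\{Y(t):t\in[0,1]\}$ be the LMSM with Hurst function $H(\cdot)$, where $H(\cdot)$ satisfies $|H(t_1)-H(t_2)|\le c_H|t_1-t_2|^{\rho_H}$ for all $t_1,t_2\in[0,1]$, for some constant $c_H$ and some $\rho_H$ with $1\ge\rho_H>\sup_{t\in[0,1]}H(t)$. Let $L\ge2$ be an integer, let $N_0=\min\{N\in\mathbb N:0<9(L+1)N^{-1}(\log N)^2\le1\}$, and for all $N\ge N_0$ let $$\theta_N=\kappa_0(\log N)^{-1}+4(L+1)N^{-1}(\log N)^2,\qquad \kappa_0=2^{-1}(L+1)N_0^{-1}(\log N_0)^2.$$ Let $b$ be a fixed real number such that $$0<b<\frac{\rho_H}{1+\rho_H}.$$ Then, for any fixed real numbers $\beta\in(0,1/4]$ and $p\in(0,4]$, the estimation error $\mathbb E\Big(\big(\|\widetilde H_{N,\theta_N}^\beta-H\|_b^{\text{Hölder}}\big)^p\Big)$ vanishes at a logarithmic rate when $N\to+\infty$; that is, there exists $\kappa>0$ such that $$\mathbb E\Big(\big(\|\widetilde H_{N,\theta_N}^\beta-H\|_b^{\text{Hölder}}\big)^p\Big)=\mathcal O\big((\log N)^{-\kappa}\big)\quad\text{as }N\to+\infty.$$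
   Context: Setting: $\alpha\in(1,2)$ is fixed and $(\Omega,\mathcal F,\mathbb P)$ is a probability space carrying an independently scattered symmetric $\alpha$-stable ($S\alpha S$) random measure $Z_\alpha(ds)$ on $\mathbb R$ with Lebesgue control measure: for $f\in L^\alpha(\mathbb R)$, $\int_{\mathbb R}f(s)Z_\alpha(ds)$ is the real $S\alpha S$ random variable with characteristic function $\xi\mapsto\exp(-|\sigma\xi|^\alpha)$, where $\sigma=\|f\|_{L^\alpha(\mathbb R)}$, and integrals of functions with (a.e.) disjoint supports are independent. For $x,\kappa\in\mathbb R$, $(x)_+^\kappa=x^\kappa$ if $x>0$ and $0$ otherwise. For $(u,v)\in[0,1]\times(1/\alpha,1)$, $$X(u,v)=\int_{\mathbb R}\{(u-s)_+^{v-1/\alpha}-(-s)_+^{v-1/\alpha}\}Z_\alpha(ds),$$ identified with its version with continuous sample paths. The Hurst function $H:[0,1]\to(1/\alpha,1)$ takes values in a compact subinterval of $(1/\alpha,1)$. The Linear Multifractional Stable Motion (LMSM) with Hurst function $H$ is $Y(t)=X(t,H(t))$, $t\in[0,1]$. Notation: $\log$ is the natural logarithm, $\log_2$ the logarithm to base 2, $\lambda$ Lebesgue measure, $[\cdot]$ the integer part. For $l\in\{0,\dots,L\}$, $a_l=(-1)^{L-l}\binom{L}{l}$. For $N\ge L$ and $k\in\{0,\dots,N-L\}$, $d_{N,k}=\sum_{l=0}^L a_l Y((k+l)/N)$. For a compact interval $I\subseteq[0,1]$ with non-empty interior and $N\ge(L+1)\lambda(I)^{-1}$, $\nu_N(I)=\{k\in\{0,\dots,N-L\}:k/N\in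 I\}$, $|\nu_N(I)|$ is its cardinality, $V_N^\beta(I)=|\nu_N(I)|^{-1}\sum_{k\in\nu_N(I)}|d_{N,k}|^\beta$. For $x\ge0$, $\mathcal T_\beta(x)=\min\{2^\beta,\max\{x,2^{\beta/2}\}\}$, and $\widehat H_N^\beta(I)=\beta^{-1}\log_2\big(\mathcal T_\beta(V_N^\beta(I)/V_{2N}^\beta(I))\big)$. Estimator of $H(\cdot)$: for $N\ge N_0$ and $n\in\{0,\dots,[\theta_N^{-1}]-1\}$, $\mathcal I_{N,n}=[n\theta_N,(n+1)\theta_N]$ if $n<[\theta_N^{-1}]-1$, and $\mathcal I_{N,[\theta_N^{-1}]-1}=[([\theta_N^{-1}]-1)\theta_N,1]$. Then $\widetilde H^\beta_{N,\theta_N}(t)=\widehat H_N^\beta(\mathcal I_{N,[\theta_N^{-1}]-1})$ for $t\in\mathcal I_{N,[\theta_N^{-1}]-1}$, and for $n\in\{0,\dots,[\theta_N^{-1}]-2\}$ and $t\in\mathcal I_{N,n}$, $$\widetilde H^\beta_{N,\theta_N}(t)=\big(1-\theta_N^{-1}(t-n\theta_N)\big)\widehat H_N^\beta(\mathcal I_{N,n})+\theta_N^{-1}(t-n\theta_N)\widehat H_N^\beta(\mathcal I_{N,n+1}).$$ Norms: $\|f\|_\infty=\sup_{t\in[0,1]}|f(t)|$ and, for $b\in(0,1]$, $\|f\|_b^{\text{Hölder}}=\|f\|_\infty+\sup_{0\le t_1<t_2\le1}\frac{|f(t_1)-f(t_2)|}{|t_1-t_2|^b}$. *)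

(* Defs.v *)
From HB Require Import structures.
From mathcomp Require Import all_boot all_order all_algebra.
From mathcomp Require Import all_classical all_reals all_analysis.

Set Implicit Arguments.
Unset Strict Implicit.
Unset Printing Implicit Defensive.

Import Order.TTheory GRing.Theory Num.Theory.
Import numFieldNormedType.Exports.

Local Open Scope classical_set_scope.
Local Open Scope ring_scope.

Section StableRandomMeasure.
Context {d : measure_display} {T : measurableType d} {R : realType}.
Variable P : probability T R.

(* Taking B i = setT for some of the i gives the product rule for every
   subfamily. *)
Definition mutually_independent (n : nat) (X : 'I_n -> T -> R) : Prop :=
  forall B : 'I_n -> set (measurableTypeR R), (forall i, measurable (B i)) ->
    P (\bigcap_(i in [set: 'I_n]) (X i @^-1` B i)) =
    (\prod_(i < n) P (X i @^-1` B i))%E.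

(* E(exp(i xi X)) = exp(- |sigma xi|^alpha) for all real xi; the real and the
   imaginary part are written separately. *)
Definition has_SaS_law (alpha sigma : R) (X : T -> R) : Prop :=
  forall xi : R,
    ('E_P[fun w => cos (xi * X w)%R] =
       (expR (- (`|sigma * xi| `^ alpha)))%:E)%E /\
    ('E_P[fun w => sin (xi * X w)%R] = 0)%E.

Definition Lalpha (alpha : R) : {pred R -> R} :=
  Lfun (@lebesgue_measure R) alpha%:E.

Definition Lalpha_norm (alpha : R) (f : R -> R) : R :=
  fine ('N[@lebesgue_measure R]_(alpha%:E)[EFin \o f])%E.

(* An independently scattered SaS random measure on R with Lebesgue control
   measure, given by its stochastic integral: Z f is the integral of f with
   respect to Z_alpha(ds), so Z (\1_A) is the random measure of a Borel set A
   of finite Lebesgue measure.  The values of Z outside L^alpha(R) are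
   irrelevant. *)
Record SaS_random_measure (alpha : R) (Z : (R -> R) -> {RV P >-> R}) : Prop := {
  SaS_linear : forall (a : R) (f g : R -> R),
    f \in Lalpha alpha -> g \in Lalpha alpha ->
    {ae P, forall w, Z (fun s => a * f s + g s) w = a * Z f w + Z g w} ;
  SaS_law : forall f : R -> R, f \in Lalpha alpha ->
    has_SaS_law alpha (Lalpha_norm alpha f) (Z f) ;
  SaS_independent : forall (n : nat) (f : 'I_n -> R -> R),
    (forall i, f i \in Lalpha alpha) ->
    (forall i j, i != j ->
       {ae @lebesgue_measure R, forall s, f i s = 0 \/ f j s = 0}) ->
    mutually_independent (fun i => Z (f i) : T -> R) }.

Definition ppow (x kappa : R) : R := if 0 < x then x `^ kappa else 0.

Definition lmsm_kernel (alpha u v : R) : R -> R :=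
  fun s => ppow (u - s) (v - alpha^-1) - ppow (- s) (v - alpha^-1).

(* X is a version, with continuous sample paths on [0,1] x (1/alpha,1), of the
   field of integrals; its values outside this set are irrelevant. *)
Definition stable_field (alpha : R) (Z : (R -> R) -> {RV P >-> R})
    (X : R -> R -> {RV P >-> R}) : Prop :=
  (forall u v : R, 0 <= u <= 1 -> alpha^-1 < v < 1 ->
     {ae P, forall w, X u v w = Z (lmsm_kernel alpha u v) w}) /\
  (forall w : T,
     {within [set z : R * R | 0 <= z.1 <= 1 /\ alpha^-1 < z.2 < 1],
       continuous (fun z : R * R => X z.1 z.2 w)}).

Definition lmsm (X : R -> R -> {RV P >-> R}) (H : R -> R) (t : R) :
  {RV P >-> R} := X t (H t).

End StableRandomMeasure.

(* Below, y is a (sample) path [0,1] -> R. *)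
Section Estimators.
Context {R : realType}.

Definition log2 (x : R) : R := ln x / ln 2.

Definition increment (L : nat) (y : R -> R) (N k : nat) : R :=
  \sum_(l < L.+1) (-1) ^+ (L - l) * 'C(L, l)%:R * y ((k + l)%:R / N%:R).

Definition nu (L N : nat) (I : interval R) : {set 'I_(N - L).+1} :=
  [set k : 'I_(N - L).+1 | (k%:R / N%:R : R) \in I]%SET.

Definition V (L : nat) (beta : R) (y : R -> R) (N : nat) (I : interval R) : R :=
  (#|nu L N I|%:R)^-1 * \sum_(k in nu L N I) `|increment L y N k| `^ beta.

Definition trunc_ratio (beta x : R) : R :=
  Num.min (2 `^ beta) (Num.max x (2 `^ (beta / 2))).

Definition Hhat (L : nat) (beta : R) (y : R -> R) (N : nat) (I : interval R) :
    R :=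
  beta^-1 * log2 (trunc_ratio beta (V L beta y N I / V L beta y (2 * N)%N I)).

(* For theta in (0,1], with m = [theta^-1]: the intervals I_{N,n}, n < m. *)
Definition block (theta : R) (n : nat) : interval R :=
  let m := Num.truncn theta^-1 in
  if (n < m.-1)%N then `[n%:R * theta, n.+1%:R * theta]%R
  else `[m.-1%:R * theta, 1]%R.

(* Consecutive blocks share one endpoint, at which the two defining formulas
   agree; here such a point t = n * theta is attached to block n. *)
Definition Htilde (L : nat) (beta : R) (y : R -> R) (N : nat) (theta t : R) :
    R :=
  let m := Num.truncn theta^-1 in
  let Hn n := Hhat L beta y N (block theta n) in
  if m.-1%:R * theta <= t then Hn m.-1 else
  let n := Num.truncn (t / theta) in
  let x := theta^-1 * (t - n%:R * theta) in
  (1 - x) * Hn n + x * Hn n.+1.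

Definition N0_cond (L N : nat) : bool :=
  0 < 9 * (L.+1)%:R * (N%:R)^-1 * (ln (N%:R : R)) ^+ 2 <= 1.

Definition is_N0 (L N0 : nat) : Prop :=
  N0_cond L N0 /\ forall N : nat, N0_cond L N -> (N0 <= N)%N.

Definition kappa0 (L N0 : nat) : R :=
  2^-1 * (L.+1)%:R * (N0%:R)^-1 * (ln (N0%:R : R)) ^+ 2.

Definition theta (L N0 N : nat) : R :=
  kappa0 L N0 * (ln (N%:R : R))^-1
  + 4 * (L.+1)%:R * (N%:R)^-1 * (ln (N%:R : R)) ^+ 2.

(* The norms are extended real numbers, so that a function which is unbounded
   or not Hoelder continuous has norm +oo. *)
Definition sup_norm (f : R -> R) : \bar R :=
  ereal_sup [set (`|f t|)%:E | t in [set t : R | 0 <= t <= 1]].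

Definition holder_norm (b : R) (f : R -> R) : \bar R :=
  (sup_norm f +
   ereal_sup [set z | exists t1 t2 : R, [/\ 0 <= t1, t1 < t2, t2 <= 1 &
     z = (`|f t1 - f t2| / `|t1 - t2| `^ b)%:E]]%R)%E.

End Estimators.

Arguments is_N0 : clear implicits.

(* Main.v *)
Require Import Defs.
From HB Require Import structures.
From mathcomp Require Import all_boot all_order all_algebra.
From mathcomp Require Import all_classical all_reals all_analysis.
From mathcomp Require Import measurable_realfun zify ring lra.

Set Implicit Arguments.
Unset Strict Implicit.
Unset Printing Implicit Defensive.

Import Order.TTheory GRing.Theory Num.Theory.
Import numFieldNormedType.Exports.

Local Open Scope classical_set_scope.
Local Open Scope ring_scope.

(** Write d_(N,k) for the L-th order increments of the path and v_k = H(k/N).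
    The proof separates a weak law for the power sums of the d_(N,k), where
    all probability happens, from a deterministic study of the estimator.

    The weak law.  The increment d_(N,k) is, almost surely, the stable
    integral of a combination of the kernels of X at the points (k+l)/N, taken
    at the exponents H((k+l)/N).  Freezing the exponent at v_k changes the
    L^alpha norm by O(N^-rho), which is small against N^(-v_k) because
    rho > sup H.  By the vanishing of the sum of the binomial coefficients
    the frozen kernel is N^(1/alpha - v_k) phi(N s - k), where phi is the L-th
    difference of the kernel, of norm N^(-v_k) |phi|.  As phi has a tail of
    small L^alpha norm, it can be cut at a distance of order N^(1/8) to the
    left, and the integrals of the truncated kernels are independent as soon
    as their indices are N^(1/8) + L apart.  Everything passes to the powers
    |d_(N,k)|^beta through two facts: |x|^beta is subadditive, and
    E |Z f|^q = c |f|^q for 0 < q < 1 (SaS_moment, obtained by integrating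
    1 - cos(t Z f) against t^(-1-q) dt).  As 2 beta < 1, second moments are
    available too, and a variance bound for sums with a finite range of
    dependence (weak_law) gives lmsm_weak_law: over any set A of at least
    N^(3/4) indices, the sum of the |d_(N,k)|^beta differs from the sum of
    mu_k = N^(-beta v_k) g(v_k), where g(v) = c |phi|^beta for the kernel phi
    of exponent v, in L^1, by at most C N^(-gam) times the latter, for some
    gam > 0.

    The estimator.  The sum of the mu_k over a block behaves like a Riemann
    sum: going from N to 2N doubles the number of points of the block and
    multiplies each term by 2^(-beta H), with H oscillating by O(theta^rho)
    on a block.  Hence, if the relative errors in the weak law are at most e,
    the truncated log-ratio is within O(theta^rho + e) of H at every point of
    the block (block_error).  Piecewise linear interpolation over a mesh theta
    turns an error D on the blocks into an error
    3 (D + cH theta^rho) theta^-b in the b-Hoelder norm (interp_holder_norm).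

    Conclusion.  Take e = 1 / log N, and let R be the sum over the blocks of
    the relative errors at N and 2N.  If R <= e, the Hoelder norm is
    O(theta^(rho-b)); otherwise the truncation, which keeps the estimator in
    [1/2, 1], bounds it by O(theta^-b), and 1 <= R / e.  So its p-th power is
    always at most A^p + B^p R / e with A = O(theta^(rho-b)) and
    B = O(theta^-b) (path_error).  As theta is of order 1 / log N, there are
    O(log N) blocks, so E R is O(log N) N^(-gam), which beats all powers of
    log N: the rate is that of A^p, namely (log N)^(-p (rho-b)). *)

(** * Integrals of products of independent variables and affine substitutions *)

Section Integration.
Context {d : measure_display} {T : measurableType d} {R : realType}.
Local Open Scope ereal_scope.

(** The integral of a nonnegative function is the supremum of the integrals of
    the simple functions below it, so it is monotone on arbitrary functions,
    such as the Hoelder norm of a random path. *)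
Lemma integral_ge0_mono (mu : {measure set T -> \bar R}) (f g : T -> \bar R) :
  (forall x, 0 <= f x) -> (forall x, f x <= g x) ->
  \int[mu]_x f x <= \int[mu]_x g x.
Proof.
move=> f0 fg; have g0 x : 0 <= g x by exact: le_trans (f0 x) (fg x).
rewrite !ge0_integralTE//; apply: le_ereal_sup => _ /= [h hf <-].
by exists h => //= x; apply: le_trans (fg x).
Qed.

(** The joint law agrees with the product of the two laws on rectangles, hence
    everywhere, and Tonelli applies. *)
Lemma integral_indep_mul (P : probability T R) (X Y : {mfun T >-> R})
    (u v : R -> \bar R) :
  (forall A B : set (measurableTypeR R), measurable A -> measurable B ->
    P (X @^-1` A `&` Y @^-1` B) = P (X @^-1` A) * P (Y @^-1` B)) ->
  measurable_fun [set: R] u -> (forall x, 0 <= u x) ->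
  measurable_fun [set: R] v -> (forall x, 0 <= v x) ->
  \int[P]_w (u (X w) * v (Y w)) =
  \int[P]_w u (X w) * \int[P]_w v (Y w).
Proof.
move=> indep mu u0 mv v0.
pose Q1 := distribution P X; pose Q2 := distribution P Y.
pose XY : T -> R * R := fun w => (X w, Y w).
have mXY : measurable_fun setT XY by apply/measurable_fun_pairP; split => /=.
pose XYm : {mfun T >-> (R * R)%type} :=
  HB.pack XY (isMeasurableFun.Build _ _ _ _ XY mXY).
pose Q : {measure set (R * R) -> \bar R} :=
  distribution P XYm.
have QE A : measurable A -> (Q1 \x Q2) A = Q A.
  apply: product_measure_unique => B C mB mC.
  rewrite /Q /= /distribution /pushforward/=.
  rewrite -indep//; congr (P _).
have muv : measurable_fun setT
   (fun z : R * R => u z.1 * v z.2).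
  by apply: emeasurable_funM; apply: measurableT_comp.
transitivity (\int[Q]_z (u z.1 * v z.2)).
  by rewrite ge0_integral_distribution//= => z; rewrite mule_ge0.
rewrite (eq_measure_integral (Q1 \x Q2)%E); last by move=> A mA _; apply/esym; exact: QE.
rewrite fubini_tonelli1//; last by move=> z; rewrite mule_ge0.
rewrite /fubini_F/=.
under eq_integral do rewrite ge0_integralZl//.
rewrite ge0_integralZr//; last by apply: integral_ge0.
by rewrite !ge0_integral_distribution.
Qed.

End Integration.

Section LebesgueAffine.
Context {R : realType}.
Local Notation mu := (@lebesgue_measure R).
Local Open Scope ereal_scope.

Lemma integral_affine (f : R -> \bar R) (a b : R) : (0 < a)%R ->
  measurable_fun [set: R] f -> (forall x, 0 <= f x) ->
  \int[mu]_x f (a * x + b)%R = (a^-1)%:E * \int[mu]_x f x.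
Proof.
move=> a0 mf f0.
pose phi : measurableTypeR R -> measurableTypeR R := fun x => (a * x + b)%R.
have mphi : measurable_fun setT phi.
  by apply: measurable_funD => //; apply: measurable_funM.
pose pm : {measure set (measurableTypeR R) -> \bar R} := pushforward mu phi.
have an : (0 <= a)%R by exact: ltW.
pose m' : {measure set (measurableTypeR R) -> \bar R} := mscale (NngNum an) (pm mphi).
have E A : measurable A -> mu A = m' A.
  apply: lebesgue_measure_unique => _ [[c e] _ <-] /=.
  rewrite /m' /mscale /= /pm /pushforward /=.
  have -> : phi @^-1` `]c, e]%classic = [set` `](c - b) / a, (e - b) / a]%R].
    apply/seteqP; split => x; rewrite /phi /= !in_itv/=.
      by rewrite ltr_pdivrMr// ler_pdivlMr// ltrBlDr lerBrDr [(x * a)%R]mulrC.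
    by rewrite ltr_pdivrMr// ler_pdivlMr// ltrBlDr lerBrDr [(x * a)%R]mulrC.
  rewrite !lebesgue_measure_itv/= !lte_fin.
  rewrite ltr_pM2r ?invr_gt0// ltrD2r; case: ifPn => ce; last by rewrite mule0.
  rewrite -!EFinB -EFinM; congr (_%:E).
  by field; rewrite gt_eqF.
have -> : \int[mu]_x f x = a%:E * \int[mu]_x f (a * x + b)%R.
  rewrite (eq_measure_integral m'); last by move=> A mA _; exact: E.
  rewrite ge0_integral_mscale//= ge0_integral_pushforward//.
by rewrite muleA -EFinM mulVf ?mul1e// gt_eqF.
Qed.

Lemma integral_reflect (f : R -> \bar R) :
  measurable_fun [set: R] f -> (forall x, 0 <= f x) ->
  \int[mu]_x f (- x)%R = \int[mu]_x f x.
Proof.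
move=> mf f0.
pose phi : measurableTypeR R -> measurableTypeR R := -%R.
have mphi : measurable_fun setT phi by exact: oppr_measurable.
pose pm : {measure set (measurableTypeR R) -> \bar R} := pushforward mu phi.
rewrite [RHS](eq_measure_integral (pm mphi)); last first.
  by move=> A mA _; exact/esym/lebesgue_measureN.
by rewrite ge0_integral_pushforward.
Qed.

End LebesgueAffine.

(** * Integrals of powers over half-lines *)

Section PowerIntegrals.
Context {R : realType}.
Local Notation mu := (@lebesgue_measure R).

Lemma powRD_gt0 (x r s : R) : 0 < x -> x `^ (r + s) = x `^ r * x `^ s.
Proof. by move=> x0; rewrite powRD ?(gt_eqF x0) ?implybT. Qed.

Lemma continuous_powR_gt0 (g x : R) : 0 < x -> {for x, continuous (@powR R ^~ g)}.
Proof.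
move=> x0; apply/differentiable_continuous/derivable1_diffP.
by apply: derivable_powR; rewrite in_itv/= andbT.
Qed.

Lemma integral_powR_itv (a b g : R) : 0 < a -> a < b -> g != -1 ->
  (\int[mu]_(x in `[a, b]) (x `^ g)%:E =
   ((b `^ (g + 1) - a `^ (g + 1)) / (g + 1))%:E)%E.
Proof.
move=> a0 ab g1; have g10 : g + 1 != 0 by rewrite addr_eq0.
pose F (x : R) := (g + 1)^-1 * x `^ (g + 1).
have cF x : 0 < x -> {for x, continuous F}.
  by move=> x0; apply: continuousM; [exact: cst_continuous|exact: continuous_powR_gt0].
rewrite (@continuous_FTC2 _ _ F)//.
- by rewrite -EFinB /F -mulrBr mulrC.
- apply: continuous_in_subspaceT => x /set_mem /=; rewrite in_itv/= => /andP[ax _].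
  by apply: continuous_powR_gt0; exact: lt_le_trans ax.
- split.
  + move=> x; rewrite in_itv/= => /andP[ax _]; apply: derivableM => //.
    by apply: derivable_powR; rewrite in_itv/= andbT (lt_trans a0).
  + by apply: cvg_at_right_filter; apply: cF.
  + by apply: cvg_at_left_filter; apply: cF; exact: lt_trans ab.
- move=> x; rewrite in_itv/= => /andP[ax _].
  have x0 : 0 < x by exact: lt_trans ax.
  rewrite derive1E deriveM//; last first.
    by apply: derivable_powR; rewrite in_itv/= andbT.
  rewrite derive_cst scaler0 addr0.
  have [_ ->] := is_derive1_powR (g + 1) x0.
  by rewrite addrK /GRing.scale/= mulrA mulVf// mul1r.
Qed.

(** Monotone convergence in the form used for improper integrals: a bound on
    an exhausting sequence of sets is a bound on their union. *)
Lemma integral_bigcup_bounded (F : (set R)^nat) (f : R -> R) (M : \bar R) :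
  nondecreasing_seq F -> (forall n, measurable (F n : set (measurableTypeR R))) ->
  measurable_fun [set: R] f -> (forall x, 0 <= f x) ->
  (forall n, \int[mu]_(x in F n) (f x)%:E <= M)%E ->
  (\int[mu]_(x in \bigcup_n F n) (f x)%:E <= M)%E.
Proof.
move=> ndF mF mf f0 FM.
have mfn i : measurable_fun (F i) (EFin \o f).
  by apply: measurable_funTS; exact/measurable_EFinP.
have f0n i x : F i x -> (0 <= (EFin \o f) x)%E by move=> _; rewrite /= lee_fin.
have cv := @ge0_nondecreasing_set_cvg_integral _ (measurableTypeR R) R F
  (EFin \o f) mu ndF mF mfn f0n.
by apply: (cvge_le _ cv); apply: nearW => n; exact: FM.
Qed.

Lemma integral_powR_tail_lty (g : R) : g < -1 ->
  (\int[mu]_(x in `[1%R, +oo[) (x `^ g)%:E < +oo)%E.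
Proof.
move=> g1; have g10 : g + 1 < 0 by lra.
apply: (@le_lt_trans _ _ ((- (g + 1)^-1)%:E)); last exact: ltry.
have -> : `[1%R, +oo[%classic = \bigcup_n (`[1, 2 + n%:R]%classic : set R).
  apply/seteqP; split => [x|x [n _]] /=; rewrite !in_itv/= ?andbT.
    move=> x1; exists (Num.truncn x) => //=.
    rewrite in_itv/= x1/=; have := truncnS_gt x; rewrite -natr1; lra.
  by case/andP.
apply: integral_bigcup_bounded => //.
- apply/nondecreasing_seqP => n; apply/subsetPset => x /=.
  rewrite !in_itv/= => /andP[-> h] /=; apply: le_trans h _.
  by rewrite lerD2l ler_nat.
- by move=> x; exact: powR_ge0.
- move=> n; rewrite integral_powR_itv//; last 2 first.
  + by have := ler0n R n; lra.
  + by rewrite lt_eqF.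
  rewrite lee_fin powR1 mulrC -[leRHS]mulrN1 ler_nM2l ?invr_lt0//.
  by have := powR_ge0 (2 + n%:R : R) (g + 1); lra.
Qed.

Lemma integral_powR_near0_lty (g : R) : -1 < g ->
  (\int[mu]_(x in `]0%R, 1%R]) (x `^ g)%:E < +oo)%E.
Proof.
move=> g1; have g10 : 0 < g + 1 by lra.
apply: (@le_lt_trans _ _ (((g + 1)^-1)%:E)); last exact: ltry.
have -> : `]0%R, 1%R]%classic = \bigcup_n (`[(n.+2%:R)^-1, 1]%classic : set R).
  apply/seteqP; split => [x|x [n _]] /=; rewrite !in_itv/=.
    move=> /andP[x0 x1]; exists (Num.truncn x^-1) => //=.
    rewrite in_itv/= x1 andbT -[leRHS]invrK lef_pV2 ?posrE ?invr_gt0//.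
    by rewrite (le_trans (ltW (truncnS_gt _)))// ler_nat.
  by case/andP => h ->; rewrite andbT; apply: lt_le_trans h; rewrite invr_gt0.
apply: integral_bigcup_bounded => //.
- apply/nondecreasing_seqP => n; apply/subsetPset => x /=.
  rewrite !in_itv/= => /andP[h ->]; rewrite andbT; apply: le_trans h.
  by rewrite lef_pV2 ?posrE// ler_nat.
- by move=> x; exact: powR_ge0.
- move=> n; rewrite integral_powR_itv//; last 2 first.
  + by rewrite invf_lt1// ltr1n.
  + by rewrite gt_eqF.
  rewrite lee_fin powR1 ler_piMl ?invr_ge0 ?(ltW g10)// gerBl powR_ge0.
Qed.

Lemma integral_scale (f : R -> \bar R) (a : R) : 0 < a ->
  measurable_fun [set: R] f -> (forall x, (0 <= f x)%E) ->
  (\int[mu]_(x in `]0%R, +oo[) f (a * x)%R = (a^-1)%:E * \int[mu]_(x in `]0%R, +oo[) f x)%E.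
Proof.
move=> a0 mf f0; rewrite integral_mkcond [in RHS]integral_mkcond.
rewrite -(@integral_affine _ (f \_ `]0%R, +oo[) a 0)//; last 2 first.
  apply/(measurable_restrictT f) => //.
    by apply: measurable_funTS.
  by move=> x; apply: erestrict_ge0.
apply: eq_integral => x _; rewrite /patch addr0.
by rewrite !mem_setE/= !in_itv/= !andbT pmulr_rgt0.
Qed.

End PowerIntegrals.

(** * Integrals against t^(-1-q) and fractional moments of stable laws *)

Section FractionalMoment.
Context {R : realType}.
Local Notation mu := (@lebesgue_measure R).

(** Up to a constant, the moment of order q of a variable is obtained from its
    characteristic function by this integral, with h t = 1 - cos(t x) on the
    variable side and h t = 1 - exp(-|t s|^alpha) on the Fourier side. *)
Definition frac_int (q : R) (h : R -> R) : \bar R :=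
  (\int[mu]_(t in `]0%R, +oo[) (h t * t `^ (- (1 + q)))%:E)%E.

Lemma measurable_frac (q : R) (h : R -> R) : measurable_fun [set: R] h ->
  measurable_fun [set: R] (fun t => (h t * t `^ (- (1 + q)))%:E).
Proof.
move=> mh; apply/measurable_EFinP; apply: measurable_funM => //.
Qed.

Lemma frac_int_scale (q x : R) (h : R -> R) : 0 < x ->
  measurable_fun [set: R] h -> (forall t, 0 <= h t) ->
  (frac_int q (fun t => h (x * t)%R) = (x `^ q)%:E * frac_int q h)%E.
Proof.
move=> x0 mh h0.
have f0 t : (0 <= (h t * t `^ (- (1 + q)))%:E)%E by rewrite lee_fin mulr_ge0 ?powR_ge0.
have E := integral_scale x0 (measurable_frac q mh) f0.
rewrite /frac_int.
transitivity (\int[mu]_(t in `]0%R, +oo[)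
   ((x `^ (1 + q))%:E * (h (x * t) * (x * t) `^ (- (1 + q)))%:E))%E.
  apply: eq_integral => t; rewrite inE/= in_itv/= andbT => t0.
  rewrite -EFinM; congr (_%:E); rewrite powRM ?(ltW t0) ?(ltW x0)// mulrCA.
  by congr (_ * _); rewrite mulrA -powRD_gt0// subrr powRr0 mul1r.
have mxt : measurable_fun [set: R] (fun t : R => x * t) by apply: measurable_funM.
have mg : measurable_fun [set: R] (fun t => (h (x * t) * (x * t) `^ (- (1 + q)))%:E).
  apply/measurable_EFinP; apply: measurable_funM; first exact: measurableT_comp mh mxt.
  exact: measurableT_comp (measurable_powR _) mxt.
rewrite ge0_integralZl; [| |exact: measurable_funTS|by move=> t _; exact: f0|].
- rewrite E muleA -EFinM; congr (_%:E * _)%E.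
  by rewrite powRD_gt0// powRr1 ?(ltW x0)// mulrAC mulfV ?mul1r ?gt_eqF.
- by [].
- by rewrite lee_fin powR_ge0.
Qed.

(** Near 0 the integrand is at most C t^(a-1-q) with a > q, and near infinity
    it is at most C t^(-1-q). *)
Lemma frac_int_lty (q a C : R) (h : R -> R) : 0 < q -> q < a ->
  measurable_fun [set: R] h -> (forall t, 0 <= h t) ->
  (forall t, 0 < t <= 1 -> h t <= C * t `^ a) -> (forall t, 1 <= t -> h t <= C) ->
  (frac_int q h < +oo)%E.
Proof.
move=> q0 qa mh h0 hs hl.
have C0 : 0 <= C by apply: le_trans (h0 1) (hl _ (lexx _)).
have f0 t : (0 <= (h t * t `^ (- (1 + q)))%:E)%E by rewrite lee_fin mulr_ge0 ?powR_ge0.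
rewrite /frac_int (@itv_bndbnd_setU _ R (BRight 0) (BRight 1) +oo%O)//; last first.
  by rewrite bnd_simp.
rewrite ge0_integral_setU//=; last 2 first.
- by apply: measurable_funTS; exact: measurable_frac.
- apply/disj_setPS => t [/=]; rewrite !in_itv/= andbT => /andP[_ t1] t2; lra.
apply: lte_add_pinfty.
- apply: (@le_lt_trans _ _
    (\int[mu]_(t in `]0%R, 1%R]) (C%:E * (t `^ (a - (1 + q)))%:E))%E).
    apply: ge0_le_integral => //.
    + by apply: measurable_funTS; exact: measurable_frac.
    + apply: measurable_funTS; apply/measurable_EFinP/measurable_funM => //.
    + move=> t; rewrite /= in_itv/= => /andP[t0 t1].
      rewrite -EFinM lee_fin powRD_gt0// mulrA.
      by rewrite ler_wpM2r ?powR_ge0// hs// t0.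
  rewrite ge0_integralZl//=; last 2 first.
  + by apply: measurable_funTS; apply/measurable_EFinP; exact: measurable_powR.
  + by move=> t _; rewrite lee_fin powR_ge0.
  apply: lte_mul_pinfty => //; apply: integral_powR_near0_lty; lra.
- apply: (@le_lt_trans _ _
    (\int[mu]_(t in `[1%R, +oo[) (C%:E * (t `^ (- (1 + q)))%:E))%E).
    apply: (@le_trans _ _ (\int[mu]_(t in `]1%R, +oo[) (C%:E * (t `^ (- (1 + q)))%:E))%E).
      apply: ge0_le_integral => //.
      + by apply: measurable_funTS; exact: measurable_frac.
      + apply: measurable_funTS; apply/measurable_EFinP/measurable_funM => //.
      + move=> t; rewrite /= in_itv/= andbT => t1.
        by rewrite -EFinM lee_fin ler_wpM2r ?powR_ge0// hl// ltW.
    apply: ge0_subset_integral => //.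
    + apply: measurable_funTS; apply/measurable_EFinP/measurable_funM => //.
    + by move=> t _; rewrite -EFinM lee_fin mulr_ge0 ?powR_ge0.
    + by move=> t /=; rewrite !in_itv/= !andbT; exact: ltW.
  rewrite ge0_integralZl//=; last 2 first.
  + by apply: measurable_funTS; apply/measurable_EFinP; exact: measurable_powR.
  + by move=> t _; rewrite lee_fin powR_ge0.
  apply: lte_mul_pinfty => //; apply: integral_powR_tail_lty; lra.
Qed.

Lemma frac_int_gt0 (q a b m : R) (h : R -> R) : 0 < q -> 0 < a -> a < b ->
  measurable_fun [set: R] h -> (forall t, 0 <= h t) -> 0 < m ->
  (forall t, a <= t <= b -> m <= h t) -> (0 < frac_int q h)%E.
Proof.
move=> q0 a0 ab mh h0 m0 hm.
pose c := m * b `^ (- (1 + q)).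
have c0 : 0 < c by rewrite mulr_gt0// powR_gt0// (lt_trans a0).
apply: (@lt_le_trans _ _ (\int[mu]_(t in `[a, b]) (cst c%:E t))%E).
  rewrite integral_cst//= lebesgue_measure_itv/= lte_fin ab -EFinB -EFinM lte_fin.
  by rewrite mulr_gt0// subr_gt0.
apply: (@le_trans _ _ (\int[mu]_(t in `[a, b]) (h t * t `^ (- (1 + q)))%:E)%E).
  apply: ge0_le_integral => //.
  - by move=> t _; rewrite lee_fin ltW.
  - by apply: measurable_funTS; exact: measurable_frac.
  - move=> t; rewrite /= in_itv/= => /andP[ta tb]; rewrite lee_fin.
    have t0 : 0 < t by exact: lt_le_trans ta.
    apply: ler_pM; rewrite ?powR_ge0 ?(ltW m0)//; first by rewrite hm// ta.
    rewrite !powRN lef_pV2 ?posrE ?powR_gt0 ?(lt_trans a0 ab)//.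
    by rewrite ge0_ler_powR ?nnegrE//; lra.
rewrite /frac_int; apply: (@ge0_subset_integral _ (measurableTypeR R) R mu) => //.
- by apply: measurable_funTS; exact: measurable_frac.
- by move=> t _; rewrite lee_fin mulr_ge0 ?powR_ge0.
- by move=> t; rewrite /= !in_itv/= andbT => /andP[ta _]; exact: lt_le_trans ta.
Qed.

Lemma one_sub_cos_le (t : R) : 0 <= t -> 1 - cos t <= t.
Proof.
rewrite le_eqVlt => /predU1P[<-|t0]; first by rewrite cos0 subrr.
have [x _] := @MVT _ cos (fun x => - sin x) 0 t t0
  (fun x _ => is_derive_cos x) (continuous_subspaceT (@continuous_cos R)).
rewrite cos0 subr0 => E; have := sin_le1 x; nra.
Qed.

(** By scaling, the integral of 1 - cos(t x) is a multiple of |x|^q: this is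
    how |x|^q becomes accessible to the characteristic function. *)
Lemma frac_int_abs_cos (q x : R) : 0 < q ->
  (frac_int q (fun t => 1 - cos (t * x))%R =
   (`|x| `^ q)%:E * frac_int q (fun t => 1 - cos t)%R)%E.
Proof.
move=> q0; have [->|x0] := eqVneq x 0.
  rewrite normr0 powR0 ?gt_eqF// mul0e /frac_int integral0_eq// => t _.
  by rewrite mulr0 cos0 subrr mul0r.
rewrite -frac_int_scale ?normr_gt0; last 2 first.
- by apply: measurable_funB => //; apply: continuous_measurable_fun; exact: continuous_cos.
- by move=> t; rewrite subr_ge0 cos_le1.
- rewrite /frac_int; apply: eq_integral => t _; congr ((_ * _)%:E).
  have [x_ge0|x_lt0] := leP 0 x; first by rewrite ger0_norm// mulrC.
  by rewrite ltr0_norm// mulNr cosN mulrC.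
- by [].
Qed.

Lemma frac_int_cos (q : R) : 0 < q < 1 ->
  (0 < frac_int q (fun t : R => 1 - cos t)%R < +oo)%E.
Proof.
move=> /andP[q0 q1].
have mh : measurable_fun [set: R] (fun t : R => 1 - cos t).
  by apply: measurable_funB => //; apply: continuous_measurable_fun; exact: continuous_cos.
have h0 (t : R) : 0 <= 1 - cos t by rewrite subr_ge0 cos_le1.
apply/andP; split.
  apply: (@frac_int_gt0 _ (pi / 2) pi 1) => //.
  - by rewrite divr_gt0// pi_gt0.
  - by have := pi_gt0 R; lra.
  - move=> t /andP[t1 t2]; rewrite lerBrDr gerDl -[t](subrK pi) cosDpi oppr_le0.
    by apply: cos_ge0_pihalf; have := pi_gt0 R; lra.
apply: (@frac_int_lty _ 1 2) => //.
- move=> t /andP[t0 _]; rewrite powRr1 ?(ltW t0)//.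
  by have := one_sub_cos_le (ltW t0); lra.
- by move=> t _; have := cos_geN1 t; lra.
Qed.

Definition stable_exponent (alpha : R) (t : R) : R := 1 - expR (- (`|t| `^ alpha)).

Lemma measurable_stable_exponent (alpha : R) :
  measurable_fun [set: R] (stable_exponent alpha).
Proof.
apply: measurable_funB; first exact: measurable_cst.
apply: (measurableT_comp (@measurable_expR R)).
apply: (measurableT_comp (@oppr_measurable R setT)).
apply: (measurableT_comp (measurable_powR alpha)).
exact: normr_measurable.
Qed.

Lemma frac_int_stable (alpha q : R) : 0 < q -> q < alpha ->
  (0 < frac_int q (stable_exponent alpha) < +oo)%E.
Proof.
move=> q0 qa; have a0 : 0 < alpha by exact: lt_trans qa.
have mh : measurable_fun [set: R] (stable_exponent alpha).
  exact: measurable_stable_exponent.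
have h0 t : 0 <= stable_exponent alpha t.
  by rewrite subr_ge0 expR_le1 oppr_le0 powR_ge0.
apply/andP; split.
  apply: (@frac_int_gt0 _ 1 2 (1 - expR (- 1))) => //.
  - by rewrite ltr1n.
  - move=> t /andP[t1 t2]; rewrite lerB// ler_expR lerN2 ger0_norm; last by lra.
    apply: (@le_trans _ _ (1 `^ alpha)); first by rewrite powR1.
    by rewrite ge0_ler_powR ?nnegrE ?(ltW a0)//; lra.
apply: (@frac_int_lty _ alpha 1) => //.
- move=> t /andP[t0 _]; rewrite mul1r /stable_exponent (gtr0_norm t0).
  by have := expR_ge1Dx (- (t `^ alpha)); lra.
- by move=> t _; rewrite gerBl expR_ge0.
Qed.

Lemma frac_int_stable_scale (alpha q s : R) : 0 < q -> 0 < alpha -> 0 <= s ->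
  (frac_int q (fun t => stable_exponent alpha (t * s)) =
   (s `^ q)%:E * frac_int q (stable_exponent alpha))%E.
Proof.
move=> q0 a0; rewrite le_eqVlt => /predU1P[<-|s0].
  rewrite powR0 ?gt_eqF// mul0e /frac_int integral0_eq// => t _.
  by rewrite mulr0 /stable_exponent normr0 powR0 ?gt_eqF// oppr0 expR0 subrr mul0r.
have h0 t : 0 <= stable_exponent alpha t.
  by rewrite subr_ge0 expR_le1 oppr_le0 powR_ge0.
have -> : (fun t => stable_exponent alpha (t * s)) = (fun t => stable_exponent alpha (s * t)).
  by apply/funext => t; rewrite mulrC.
exact: (frac_int_scale q s0 (measurable_stable_exponent alpha) h0).
Qed.

End FractionalMoment.

Section StableMoment.
Context {d : measure_display} {T : measurableType d} {R : realType}.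
Variable P : probability T R.
Local Notation mu := (@lebesgue_measure R).

Lemma integral_one_sub_cos (alpha s t : R) (X : {RV P >-> R}) :
  has_SaS_law P alpha s X ->
  (\int[P]_w (1 - cos (t * X w))%:E = (stable_exponent alpha (t * s))%:E)%E.
Proof.
move=> /(_ t)[E _].
have mc : measurable_fun [set: T] (fun w => cos (t * X w)).
  apply: measurableT_comp; last by apply: measurable_funM.
  by apply: continuous_measurable_fun; exact: continuous_cos.
have ic : P.-integrable [set: T] (EFin \o (fun w => cos (t * X w))).
  apply: measurable_bounded_integrable => //.
    by apply: (le_lt_trans (probability_le1 P measurableT)); rewrite ltry.
  exists 1; split; first exact: num_real.
  move=> x x1 w _ /=; apply: le_trans (ltW x1).
  by rewrite ler_norml cos_geN1 cos_le1.
have i1 : P.-integrable [set: T] (EFin \o (fun _ : T => 1%R)).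
  apply: measurable_bounded_integrable => //.
    by apply: (le_lt_trans (probability_le1 P measurableT)); rewrite ltry.
  exists 1; split; first exact: num_real.
  by move=> x x1 w _ /=; rewrite normr1 ltW.
transitivity (\int[P]_w (1%:E - (cos (t * X w))%:E))%E; first by [].
rewrite (integralB_EFin measurableT i1 ic).
have -> : (\int[P]_x 1%:E = 1)%E by rewrite integral_cst//= probability_setT mul1e.
move: E; rewrite unlock => ->; rewrite -EFinB /stable_exponent.
by rewrite mulrC.
Qed.

(** Integrate 1 - cos(t X) over both t^(-1-q) dt and P.  Integrating first in
    t gives D E|X|^q, and integrating first in P gives the same integral of
    1 - exp(-|t s|^alpha), that is J s^q by scaling.  Both D and J are finite
    and positive since 0 < q < 1 < alpha. *)
Lemma SaS_moment (alpha q : R) : 1 < alpha -> 0 < q < 1 ->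
  exists c : R, 0 < c /\
  forall (s : R) (X : {RV P >-> R}), 0 <= s -> has_SaS_law P alpha s X ->
    (\int[P]_w (`|X w| `^ q)%:E = (c * s `^ q)%:E)%E.
Proof.
move=> a1 q01; have /andP[q0 q1] := q01.
have a0 : 0 < alpha by exact: lt_trans a1.
have qa : q < alpha by exact: lt_trans a1.
have /andP[D0 Dy] := @frac_int_cos R q q01.
have /andP[J0 Jy] := @frac_int_stable R alpha q q0 qa.
move: (@frac_int_abs_cos R q) (@frac_int_stable_scale R alpha q) D0 Dy J0 Jy.
case DE : (frac_int q (fun t : R => 1 - cos t)) => [D| |]//.
case JE : (frac_int q (stable_exponent alpha)) => [J| |]; last 2 first.
- by move=> _ _ _ _ _; rewrite ltxx.
- by move=> _ _ _ _; rewrite ltNge leNye.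
move=> HD HJ; rewrite !lte_fin => D0 _ J0 _.
exists (J / D); split; first by rewrite divr_gt0.
move=> s X s0 hX.
have E1 : (\int[P]_w (frac_int q (fun t => 1 - cos (t * X w))%R) =
           (\int[P]_w (`|X w| `^ q)%:E) * D%:E)%E.
  rewrite -ge0_integralZr//.
  - by apply: eq_integral => w _; rewrite HD.
  - apply/measurable_EFinP; apply: (measurableT_comp (measurable_powR q)).
    exact: measurableT_comp.
  - by rewrite lee_fin ltW.
have E2 : (\int[P]_w (frac_int q (fun t => 1 - cos (t * X w))%R) = (s `^ q * J)%:E)%E.
  rewrite EFinM -HJ//.
  pose g (z : T * measurableTypeR R) : \bar R :=
    ((1 - cos (z.2 * X z.1)) * (z.2 `^ (- (1 + q)) * \1_(`]0, +oo[ : set R) z.2))%:E.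
  have mg : measurable_fun setT g.
    apply/measurable_EFinP; apply: measurable_funM.
      apply: measurable_funB => //.
      apply: (measurableT_comp (continuous_measurable_fun (@continuous_cos R))).
      apply: measurable_funM; first exact: measurable_snd.
      exact: measurableT_comp measurable_fst.
    apply: measurable_funM.
      exact: measurableT_comp (measurable_powR _) measurable_snd.
    apply: measurableT_comp measurable_snd.
    exact: measurable_indic.
  have g0 z : (0 <= g z)%E.
    by rewrite lee_fin !mulr_ge0 ?powR_ge0// subr_ge0 cos_le1.
  have fracE (h : R -> R) : (frac_int q h =
    \int[mu]_t (h t * (t `^ (- (1 + q)) * \1_(`]0%R, +oo[ : set R) t))%:E)%E.
    rewrite /frac_int integral_mkcond; apply: eq_integral => t _.
    rewrite /patch indicE; case: ifPn => _; first by rewrite mulr1.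
    by rewrite !mulr0.
  under eq_integral do rewrite fracE.
  rewrite (@fubini_tonelli _ _ _ _ _ P mu g mg g0) fracE.
  apply: eq_integral => t _; rewrite /g /=.
  under eq_integral do rewrite EFinM.
  rewrite ge0_integralZr//.
  - by rewrite (integral_one_sub_cos t hX) -EFinM.
  - apply/measurable_EFinP; apply: measurable_funB => //.
    apply: (measurableT_comp (continuous_measurable_fun (@continuous_cos R))).
    exact: measurable_funM.
  - by rewrite lee_fin !mulr_ge0 ?powR_ge0.
move: E1; rewrite E2.
have : (0 <= \int[P]_w (`|X w| `^ q)%:E)%E.
  by apply: integral_ge0 => w _; rewrite lee_fin powR_ge0.
case: (\int[P]_w (`|X w| `^ q)%:E)%E => [m| |]//.
- move=> _ [E]; congr (_%:E).
  by apply: (mulIf (lt0r_neq0 D0)); rewrite -E mulrAC mulfVK ?lt0r_neq0// mulrC.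
- by move=> _; rewrite gt0_mulye.
Qed.

End StableMoment.

(** * The space L^alpha *)

(** Locked, so that the comparison of two norms never unfolds Lebesgue
    integrals. *)
HB.lock Definition power_integral {R : realType} (alpha : R) (f : R -> R) : \bar R :=
  (\int[@lebesgue_measure R]_s (`|f s| `^ alpha)%:E)%E.

Section LalphaTheory.
Context {R : realType}.
Variable alpha : R.
Hypothesis alpha_gt1 : 1 < alpha.
Local Notation mu := (@lebesgue_measure R).

Let alpha_gt0 : 0 < alpha. Proof. exact: lt_trans alpha_gt1. Qed.

Local Notation power_integral := (power_integral alpha).

Lemma power_integral_ge0 f : (0 <= power_integral f)%E.
Proof. by rewrite unlock; apply: integral_ge0 => s _; rewrite lee_fin powR_ge0. Qed.

Lemma LnormE (f : R -> R) :
  ('N[mu]_(alpha%:E)[EFin \o f] = power_integral f `^ alpha^-1)%E.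
Proof. by rewrite !unlock. Qed.

Lemma LalphaP (f : R -> R) :
  f \in Lalpha alpha <-> measurable_fun [set: R] f /\ (power_integral f < +oo)%E.
Proof.
split.
  move=> /andP[/set_mem mf /set_mem]; rewrite /finite_norm/= LnormE.
  by move=> /lty_poweRy h; split => //; apply: h; rewrite invr_neq0// gt_eqF.
move=> [mf If]; apply/andP; split; apply: mem_set => //=.
by rewrite /finite_norm LnormE; exact: poweR_lty.
Qed.

Lemma Lalpha_normE (f : R -> R) : Lalpha_norm alpha f = fine (power_integral f) `^ alpha^-1.
Proof. by rewrite /Lalpha_norm LnormE fine_poweR. Qed.

Lemma Lalpha_norm_ge0 (f : R -> R) : 0 <= Lalpha_norm alpha f.
Proof. by rewrite Lalpha_normE powR_ge0. Qed.

Lemma measurable_abs_pow (f : R -> R) : measurable_fun [set: R] f ->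
  measurable_fun [set: R] (fun s => (`|f s| `^ alpha)%:E).
Proof.
move=> mf; apply/measurable_EFinP; apply: (measurableT_comp (measurable_powR alpha)).
exact: measurableT_comp.
Qed.

Lemma power_integral_dom (f g : R -> R) (a : R) : 0 <= a ->
  measurable_fun [set: R] f -> measurable_fun [set: R] g ->
  (forall s, `|f s| <= a * `|g s|) -> (power_integral f <= (a `^ alpha)%:E * power_integral g)%E.
Proof.
move=> a0 mf mg fg; rewrite !unlock -ge0_integralZl//.
- apply: ge0_le_integral => //.
  + exact: measurable_abs_pow.
  + apply: emeasurable_funM => //; exact: measurable_abs_pow.
  + move=> s _; rewrite -EFinM lee_fin -powRM//.
    by rewrite ge0_ler_powR ?nnegrE ?mulr_ge0 ?(ltW alpha_gt0).
- exact: measurable_abs_pow.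
- by rewrite lee_fin powR_ge0.
Qed.

(** The main source of membership in L^alpha and of bounds on norms:
    every kernel below is compared with a multiple of one envelope. *)
Lemma Lalpha_dom (f g : R -> R) (a : R) : 0 <= a ->
  measurable_fun [set: R] f -> g \in Lalpha alpha ->
  (forall s, `|f s| <= a * `|g s|) ->
  f \in Lalpha alpha /\ Lalpha_norm alpha f <= a * Lalpha_norm alpha g.
Proof.
move=> a0 mf /LalphaP[mg Ig] fg.
have I1 := power_integral_dom a0 mf mg fg.
have I2 : (power_integral f < +oo)%E.
  apply: le_lt_trans I1 _; apply: lte_mul_pinfty => //.
  by rewrite lee_fin powR_ge0.
split; first exact/LalphaP.
rewrite !Lalpha_normE.
have [Ff Fg] : power_integral f \is a fin_num /\ power_integral g \is a fin_num.
  by rewrite (ge0_fin_numE (power_integral_ge0 f)) (ge0_fin_numE (power_integral_ge0 g)).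
have F : fine (power_integral f) <= a `^ alpha * fine (power_integral g).
  by rewrite -lee_fin EFinM (fineK Ff) (fineK Fg).
have aE : a = (a `^ alpha) `^ alpha^-1.
  by rewrite -powRrM mulfV ?gt_eqF// powRr1.
rewrite [in leRHS]aE -powRM ?powR_ge0 ?fine_ge0 ?power_integral_ge0//.
by rewrite ge0_ler_powR ?nnegrE ?invr_ge0 ?(ltW alpha_gt0)// ?mulr_ge0 ?powR_ge0 ?fine_ge0 ?power_integral_ge0.
Qed.

Lemma Lalpha_affine (f : R -> R) (a b : R) : 0 < a -> f \in Lalpha alpha ->
  (fun s => f (a * s + b)) \in Lalpha alpha /\
  Lalpha_norm alpha (fun s => f (a * s + b)) = a `^ (- alpha^-1) * Lalpha_norm alpha f.
Proof.
move=> a0 /LalphaP[mf If].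
have IE : (power_integral (fun s => f (a * s + b)%R) = (a^-1)%:E * power_integral f)%E.
  have h0 s : (0 <= (`|f s| `^ alpha)%:E)%E by rewrite lee_fin powR_ge0.
  rewrite !unlock; exact: (integral_affine b a0 (measurable_abs_pow mf) h0).
split.
  apply/LalphaP; split.
    by apply: (measurableT_comp mf); apply: measurable_funD.
  by rewrite IE; apply: lte_mul_pinfty => //; rewrite lee_fin invr_ge0 ltW.
rewrite !Lalpha_normE IE.
have Ff : power_integral f \is a fin_num by rewrite (ge0_fin_numE (power_integral_ge0 f)).
rewrite -(fineK Ff) -EFinM/=.
rewrite powRM ?invr_ge0 ?fine_ge0 ?power_integral_ge0 ?(ltW a0)//.
congr (_ * _); rewrite -powR_inv1 ?(ltW a0)// -powRrM; congr (_ `^ _).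
by rewrite mulN1r.
Qed.

Lemma Lalpha_lin (a : R) (f g : R -> R) :
  f \in Lalpha alpha -> g \in Lalpha alpha ->
  (fun s => a * f s + g s) \in Lalpha alpha.
Proof.
move=> hf hg.
have p1 : (1 <= alpha%:E)%E by rewrite lee_fin ltW.
exact: (@Lfun_submod_closed _ _ R mu alpha%:E p1).2.
Qed.

Lemma Lalpha0 : (fun _ : R => 0 : R) \in Lalpha alpha.
Proof.
have p1 : (1 <= alpha%:E)%E by rewrite lee_fin ltW.
exact: (@Lfun_submod_closed _ _ R mu alpha%:E p1).1.
Qed.

Lemma LalphaB (f g : R -> R) :
  f \in Lalpha alpha -> g \in Lalpha alpha ->
  (fun s => f s - g s) \in Lalpha alpha.
Proof.
move=> hf hg; have := Lalpha_lin (-1) hg hf.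
have -> // : (fun s => -1 * g s + f s) = (fun s => f s - g s).
by apply/funext => s; rewrite mulN1r addrC.
Qed.

Lemma Lalpha_norm_gt0 (f : R -> R) (a b m : R) : f \in Lalpha alpha ->
  a < b -> 0 < m -> (forall s, a <= s <= b -> m <= `|f s|) ->
  m * (b - a) `^ alpha^-1 <= Lalpha_norm alpha f.
Proof.
move=> /LalphaP[mf If] ab m0 fm; rewrite Lalpha_normE.
have Ff : power_integral f \is a fin_num by rewrite (ge0_fin_numE (power_integral_ge0 f)).
have -> : m = (m `^ alpha) `^ alpha^-1.
  by rewrite -powRrM mulfV ?gt_eqF// powRr1// ltW.
rewrite -powRM ?powR_ge0 ?subr_ge0 ?(ltW ab)//.
rewrite ge0_ler_powR ?nnegrE ?invr_ge0 ?(ltW alpha_gt0)//.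
- by rewrite mulr_ge0 ?powR_ge0// subr_ge0 ltW.
- by rewrite fine_ge0 ?power_integral_ge0.
rewrite -lee_fin (fineK Ff).
apply: (@le_trans _ _ (\int[mu]_(s in `[a, b]) (cst (m `^ alpha)%:E s))%E).
  by rewrite integral_cst//= lebesgue_measure_itv/= lte_fin ab -EFinB -EFinM.
apply: (@le_trans _ _ (\int[mu]_(s in `[a, b]) (`|f s| `^ alpha)%:E)%E).
  apply: ge0_le_integral => //.
  - by move=> s _; rewrite lee_fin powR_ge0.
  - by apply: measurable_funTS; exact: measurable_abs_pow.
  - move=> s; rewrite /= in_itv/= => sab; rewrite lee_fin.
    by rewrite ge0_ler_powR ?nnegrE ?(ltW alpha_gt0) ?(ltW m0)// fm.
rewrite unlock; apply: (@ge0_subset_integral _ (measurableTypeR R) R mu) => //.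
exact: measurable_abs_pow.
Qed.

End LalphaTheory.

(** * The kernel of the stable field and its envelope *)

Section KernelBounds.
Context {R : realType}.

Lemma norm_expR_sub (a b : R) :
  `|expR a - expR b| <= `|a - b| * (expR a + expR b).
Proof.
wlog ab : a b / b <= a => [H|].
  have [/H//|/ltW/H] := leP b a.
  by rewrite distrC (distrC b) (addrC (expR b)).
have E : expR a * (1 + (b - a)) <= expR b.
  by rewrite -[X in _ <= expR X](subrKC a) expRD ler_wpM2l ?expR_ge0 ?expR_ge1Dx.
rewrite ger0_norm ?subr_ge0 ?ler_expR// ger0_norm ?subr_ge0//.
have := expR_ge0 a; have := expR_ge0 b; nra.
Qed.

Lemma powR_expR (y k : R) : 0 < y -> y `^ k = expR (k * ln y).
Proof. by move=> y0; rewrite /powR gt_eqF. Qed.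

(** The power y^k is the exponential of k ln y, and the mean value theorem in
    k costs a factor ln y; it is absorbed below by a slightly larger power. *)
Lemma norm_powR_sub (y k k' : R) : 0 < y ->
  `|y `^ k - y `^ k'| <= `|k - k'| * (`|ln y| * (y `^ k + y `^ k')).
Proof.
move=> y0; rewrite !powR_expR//.
apply: le_trans (norm_expR_sub _ _) _.
by rewrite -mulrBl normrM mulrA.
Qed.

Lemma ln_le_powR (y e : R) : 0 < y -> 0 < e -> ln y <= e^-1 * y `^ e.
Proof.
move=> y0 e0.
have ye : 0 < y `^ e by rewrite powR_gt0.
rewrite -(ler_pM2l e0) mulrA mulfV ?gt_eqF// mul1r -ln_powR.
by apply: ltW; apply: ln_sublinear.
Qed.

Lemma norm_ln_powR_small (y k : R) : 0 < y <= 1 -> 0 < k ->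
  `|ln y| * y `^ k <= k^-1.
Proof.
move=> /andP[y0 y1] k0.
have ln0 : ln y <= 0 by exact: ln_le0.
have := @ln_le_powR y^-1 k; rewrite invr_gt0 => /(_ y0 k0).
rewrite lnV ?posrE// => h.
rewrite ler0_norm// -ler_pdivlMr ?powR_gt0//; apply: le_trans h _.
by rewrite -(powR_inv1 (ltW y0)) -powRrM mulN1r powRN.
Qed.

Lemma ppow_ge0 (y k : R) : 0 <= ppow y k.
Proof. by rewrite /ppow; case: ifP => // _; exact: powR_ge0. Qed.

Lemma ppow_le (y k U : R) : 0 <= U -> y <= U + 1 -> 0 <= k <= 1 -> ppow y k <= U + 1.
Proof.
move=> U0 yU /andP[k0 k1]; rewrite /ppow; case: ltP => y0; last by lra.
have [y1|y1] := leP 1 y.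
  by apply: le_trans yU; apply: ler1_powR.
apply: (@le_trans _ _ 1); last by lra.
by apply: le_trans (ge0_ler_powR k0 _ _ (ltW y1)) _; rewrite ?nnegrE ?(ltW y0)// powR1.
Qed.

Lemma ppow_lipschitz (y k k' U k1 : R) : 0 <= U -> y <= U + 1 ->
  0 < k1 -> k1 <= k <= 1 -> k1 <= k' <= 1 ->
  `|ppow y k - ppow y k'| <= `|k - k'| * (2 * k1^-1 + 2 * (U + 1) ^+ 2).
Proof.
move=> U0 yU k10 /andP[k1k k_1] /andP[k1k' k'_1].
have i0 : 0 <= k1^-1 by rewrite invr_ge0 ltW.
have s0 : 0 <= (U + 1) ^+ 2 by rewrite sqr_ge0.
rewrite /ppow; case: ltP => y0; last first.
  by rewrite subrr normr0 mulr_ge0//; lra.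
apply: le_trans (norm_powR_sub _ _ y0) _; rewrite ler_wpM2l//.
have [y1|y1] := leP y 1.
  have h j : k1 <= j -> `|ln y| * y `^ j <= k1^-1.
    move=> kj; apply: le_trans (norm_ln_powR_small _ _) _; rewrite ?y0 ?y1//; first by lra.
    by rewrite lef_pV2 ?posrE//; lra.
  have := h _ k1k; have := h _ k1k'; rewrite mulrDr; lra.
have ly0 : 0 <= ln y by rewrite ln_ge0 // ltW.
have h j : j <= 1 -> `|ln y| * y `^ j <= (U + 1) ^+ 2.
  move=> j1; rewrite ger0_norm// expr2; apply: ler_pM; rewrite ?powR_ge0//.
    by apply: le_trans yU; apply: ltW; exact: ln_sublinear.
  by apply: le_trans yU; apply: ler1_powR => //; exact: ltW.
have := h _ k_1; have := h _ k'_1; rewrite mulrDr; lra.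
Qed.

(** The mean value theorem for y^k - y^k' between x and x + u, which gains one
    power of decay; the case k' = 0 is that of a single power. *)
Lemma powR_MVT (k k' x u : R) : 0 < x -> 0 < u ->
  exists c : R, x <= c <= x + u /\
  ((x + u) `^ k - (x + u) `^ k') - (x `^ k - x `^ k') =
   u * (k * c `^ (k - 1) - k' * c `^ (k' - 1)).
Proof.
move=> x0 u0.
pose f (y : R) := y `^ k - y `^ k'.
have dpow (y : R) (j : R) : 0 < y -> is_derive y 1 (@powR R ^~ j) (j * y `^ (j - 1)).
  exact: is_derive1_powR.
have xu : x < x + u by lra.
have df y : y \in `]x, (x + u)[ -> is_derive y 1 f (k * y `^ (k - 1) - k' * y `^ (k' - 1)).
  rewrite in_itv/= => /andP[xy _]; have y0 : 0 < y by lra.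
  by apply: is_deriveB; exact: dpow.
have cf : {within `[x, (x + u)], continuous f}.
  apply: continuous_in_subspaceT => y /set_mem/=; rewrite in_itv/= => /andP[xy _].
  have y0 : 0 < y by lra.
  by apply: cvgB; exact: continuous_powR_gt0.
have [c /andP[xc cu] E] := MVT xu df cf.
exists c; split; first by move: xc cu; rewrite !bnd_simp => /ltW-> /ltW->.
by rewrite -/(f _) -/(f _) E mulrC addrAC subrr add0r.
Qed.

(** The kernel of the field, with k standing for v - 1/alpha. *)
Definition moving_kernel (k u s : R) : R := ppow (u - s) k - ppow (- s) k.

Definition env_tail (k s : R) : R := if s < -1 then (- s) `^ (k - 1) else 0.
(** For k > k2, this function dominates, up to a constant, the kernels for all
    positions u in [0, U] and all exponents in [k1, k2].  The margin k - k2
    leaves room for logarithms and for a decay of the tail. *)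
Definition env (U k s : R) : R := env_tail k s + \1_(`[-1, U] : set R) s.

Lemma env_tail_ge0 k s : 0 <= env_tail k s.
Proof. by rewrite /env_tail; case: ifP => // _; exact: powR_ge0. Qed.

Lemma env_ge0 U k s : 0 <= env U k s.
Proof. by rewrite addr_ge0 ?env_tail_ge0. Qed.

Definition env_const (U k1 k2 k3 : R) : R :=
  2 * k1^-1 + 2 * (U + 1) ^+ 2 + U * (1 + 2 * (k3 - k2)^-1).

Lemma ler_wpowRN (x y e : R) : 0 < x -> x <= y -> 0 <= e -> y `^ (- e) <= x `^ (- e).
Proof.
move=> x0 xy e0; have y0 : 0 < y by exact: lt_le_trans xy.
rewrite !powRN lef_pV2 ?posrE ?powR_gt0//.
by rewrite ge0_ler_powR// nnegrE ltW.
Qed.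

(** To the left of -m the kernel is u k c^(k-1) for some c >= -s, and
    (-s)^(k2-1) is at most m^(-(k3-k2)) (-s)^(k3-1). *)
Lemma far_left_tail (U k1 k2 k3 k u s m : R) : 0 <= U -> 0 < k1 -> k1 <= k2 -> k2 < k3 -> k3 <= 1 ->
  k1 <= k <= k2 -> 0 <= u <= U -> 1 <= m -> s < - m ->
  `|moving_kernel k u s| <= U * m `^ (- (k3 - k2)) * env U k3 s.
Proof.
move=> U0 k10 k12 k23 k31.
have i10 : 0 < k1^-1 by rewrite invr_gt0.
have i20 : 0 < (k3 - k2)^-1 by rewrite invr_gt0 subr_gt0.
move=> /andP[k1k kk2] /andP[u0 uU] m1 sm; have s0 : 0 < - s by lra.
have m0 : 0 <= m `^ (- (k3 - k2)) by exact: powR_ge0.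
move: u0; rewrite le_eqVlt => /predU1P[<-|u0].
  by rewrite /moving_kernel sub0r subrr normr0 !mulr_ge0 ?env_ge0.
have [c [/andP[xc cu]]] := @powR_MVT k 0 (- s) u s0 u0.
rewrite !powRr0 mul0r subr0 (_ : - s + u = u - s); last by rewrite addrC.
rewrite /moving_kernel /ppow s0 (_ : 0 < u - s); last by lra.
move=> E; have -> : (u - s) `^ k - (- s) `^ k = u * (k * c `^ (k - 1)) by lra.
have c0 : 0 < c by lra.
have c1 : 1 <= c by lra.
have kc0 : 0 <= k * c `^ (k - 1) by apply: mulr_ge0; [exact: le_trans (ltW k10) k1k|exact: powR_ge0].
rewrite ger0_norm; last by apply: mulr_ge0 => //; exact: ltW.
rewrite -[leRHS]mulrA; apply: ler_pM => //; first by lra.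
apply: (@le_trans _ _ (c `^ (k2 - 1))).
  rewrite -[leRHS]mul1r; apply: ler_pM; rewrite ?powR_ge0//; try lra.
  by rewrite ler_powR//; lra.
apply: (@le_trans _ _ ((- s) `^ (k2 - 1))).
  rewrite (_ : k2 - 1 = - (1 - k2)); last by lra.
  by apply: ler_wpowRN; lra.
have -> : (- s) `^ (k2 - 1) = (- s) `^ (- (k3 - k2)) * (- s) `^ (k3 - 1).
  by rewrite -powRD_gt0//; congr (_ `^ _); lra.
apply: ler_pM; rewrite ?powR_ge0//.
  by apply: ler_wpowRN; lra.
rewrite /env /env_tail (_ : s < -1); last by lra.
by rewrite lerDl.
Qed.

Lemma kernel_le_env (U k1 k2 k3 k u s : R) : 0 <= U -> 0 < k1 -> k1 <= k2 -> k2 < k3 -> k3 <= 1 ->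
  k1 <= k <= k2 -> 0 <= u <= U ->
  `|moving_kernel k u s| <= env_const U k1 k2 k3 * env U k3 s.
Proof.
move=> U0 k10 k12 k23 k31.
have i10 : 0 < k1^-1 by rewrite invr_gt0.
have i20 : 0 < (k3 - k2)^-1 by rewrite invr_gt0 subr_gt0.
rewrite /env_const; set C := (X in X * _).
move=> kk uU; have [s1|s1] := ltP s (-1).
  apply: le_trans (far_left_tail U0 k10 k12 k23 k31 kk uU (lexx 1) s1) _.
  rewrite powR1 mulr1 ler_wpM2r ?env_ge0// /C.
  have := mulr_ge0 U0 (ltW i20); have := sqr_ge0 (U + 1); lra.
have [sU|sU] := leP s U.
  rewrite /env indicE mem_set/= ?in_itv/= ?s1 ?sU// /env_tail ltNge s1/= add0r mulr1.
  move: kk uU => /andP[k1k kk2] /andP[u0 uU].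
  have kk1 : 0 <= k <= 1 by lra.
  have A1 : 0 <= ppow (u - s) k <= U + 1 by rewrite ppow_ge0 ppow_le//; lra.
  have A2 : 0 <= ppow (- s) k <= U + 1 by rewrite ppow_ge0 ppow_le//; lra.
  apply: (@le_trans _ _ (U + 1)).
    by rewrite /moving_kernel ler_norml; lra.
  rewrite /C; have := mulr_ge0 U0 (ltW i20); nra.
rewrite /moving_kernel /ppow (_ : 0 < u - s = false); last by apply/negbTE; lra.
rewrite (_ : 0 < - s = false); last by apply/negbTE; lra.
rewrite subrr normr0 mulr_ge0 ?env_ge0// /C.
have := mulr_ge0 U0 (ltW i20); have := sqr_ge0 (U + 1); lra.
Qed.

(** On the left, the mean value theorem in u followed by the Lipschitz bound in
    the exponent; the factor ln c is absorbed by c^(k3-k2). *)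
Lemma kernel_lipschitz_env (U k1 k2 k3 k k' u s : R) : 0 <= U -> 0 < k1 -> k1 <= k2 -> k2 < k3 -> k3 <= 1 ->
  k1 <= k <= k2 -> k1 <= k' <= k2 ->
  0 <= u <= U ->
  `|moving_kernel k u s - moving_kernel k' u s| <= (2 * env_const U k1 k2 k3 * `|k - k'|) * env U k3 s.
Proof.
move=> U0 k10 k12 k23 k31.
have i10 : 0 < k1^-1 by rewrite invr_gt0.
have i20 : 0 < (k3 - k2)^-1 by rewrite invr_gt0 subr_gt0.
rewrite /env_const; set C := (X in 2 * X * _).
move=> /andP[k1k kk2] /andP[k1k' kk2'] /andP[u0 uU].
have UC : 0 <= U * (k3 - k2)^-1 by rewrite mulr_ge0// ltW.
have SC := sqr_ge0 (U + 1).
have C0 : 0 <= C by rewrite /C; lra.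
have [s1|s1] := ltP s (-1); last first.
  have [sU|sU] := leP s U; last first.
    rewrite /moving_kernel /ppow (_ : 0 < u - s = false); last by apply/negbTE; lra.
    rewrite (_ : 0 < - s = false); last by apply/negbTE; lra.
    by rewrite !subrr normr0 !mulr_ge0 ?env_ge0.
  rewrite /env indicE mem_set/= ?in_itv/= ?s1 ?sU// /env_tail ltNge s1/= add0r mulr1.
  have e1 : `|ppow (u - s) k - ppow (u - s) k'| <= `|k - k'| * C.
    apply: le_trans (@ppow_lipschitz _ _ _ U k1 _ _ _ _ _) _ => //; try lra.
    by rewrite ler_wpM2l// /C; lra.
  have e2 : `|ppow (- s) k - ppow (- s) k'| <= `|k - k'| * C.
    apply: le_trans (@ppow_lipschitz _ _ _ U k1 _ _ _ _ _) _ => //; try lra.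
    by rewrite ler_wpM2l// /C; lra.
  rewrite /moving_kernel (_ : _ - _ - _ = (ppow (u - s) k - ppow (u - s) k')
     - (ppow (- s) k - ppow (- s) k')); last by lra.
  by apply: le_trans (ler_normB _ _) _; lra.
have s0 : 0 < - s by lra.
move: u0; rewrite le_eqVlt => /predU1P[<-|u0].
  by rewrite /moving_kernel !sub0r !subrr normr0 !mulr_ge0 ?env_ge0.
have [c [/andP[xc cu] E]] := @powR_MVT k k' (- s) u s0 u0.
rewrite /moving_kernel /ppow s0 (_ : 0 < u - s); last by lra.
rewrite (addrC (- s)) in E.
have -> : (u - s) `^ k - (- s) `^ k - ((u - s) `^ k' - (- s) `^ k') =
  u * (k * c `^ (k - 1) - k' * c `^ (k' - 1)) by lra.
have c0 : 0 < c by lra.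
have c1 : 1 <= c by lra.
rewrite normrM (gtr0_norm u0).
have P3 : 0 <= c `^ (k3 - 1) by exact: powR_ge0.
have lec j : j <= k2 -> c `^ (j - 1) <= c `^ (k2 - 1).
  by move=> jk; rewrite ler_powR//; lra.
have c23 : c `^ (k2 - 1) <= c `^ (k3 - 1) by rewrite ler_powR//; lra.
have lnc : 0 <= ln c by exact: ln_ge0.
have lncP : ln c * c `^ (k2 - 1) <= (k3 - k2)^-1 * c `^ (k3 - 1).
  have -> : c `^ (k3 - 1) = c `^ (k3 - k2) * c `^ (k2 - 1).
    by rewrite -powRD_gt0//; congr (_ `^ _); lra.
  rewrite mulrA ler_wpM2r ?powR_ge0//; apply: ln_le_powR => //; lra.
have B : `|k * c `^ (k - 1) - k' * c `^ (k' - 1)| <=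
         `|k - k'| * ((1 + 2 * (k3 - k2)^-1) * c `^ (k3 - 1)).
  rewrite (_ : _ - _ = (k - k') * c `^ (k - 1) + k' * (c `^ (k - 1) - c `^ (k' - 1))); last by lra.
  apply: le_trans (ler_normD _ _) _; rewrite !normrM.
  have h1 : `|k - k'| * `|c `^ (k - 1)| <= `|k - k'| * c `^ (k3 - 1).
    rewrite ler_wpM2l// ger0_norm ?powR_ge0//.
    exact: le_trans (lec _ kk2) c23.
  have h2 : `|k'| * `|c `^ (k - 1) - c `^ (k' - 1)| <=
      `|k - k'| * (2 * (k3 - k2)^-1 * c `^ (k3 - 1)).
    have h3 := norm_powR_sub (k - 1) (k' - 1) c0.
    rewrite (_ : k - 1 - (k' - 1) = k - k') in h3; last by lra.
    rewrite (ger0_norm lnc) in h3.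
    apply: (@le_trans _ _ (1 * `|c `^ (k - 1) - c `^ (k' - 1)|)).
      rewrite ler_wpM2r// ger0_norm; last exact: le_trans (ltW k10) k1k'.
      exact: le_trans kk2' (le_trans (ltW k23) k31).
    rewrite mul1r; apply: le_trans h3 _; rewrite ler_wpM2l//.
    have := ler_wpM2l lnc (lec _ kk2); have := ler_wpM2l lnc (lec _ kk2').
    by rewrite mulrDr -mulrA; lra.
  by rewrite mulrDl mul1r mulrDr; lra.
have Penv : c `^ (k3 - 1) <= env U k3 s.
  rewrite /env /env_tail s1.
  apply: (@le_trans _ _ ((- s) `^ (k3 - 1))); last by rewrite lerDl.
  by rewrite -[k3 - 1]opprB; apply: ler_wpowRN => //; rewrite subr_ge0.
apply: (@le_trans _ _ (U * (`|k - k'| * ((1 + 2 * (k3 - k2)^-1) * env U k3 s)))).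
  apply: ler_pM => //; first exact: ltW.
  apply: le_trans B _; rewrite ler_wpM2l// ler_wpM2l//; lra.
rewrite mulrCA (mulrC _ `|k - k'|) -!mulrA ler_wpM2l// !mulrA ler_wpM2r ?env_ge0// /C.
lra.
Qed.

End KernelBounds.

Section KernelIntegrability.
Context {R : realType}.
Local Notation mu := (@lebesgue_measure R).

Lemma measurable_ppow (k : R) : measurable_fun [set: R] (ppow ^~ k).
Proof.
apply: measurable_fun_ifT => //; exact: measurable_fun_ltr.
Qed.

Lemma measurable_moving_kernel (k u : R) : measurable_fun [set: R] (moving_kernel k u).
Proof.
apply: measurable_funB.
  by apply: (measurableT_comp (measurable_ppow k)); exact: measurable_funB.
by apply: (measurableT_comp (measurable_ppow k)).
Qed.

(** The condition on k makes (-s)^(alpha (k-1)) integrable at -oo. *)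
Lemma env_Lalpha (alpha U k : R) : 1 < alpha -> alpha * (k - 1) < -1 -> 0 <= U ->
  env U k \in Lalpha alpha.
Proof.
move=> a1 ak U0; have a0 : 0 < alpha by lra.
have mt : measurable_fun [set: R] (env_tail k).
  apply: measurable_fun_ifT => //; first exact: measurable_fun_ltr.
  exact: (measurableT_comp (measurable_powR (k - 1)) (@oppr_measurable R setT)).
have ht : env_tail k \in Lalpha alpha.
  apply/LalphaP => //; split => //.
  rewrite power_integral.unlock -integral_reflect; last 2 first.
  - exact: measurable_abs_pow.
  - by move=> s; rewrite lee_fin powR_ge0.
  apply: le_lt_trans (integral_powR_tail_lty ak).
  rewrite [leRHS]integral_mkcond; apply: ge0_le_integral => //.
  - exact: (measurableT_comp (measurable_abs_pow alpha mt) (@oppr_measurable R setT)).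
  - have mp : measurable_fun [set: R] (fun s : R => (s `^ (alpha * (k - 1)))%:E).
      by apply/measurable_EFinP; exact: measurable_powR.
    apply/(measurable_restrictT (fun s : R => (s `^ (alpha * (k - 1)))%:E)) => //.
    exact: measurable_funTS.
  move=> s _; rewrite /patch mem_setE/= in_itv/= andbT /env_tail opprK ltrNl opprK.
  have [s1|s1] := ltP 1 s.
    rewrite (ltW s1) lee_fin ger0_norm ?powR_ge0// -powRrM mulrC; lra.
  rewrite normr0 powR0 ?gt_eqF//; case: ifP => // _.
  by rewrite lee_fin powR_ge0.
have hi : (\1_(`[-1, U] : set R) : R -> R) \in Lalpha alpha.
  apply/LalphaP => //; split => //.
  rewrite power_integral.unlock.
  have -> : (\int[mu]_s (`|(\1_(`[-1, U] : set R) : R -> R) s| `^ alpha)%:E =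
             \int[mu]_s (\1_(`[-1%R, U] : set R) s)%:E)%E.
    apply: eq_integral => s _; rewrite indicE; case: (_ \in _) => /=.
      by rewrite normr1 powR1.
    by rewrite normr0 powR0// gt_eqF.
  rewrite integral_indic//= setIT lebesgue_measure_itv/=.
  by case: ifP => _; rewrite ?ltry// -EFinB ltry.
have -> : env U k = (fun s => 1 * env_tail k s + \1_(`[-1, U] : set R) s).
  by apply/funext => s; rewrite mul1r.
exact: Lalpha_lin.
Qed.

End KernelIntegrability.

(** * The L-th difference of the kernel *)

Section FilteredKernel.
Context {R : realType}.

Definition diff_coef (L l : nat) : R := (-1) ^+ (L - l) * 'C(L, l)%:R.

(** The constant lost when the triangle inequality is applied to an L-th
    difference. *)
Definition diff_mass (L : nat) : R := \sum_(l < L.+1) `|diff_coef L l|.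

Lemma diff_mass_ge0 L : 0 <= diff_mass L.
Proof. exact: sumr_ge0. Qed.

Lemma sum_diff_coef (L : nat) : (0 < L)%N -> \sum_(l < L.+1) diff_coef L l = 0.
Proof.
move=> L0; have := @exprDn R (-1) 1 L; rewrite addNr expr0n (gtn_eqF L0) /= => E.
apply/esym; apply: etrans E _.
by apply: eq_bigr => l _; rewrite /diff_coef expr1n mulr1 mulr_natr.
Qed.

(** The kernel of the L-th increment of the field at unit scale and
    constant exponent. *)
Definition phi (L : nat) (k x : R) : R :=
  \sum_(l < L.+1) diff_coef L l * ppow (l%:R - x) k.

(** The coefficients of an L-th difference sum to 0, so the terms that do not
    depend on l can be added at will. *)
Lemma phi_moving (L : nat) (k x : R) : (0 < L)%N ->
  phi L k x = \sum_(l < L.+1) diff_coef L l * moving_kernel k l%:R x.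
Proof.
move=> L0; rewrite /moving_kernel.
under [RHS]eq_bigr do rewrite mulrBr.
by rewrite sumrB -mulr_suml sum_diff_coef// mul0r subr0.
Qed.

Lemma ppow_scale (a y k : R) : 0 < a -> ppow (a^-1 * y) k = a `^ (- k) * ppow y k.
Proof.
move=> a0; rewrite /ppow pmulr_rgt0 ?invr_gt0//; case: ltP => y0; last by rewrite mulr0.
rewrite powRM ?invr_ge0 ?(ltW a0) ?(ltW y0)//; congr (_ * _).
by rewrite -(powR_inv1 (ltW a0)) -powRrM mulN1r.
Qed.

(** Self-similarity: at constant exponent, the kernel of the increment at
    j/N is a rescaled translate of phi. *)
Lemma increment_kernel_scale (L N j : nat) (k s : R) : (0 < L)%N -> (0 < N)%N ->
  \sum_(l < L.+1) diff_coef L l * moving_kernel k ((j + l)%:R / N%:R) s =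
  N%:R `^ (- k) * phi L k (N%:R * s + - j%:R).
Proof.
move=> L0 N0; have Np : 0 < N%:R :> R by rewrite ltr0n.
rewrite /moving_kernel; under [LHS]eq_bigr do rewrite mulrBr.
rewrite sumrB -mulr_suml sum_diff_coef// mul0r subr0 /phi mulr_sumr.
apply: eq_bigr => l _; rewrite mulrCA; congr (_ * _).
rewrite -ppow_scale//; congr (ppow _ _).
by rewrite natrD; field; rewrite gt_eqF.
Qed.

Lemma sum_diff_bound (L : nat) (f : nat -> R) (e : R) :
  (forall l, (l <= L)%N -> `|f l| <= e) ->
  `|\sum_(l < L.+1) diff_coef L l * f l| <= diff_mass L * e.
Proof.
move=> fe; apply: le_trans (ler_norm_sum _ _ _) _.
rewrite /diff_mass mulr_suml; apply: ler_sum => l _.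
by rewrite normrM ler_wpM2l// fe// -ltnS.
Qed.

Lemma phi_right (L : nat) (k x : R) : L%:R <= x -> phi L k x = 0.
Proof.
move=> Lx; rewrite /phi big1// => l _.
rewrite /ppow ltNge subr_le0 (le_trans _ Lx) ?mulr0// ler_nat -ltnS //.
Qed.

Lemma phi_last (L : nat) (k x : R) : (0 < L)%N -> L.-1%:R <= x < L%:R ->
  phi L k x = (L%:R - x) `^ k.
Proof.
move=> L0 /andP[x1 x2]; rewrite /phi big_ord_recr/= big1 => [|l _].
  by rewrite add0r /diff_coef subnn expr0 binn !mul1r /ppow subr_gt0 x2.
rewrite /ppow ltNge subr_le0 (le_trans _ x1) ?mulr0// ler_nat.
by rewrite -ltnS prednK.
Qed.

Lemma measurable_phi (L : nat) (k : R) : measurable_fun [set: R] (phi L k).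
Proof.
apply: measurable_sum => l; apply: measurable_funM => //.
apply: (measurableT_comp (measurable_ppow k)).
exact: measurable_funB.
Qed.

Section Bounds.
Variables (L : nat) (k1 k2 k3 : R).

Lemma phi_le_env (k x : R) : (0 < L)%N -> 0 < k1 -> k1 <= k2 -> k2 < k3 -> k3 <= 1 ->
  k1 <= k <= k2 ->
  `|phi L k x| <= diff_mass L * env_const L%:R k1 k2 k3 * env L%:R k3 x.
Proof.
move=> L0 k10 k12 k23 k31 kk; rewrite phi_moving// -mulrA.
apply: (@sum_diff_bound _ (fun l => moving_kernel k l%:R x)) => l lL.
by apply: kernel_le_env => //; rewrite ler0n ler_nat.
Qed.

Lemma phi_tail (k x m : R) : (0 < L)%N -> 0 < k1 -> k1 <= k2 -> k2 < k3 -> k3 <= 1 ->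
  k1 <= k <= k2 -> 1 <= m -> x < - m ->
  `|phi L k x| <= diff_mass L * L%:R * m `^ (- (k3 - k2)) * env L%:R k3 x.
Proof.
move=> L0 k10 k12 k23 k31 kk m1 xm; rewrite phi_moving// -!mulrA.
apply: (@sum_diff_bound _ (fun l => moving_kernel k l%:R x)) => l lL.
rewrite mulrA; apply: (@far_left_tail _ _ k1 k2 k3) => //; by rewrite ler0n ler_nat.
Qed.

Lemma phi_lipschitz (k k' x : R) : (0 < L)%N -> 0 < k1 -> k1 <= k2 -> k2 < k3 -> k3 <= 1 ->
  k1 <= k <= k2 -> k1 <= k' <= k2 ->
  `|phi L k x - phi L k' x| <=
  diff_mass L * (2 * env_const L%:R k1 k2 k3 * `|k - k'|) * env L%:R k3 x.
Proof.
move=> L0 k10 k12 k23 k31 kk kk'; rewrite !phi_moving// -sumrB -mulrA.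
under eq_bigr do rewrite -mulrBr.
apply: (@sum_diff_bound _ (fun l => moving_kernel k l%:R x - moving_kernel k' l%:R x)) => l lL.
by apply: kernel_lipschitz_env => //; rewrite ler0n ler_nat.
Qed.

End Bounds.

Lemma env_const_ge0 (U k1 k2 k3 : R) : 0 <= U -> 0 < k1 -> k2 < k3 ->
  0 <= env_const U k1 k2 k3.
Proof.
move=> U0 k10 k23; rewrite /env_const.
have i10 : 0 < k1^-1 by rewrite invr_gt0.
have i20 : 0 < (k3 - k2)^-1 by rewrite invr_gt0 subr_gt0.
have := sqr_ge0 (U + 1); have := mulr_ge0 U0 (ltW i20); lra.
Qed.

(** On [L-1, L) only the term l = L of phi survives; it is at least 1/2 on the
    first half of this interval. *)
Lemma phi_norm_lower (alpha k : R) (L : nat) : 1 < alpha -> (0 < L)%N -> 0 <= k <= 1 ->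
  phi L k \in Lalpha alpha ->
  2^-1 * (2^-1) `^ alpha^-1 <= Lalpha_norm alpha (phi L k).
Proof.
move=> a1 L0 /andP[k0 k1] hphi.
have LE : L%:R = L.-1%:R + 1 :> R by rewrite natr1 prednK.
have := @Lalpha_norm_gt0 _ _ a1 _ (L.-1%:R) (L.-1%:R + 2^-1) (2^-1) hphi.
rewrite (_ : L.-1%:R + 2^-1 - L.-1%:R = 2^-1); last by rewrite addrAC subrr add0r.
apply.
- by rewrite ltrDl invr_gt0.
- by rewrite invr_gt0.
move=> s /andP[s1 s2].
rewrite phi_last//; last by rewrite s1/= LE; lra.
rewrite ger0_norm ?powR_ge0//.
apply: (@le_trans _ _ ((2^-1) `^ k)).
  by apply: ger1_powR => //; lra.
by apply: ge0_ler_powR; rewrite ?nnegrE//; lra.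
Qed.

End FilteredKernel.

(** * A weak law for sums with a finite range of dependence *)

Section WeakLaw.
Context {d : measure_display} {T : measurableType d} {R : realType}.
Variable P : probability T R.

Lemma card_near (n M : nat) (k : 'I_n) :
  (#|[set j : 'I_n | (k < j + M) && (j < k + M)]%SET| <= 2 * M)%N.
Proof.
rewrite cardE -(size_map val) -[leqRHS](size_iota (k.+1 - M)).
apply: uniq_leq_size; first by rewrite map_inj_uniq ?enum_uniq//; exact: val_inj.
move=> x /mapP[j]; rewrite mem_enum inE => /andP[h1 h2] ->.
rewrite mem_iota /=; move: h1 h2; move: (nat_of_ord j) (nat_of_ord k) => a b h1 h2.
by apply/andP; split; lia.
Qed.

Lemma measurable_sum_cond (I : Type) (r : seq I) (F : pred I) (f : I -> T -> R) :
  (forall i, measurable_fun [set: T] (f i)) ->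
  measurable_fun [set: T] (fun w => \sum_(i <- r | F i) f i w).
Proof.
by move=> mf; under eq_fun do rewrite -big_filter; exact: measurable_sum.
Qed.

Lemma integral_EFin_sum (I : Type) (r : seq I) (F : pred I) (f : I -> T -> R) :
  (forall i, measurable_fun [set: T] (f i)) -> (forall i w, 0 <= f i w) ->
  (\int[P]_w (\sum_(i <- r | F i) f i w)%:E =
   \sum_(i <- r | F i) \int[P]_w (f i w)%:E)%E.
Proof.
move=> mf f0; under eq_integral do rewrite -sumEFin.
rewrite -big_filter; under eq_integral do rewrite -big_filter.
rewrite ge0_integral_sum//.
- by move=> i; apply/measurable_EFinP.
- by move=> i w _; rewrite lee_fin.
Qed.

(** Only pairs at distance less than M contribute to the variance, there are
    at most 2M of them for each index, and each contributes at most
    (q_k + q_j)/2. *)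
Lemma variance_le (n : nat) (A : {set 'I_n}) (W : 'I_n -> T -> R)
    (m q : 'I_n -> R) (M : nat) :
  (forall k, measurable_fun [set: T] (W k)) -> (forall k w, 0 <= W k w) ->
  (forall k, (\int[P]_w (W k w)%:E = (m k)%:E)%E) ->
  (forall k, (\int[P]_w (W k w ^+ 2)%:E = (q k)%:E)%E) ->
  (forall k j : 'I_n, (k + M <= j)%N || (j + M <= k)%N ->
     (\int[P]_w (W k w * W j w)%:E = (m k * m j)%:E)%E) ->
  (\int[P]_w ((\sum_(k in A) W k w - \sum_(k in A) m k) ^+ 2)%:E <=
    ((2 * M)%:R * \sum_(k in A) q k)%:E)%E.
Proof.
move=> mW W0 hm hq hfar.
pose S w := \sum_(k in A) W k w; pose s := \sum_(k in A) m k.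
have mS : measurable_fun [set: T] S by apply: measurable_sum_cond.
have m0 k : 0 <= m k.
  by rewrite -lee_fin -hm integral_ge0// => w _; rewrite lee_fin.
have q0 k : 0 <= q k.
  by rewrite -lee_fin -hq integral_ge0// => w _; rewrite lee_fin sqr_ge0.
have S0 w : 0 <= S w by exact: sumr_ge0.
have s0 : 0 <= s by exact: sumr_ge0.
have IS : (\int[P]_w (S w)%:E = s%:E)%E.
  by rewrite integral_EFin_sum// -sumEFin; apply: eq_bigr => k _; rewrite hm.
pose near (k j : 'I_n) := (k < j + M)%N && (j < k + M)%N.
pose b k j := m k * m j + (if near k j then 2^-1 * (q k + q j) else 0).
have IS2 : (\int[P]_w (S w ^+ 2)%:E <= (\sum_(k in A) \sum_(j in A) b k j)%:E)%E.
  have -> : (fun w => (S w ^+ 2)%:E) =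
      (fun w => (\sum_(k in A) \sum_(j in A) W k w * W j w)%:E).
    apply/funext => w; rewrite expr2 /S mulr_suml; congr (_%:E).
    by apply: eq_bigr => k _; rewrite mulr_sumr.
  rewrite integral_EFin_sum; last 2 first.
  - by move=> k; apply: measurable_sum_cond => j; exact: measurable_funM.
  - by move=> k w; apply: sumr_ge0 => j _; rewrite mulr_ge0.
  rewrite -sumEFin; apply: lee_sum => k _.
  rewrite integral_EFin_sum; last 2 first.
  - by move=> j; exact: measurable_funM.
  - by move=> j w; rewrite mulr_ge0.
  rewrite -sumEFin; apply: lee_sum => j _.
  rewrite /b; case: ifPn => [_|].
    apply: (@le_trans _ _ (2^-1 * (q k + q j))%:E).
      apply: (@le_trans _ _ (\int[P]_w (2^-1 * (W k w ^+ 2 + W j w ^+ 2))%:E)%E).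
        apply: integral_ge0_mono => w; first by rewrite lee_fin mulr_ge0.
        by rewrite lee_fin; have := sqr_ge0 (W k w - W j w); nra.
      have mW2 i : measurable_fun [set: T] (fun w => (W i w ^+ 2)%:E).
        by apply/measurable_EFinP; exact: measurable_funX.
      have W20 i w : (0 <= (W i w ^+ 2)%:E)%E by rewrite lee_fin sqr_ge0.
      under eq_integral do rewrite EFinM EFinD.
      rewrite ge0_integralZl//; first last.
      - by move=> w _; rewrite adde_ge0.
      - exact: emeasurable_funD.
      by rewrite ge0_integralD// !hq.
    by rewrite lee_fin lerDr mulr_ge0.
  rewrite /near negb_and -!leqNgt orbC => far.
  by rewrite addr0 hfar.
have V : (\int[P]_w ((S w - s) ^+ 2)%:E + (2 * s * s)%:E =
    \int[P]_w (S w ^+ 2)%:E + (s ^+ 2)%:E)%E.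
  have -> : ((2 * s * s)%:E = \int[P]_w (2 * s * S w)%:E)%E.
    under eq_integral do rewrite EFinM.
    rewrite ge0_integralZl//.
    - by rewrite IS -EFinM.
    - exact/measurable_EFinP.
    - by move=> w _; rewrite lee_fin.
    - by rewrite lee_fin mulr_ge0.
  have -> : ((s ^+ 2)%:E = \int[P]_w (cst (s ^+ 2)%:E w))%E.
    by rewrite integral_cst//= probability_setT mule1.
  have mSs : measurable_fun [set: T] (fun w => ((S w - s) ^+ 2)%:E).
    by apply/measurable_EFinP; apply: measurable_funX; exact: measurable_funB.
  have mSS : measurable_fun [set: T] (fun w => (S w ^+ 2)%:E).
    by apply/measurable_EFinP; exact: measurable_funX.
  have m2S : measurable_fun [set: T] (fun w => (2 * s * S w)%:E).
    by apply/measurable_EFinP; exact: measurable_funM.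
  rewrite -!ge0_integralD//; first last.
  - by move=> w _; rewrite lee_fin mulr_ge0// mulr_ge0.
  - by move=> w _; rewrite lee_fin sqr_ge0.
  - by move=> w _; rewrite /= lee_fin sqr_ge0.
  - by move=> w _; rewrite lee_fin sqr_ge0.
  by apply: eq_integral => w _; rewrite /= -!EFinD; congr (_%:E); ring.
have sum_b : \sum_(k in A) \sum_(j in A) b k j <=
    s ^+ 2 + (2 * M)%:R * \sum_(k in A) q k.
  rewrite /b; under eq_bigr do rewrite big_split/=.
  rewrite big_split/= expr2 {1}/s mulr_suml lerD//.
    by apply: ler_sum => k _; rewrite -mulr_sumr.
  have half : \sum_(k in A) \sum_(j in A) (if near k j then 2^-1 * q k else 0) <=
      2^-1 * ((2 * M)%:R * \sum_(k in A) q k).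
    rewrite mulrCA mulr_sumr mulr_sumr; apply: ler_sum => k _.
    rewrite -big_mkcondr/= sumr_const.
    rewrite -[leLHS]mulr_natl ler_wpM2r ?mulr_ge0// ler_nat.
    apply: leq_trans (card_near M k); apply: subset_leq_card.
    by apply/fintype.subsetP => j; rewrite !inE => /andP[].
  have -> : \sum_(k in A) \sum_(j in A) (if near k j then 2^-1 * (q k + q j) else 0) =
     \sum_(k in A) \sum_(j in A) (if near k j then 2^-1 * q k else 0) +
     \sum_(k in A) \sum_(j in A) (if near k j then 2^-1 * q k else 0).
    rewrite [X in _ + X]exchange_big/= -big_split/=; apply: eq_bigr => k _.
    rewrite -big_split/=; apply: eq_bigr => j _.
    rewrite [near j k]andbC -/(near k j); case: ifP => _; last by rewrite addr0.
    by rewrite mulrDr.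
  by apply: le_trans (lerD half half) _; lra.
rewrite -(@leeD2rE _ (2 * s * s)%:E)//.
move: V => /= ->; apply: le_trans (leeD2r _ IS2) _.
by rewrite -!EFinD lee_fin; move: sum_b; nra.
Qed.

(** The variables D are close in L^1 to variables W with a finite range M of
    dependence, and mu is close to the means of W.  The variance bound for W
    is turned into an L^1 bound by |x| <= (l + x^2 / l) / 2, and the ratios
    mu_k / mu_j being at most Q gives the gain of a factor Q / #|A| over the
    square of the sum. *)
Lemma weak_law (n : nat) (A : {set 'I_n}) (D W : 'I_n -> T -> R)
    (mu m q : 'I_n -> R) (M : nat) (tau K Q lam : R) :
  (0 < #|A|)%N -> 0 <= tau -> 0 < lam -> 0 <= K -> 0 <= Q ->
  (forall k, 0 < mu k) ->
  (forall k, measurable_fun [set: T] (D k)) ->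
  (forall k, measurable_fun [set: T] (W k)) -> (forall k w, 0 <= W k w) ->
  (forall k, (\int[P]_w (W k w)%:E = (m k)%:E)%E) ->
  (forall k, (\int[P]_w (W k w ^+ 2)%:E = (q k)%:E)%E) ->
  (forall k j : 'I_n, (k + M <= j)%N || (j + M <= k)%N ->
     (\int[P]_w (W k w * W j w)%:E = (m k * m j)%:E)%E) ->
  (forall k, (\int[P]_w (`|D k w - W k w|)%:E <= (tau * mu k)%:E)%E) ->
  (forall k, `|m k - mu k| <= tau * mu k) ->
  (forall k, q k <= K * mu k ^+ 2) ->
  (forall k j, mu k <= Q * mu j) ->
  (\int[P]_w (`|\sum_(k in A) D k w - \sum_(k in A) mu k|)%:E <=
   ((2 * tau + 2^-1 * (lam + (2 * M)%:R * K * Q / #|A|%:R / lam)) *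
     \sum_(k in A) mu k)%:E)%E.
Proof.
move=> A0 tau0 lam0 K0 Q0 mu0 mD mW W0 hm hq hfar hD hmu hqK hQ.
set s := \sum_(k in A) mu k.
have [k0 k0A] : exists k0, k0 \in A by apply/set0Pn; rewrite -card_gt0.
have s0 : 0 < s.
  rewrite /s (bigD1 k0)//= ltr_pwDl//; apply: sumr_ge0 => k _; exact: ltW.
have cA : 0 < #|A|%:R :> R by rewrite ltr0n.
(* the threshold l is a small multiple of the sum s *)
pose l := lam * s; have l0 : 0 < l by exact: mulr_gt0.
pose S w := \sum_(k in A) W k w; pose sm := \sum_(k in A) m k.
have mS : measurable_fun [set: T] S by apply: measurable_sum_cond.
have V := variance_le A mW W0 hm hq hfar.
have mu_le k : mu k <= Q / #|A|%:R * s.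
  rewrite -mulrA mulrCA ler_pdivlMl// mulr_natl -sumr_const mulr_sumr.
  exact: ler_sum.
have Q2 : \sum_(k in A) q k <= K * (Q / #|A|%:R) * s ^+ 2.
  rewrite expr2 [leRHS]mulrA {2}/s mulr_sumr; apply: ler_sum => k _.
  apply: le_trans (hqK k) _; rewrite expr2 mulrA ler_wpM2r ?(ltW (mu0 k))//.
  by rewrite -mulrA ler_wpM2l.
have V2 : (\int[P]_w ((S w - sm) ^+ 2)%:E <=
    ((2 * M)%:R * (K * (Q / #|A|%:R) * s ^+ 2))%:E)%E.
  by apply: le_trans V _; rewrite lee_fin ler_wpM2l.
have mSs : measurable_fun [set: T] (fun w => (S w - sm) ^+ 2).
  by apply: measurable_funX; exact: measurable_funB.
have mDW k : measurable_fun [set: T] (fun w => `|D k w - W k w|).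
  by apply: (measurableT_comp (@normr_measurable R setT)); exact: measurable_funB.
pose B w := 2^-1 * l + 2^-1 * l^-1 * (S w - sm) ^+ 2.
have mB : measurable_fun [set: T] B.
  by apply: measurable_funD => //; exact: measurable_funM.
have B0 w : 0 <= B w.
  have l1 : 0 <= l^-1 by rewrite invr_ge0 ltW.
  by apply: addr_ge0; [rewrite mulr_ge0// ltW|rewrite mulr_ge0 ?sqr_ge0// mulr_ge0].
have pointwise w : `|\sum_(k in A) D k w - s| <=
    \sum_(k in A) `|D k w - W k w| + (B w + tau * s).
  have -> : \sum_(k in A) D k w - s = \sum_(k in A) (D k w - W k w) +
     ((S w - sm) + (sm - s)) by rewrite sumrB /S; lra.
  apply: le_trans (ler_normD _ _) (lerD (ler_norm_sum _ _ _) _).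
  apply: le_trans (ler_normD _ _) (lerD _ _); last first.
    rewrite /sm /s -sumrB mulr_sumr; apply: le_trans (ler_norm_sum _ _ _) _.
    exact: ler_sum.
  rewrite /B -(real_normK (num_real (S w - sm))).
  set x := `|_|.
  rewrite -subr_ge0.
  have -> : 2^-1 * l + 2^-1 * l^-1 * x ^+ 2 - x = 2^-1 * (l^-1 * (x - l) ^+ 2).
    by field; rewrite gt_eqF.
  by rewrite mulr_ge0// mulr_ge0 ?sqr_ge0// invr_ge0 ltW.
apply: (@le_trans _ _ (\int[P]_w (\sum_(k in A) `|D k w - W k w| + (B w + tau * s))%:E)%E).
  by apply: integral_ge0_mono => w; rewrite lee_fin.
under eq_integral do rewrite EFinD.
rewrite ge0_integralD//; first last.
- by apply/measurable_EFinP; exact: measurable_funD.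
- by move=> w _; rewrite lee_fin addr_ge0// mulr_ge0// ltW.
- by apply/measurable_EFinP; exact: measurable_sum_cond.
- by move=> w _; rewrite lee_fin sumr_ge0.
rewrite integral_EFin_sum//.
have IB : (\int[P]_w (B w + tau * s)%:E <=
   (2^-1 * (lam + (2 * M)%:R * K * Q / #|A|%:R / lam) * s + tau * s)%:E)%E.
  under eq_integral do rewrite EFinD.
  rewrite ge0_integralD//; first last.
  - by move=> w _; rewrite lee_fin mulr_ge0// ltW.
  - exact/measurable_EFinP.
  - by move=> w _; rewrite lee_fin.
  rewrite EFinD; apply: leeD; last first.
    have -> : (fun _ : T => (tau * s)%:E) = cst (tau * s)%:E by [].
    by rewrite integral_cst//= probability_setT mule1.
  under eq_integral do rewrite EFinD.
  rewrite ge0_integralD//; first last.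
  - by apply/measurable_EFinP; exact: measurable_funM.
  - by move=> w _; rewrite lee_fin mulr_ge0 ?sqr_ge0// mulr_ge0 ?invr_ge0 ?(ltW l0).
  - by move=> w _; rewrite lee_fin mulr_ge0 ?(ltW l0).
  have -> : (fun _ : T => (2^-1 * l)%:E) = cst (2^-1 * l)%:E by [].
  rewrite integral_cst//= probability_setT mule1.
  under eq_integral do rewrite EFinM.
  rewrite ge0_integralZl//; first last.
  - by rewrite lee_fin mulr_ge0 ?invr_ge0 ?(ltW l0).
  - by move=> w _; rewrite lee_fin sqr_ge0.
  - exact/measurable_EFinP.
  apply: (@le_trans _ _ ((2^-1 * l)%:E + (2^-1 * l^-1)%:E *
      ((2 * M)%:R * (K * (Q / #|A|%:R) * s ^+ 2))%:E)%E).
    by rewrite leeD2l// lee_wpmul2l// lee_fin mulr_ge0 ?invr_ge0 ?(ltW l0).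
  rewrite -EFinM -EFinD lee_fin /l le_eqVlt; apply/orP; left; apply/eqP.
  by field; rewrite !gt_eqF.
apply: (@le_trans _ _ ((\sum_(k in A) tau * mu k)%:E +
   (2^-1 * (lam + (2 * M)%:R * K * Q / #|A|%:R / lam) * s + tau * s)%:E)%E).
  apply: leeD => //; rewrite -sumEFin; apply: lee_sum => k _; exact: hD.
by rewrite -mulr_sumr -/s -EFinD lee_fin; lra.
Qed.

End WeakLaw.

(** * Moments of stable integrals *)

Section PowerInequalities.
Context {R : realType}.

Lemma powR_subadd (x y b : R) : 0 <= x -> 0 <= y -> 0 < b <= 1 ->
  (x + y) `^ b <= x `^ b + y `^ b.
Proof.
move=> x0 y0 /andP[b0 b1].
have [s0|s0] := leP (x + y) 0.
  have [-> ->] : x = 0 /\ y = 0 by split; lra.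
  by rewrite addr0 !powR0 ?gt_eqF// addr0.
have h (z : R) : 0 <= z -> z <= x + y -> z / (x + y) * (x + y) `^ b <= z `^ b.
  move=> z0 zs; have sb := powR_ge0 (x + y) b.
  have [->|zn0] := eqVneq z 0; first by rewrite !mul0r powR_ge0.
  have zp : 0 < z by rewrite lt_neqAle eq_sym zn0.
  rewrite -[in leRHS](divfK (lt0r_neq0 s0) z) powRM ?divr_ge0 ?(ltW s0)//.
  rewrite ler_wpM2r//; apply: ger1_powR => //.
  by rewrite divr_gt0//= ler_pdivrMr// mul1r.
have hx := h x x0; have hy := h y y0.
rewrite -[leLHS]mul1r -{1}(mulfV (lt0r_neq0 s0)) !mulrDl.
by apply: lerD; [apply: hx; rewrite lerDl|apply: hy; rewrite lerDr].
Qed.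

Lemma norm_powR_subadd (x y b : R) : 0 < b <= 1 ->
  `|x + y| `^ b <= `|x| `^ b + `|y| `^ b.
Proof.
move=> b01; apply: le_trans (powR_subadd _ _ b01) => //.
by have /andP[b0 _] := b01; rewrite ge0_ler_powR ?nnegrE ?(ltW b0)// ler_normD.
Qed.

Lemma norm_powR_dist (x y b : R) : 0 < b <= 1 ->
  `| `|x| `^ b - `|y| `^ b | <= `|x - y| `^ b.
Proof.
move=> b01; rewrite ler_norml.
have := @norm_powR_subadd (x - y) y b b01; rewrite subrK => h1.
have := @norm_powR_subadd (y - x) x b b01; rewrite subrK (distrC y) => h2.
by apply/andP; split; lra.
Qed.

End PowerInequalities.

Section StableIntegral.
Context {d : measure_display} {T : measurableType d} {R : realType}.
Variable P : probability T R.
Variable alpha : R.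
Variable Z : (R -> R) -> {RV P >-> R}.
Hypothesis alpha_gt1 : 1 < alpha.
Hypothesis hZ : SaS_random_measure alpha Z.

Lemma stable_zero : {ae P, forall w, Z (fun=> 0) w = 0}.
Proof.
have := SaS_linear hZ 1 (Lalpha0 alpha_gt1) (Lalpha0 alpha_gt1).
have -> : (fun s : R => 1 * 0 + 0 : R) = (fun=> 0) by apply/funext => s; rewrite mul1r addr0.
by apply: filterS => w; lra.
Qed.

Lemma stable_sum (n : nat) (a : nat -> R) (f : nat -> R -> R) :
  (forall l, (l < n)%N -> f l \in Lalpha alpha) ->
  (fun s => \sum_(l < n) a l * f l s) \in Lalpha alpha /\
  {ae P, forall w, Z (fun s => \sum_(l < n) a l * f l s) w = \sum_(l < n) a l * Z (f l) w}.
Proof.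
elim: n => [|n IH] hf.
  have -> : (fun s : R => \sum_(l < 0) a l * f l s) = (fun=> 0).
    by apply/funext => s; rewrite big_ord0.
  split; first exact: Lalpha0.
  by apply: filterS stable_zero => w ->; rewrite big_ord0.
have [l|h1 h2] := IH; first by move=> ln; apply: hf; exact: ltnW.
have -> : (fun s : R => \sum_(l < n.+1) a l * f l s) =
    (fun s => a n * f n s + \sum_(l < n) a l * f l s).
  by apply/funext => s; rewrite big_ord_recr addrC.
have fn := hf n (ltnSn n).
split; first exact: Lalpha_lin.
move: h2 (SaS_linear hZ (a n) fn h1); apply: filterS2 => w E ->.
by rewrite big_ord_recr/= E addrC.
Qed.

Lemma stable_sub (f g : R -> R) : f \in Lalpha alpha -> g \in Lalpha alpha ->
  {ae P, forall w, Z (fun s => f s - g s) w = Z f w - Z g w}.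
Proof.
move=> hf hg; have := SaS_linear hZ (-1) hg hf.
have -> : (fun s => -1 * g s + f s) = (fun s => f s - g s).
  by apply/funext => s; rewrite mulN1r addrC.
by apply: filterS => w ->; rewrite mulN1r addrC.
Qed.

Lemma measurable_abs_powR (q : R) (Y : T -> R) : measurable_fun [set: T] Y ->
  measurable_fun [set: T] (fun w => `|Y w| `^ q).
Proof.
move=> mY; apply: (measurableT_comp (measurable_powR q)).
exact: (measurableT_comp (@normr_measurable R setT)).
Qed.

Lemma stable_indep (q : R) (f g : R -> R) :
  f \in Lalpha alpha -> g \in Lalpha alpha -> (forall s, f s = 0 \/ g s = 0) ->
  (\int[P]_w (`|Z f w| `^ q * `|Z g w| `^ q)%:E =
   \int[P]_w (`|Z f w| `^ q)%:E * \int[P]_w (`|Z g w| `^ q)%:E)%E.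
Proof.
move=> hf hg fg.
pose F (i : 'I_2) := if i == ord0 then f else g.
have hF i : F i \in Lalpha alpha by rewrite /F; case: ifP.
have dF (i j : 'I_2) : i != j ->
    {ae @lebesgue_measure R, forall s, F i s = 0 \/ F j s = 0}.
  move=> ij; apply: aeW => s /=; rewrite /F.
  case: (eqVneq i ord0) => [i0|i0]; case: (eqVneq j ord0) => [j0|j0].
  - by move: ij; rewrite i0 j0 eqxx.
  - exact: fg.
  - by case: (fg s) => ->; [right|left].
  - exfalso; move: i j i0 j0 ij => [[|[|i]] ?] [[|[|j]] ?] //.
have ind := SaS_independent hZ hF dF.
have indep (A B : set (measurableTypeR R)) : measurable A -> measurable B ->
    (P (Z f @^-1` A `&` Z g @^-1` B) = P (Z f @^-1` A) * P (Z g @^-1` B))%E.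
  move=> mA mB.
  have := ind (fun i => if i == ord0 then A else B).
  rewrite big_ord_recl big_ord1 /= /F /= => <-; last by move=> i; case: ifP.
  congr (P _); apply/seteqP; split => [w [Aw Bw] i _ /=|w h].
    by case: ifP.
  by split; [have := h ord0 I|have := h (lift ord0 ord0) I].
under eq_integral do rewrite EFinM.
pose u (x : R) : \bar R := (`|x| `^ q)%:E.
have mu : measurable_fun [set: R] u.
  apply/measurable_EFinP; apply: (measurableT_comp (measurable_powR q)).
  exact: normr_measurable.
have u0 x : (0 <= u x)%E by rewrite lee_fin powR_ge0.
exact: (@integral_indep_mul _ _ _ P (Z f) (Z g) u u indep mu u0 mu u0).
Qed.

Section Moment.
Variables (q c : R).
Hypothesis q01 : 0 < q < 1.
Hypothesis c_gt0 : 0 < c.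
Hypothesis hc : forall (s : R) (X : {RV P >-> R}), 0 <= s -> has_SaS_law P alpha s X ->
  (\int[P]_w (`|X w| `^ q)%:E = (c * s `^ q)%:E)%E.

Lemma stable_moment (f : R -> R) : f \in Lalpha alpha ->
  (\int[P]_w (`|Z f w| `^ q)%:E = (c * Lalpha_norm alpha f `^ q)%:E)%E.
Proof. by move=> hf; apply: hc; [exact: Lalpha_norm_ge0|exact: SaS_law]. Qed.

Lemma stable_moment_sub (f g : R -> R) : f \in Lalpha alpha -> g \in Lalpha alpha ->
  (\int[P]_w (`|Z f w - Z g w| `^ q)%:E =
   (c * Lalpha_norm alpha (fun s => f s - g s)%R `^ q)%:E)%E.
Proof.
move=> hf hg; have hfg := LalphaB alpha_gt1 hf hg.
rewrite -(stable_moment hfg); apply: ge0_ae_eq_integral => //.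
- apply/measurable_EFinP; apply: measurable_abs_powR.
  exact: measurable_funB.
- apply/measurable_EFinP; exact: measurable_abs_powR.
- by apply: filterS (stable_sub hf hg) => w /= -> _.
Qed.

(** For q < 1 the power of the norm is, up to a constant, the moment of order q
    of the stable integral, so its subadditivity follows from that of
    |x|^q. *)
Lemma Lalpha_norm_powR_dist (f g : R -> R) : f \in Lalpha alpha -> g \in Lalpha alpha ->
  `|Lalpha_norm alpha f `^ q - Lalpha_norm alpha g `^ q| <=
   Lalpha_norm alpha (fun s => f s - g s) `^ q.
Proof.
move=> hf hg.
have q01' : 0 < q <= 1 by case/andP: q01 => -> /ltW ->.
have half (f1 f2 : R -> R) : f1 \in Lalpha alpha -> f2 \in Lalpha alpha ->
  Lalpha_norm alpha f1 `^ q <= Lalpha_norm alpha (fun s => f1 s - f2 s) `^ q +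
    Lalpha_norm alpha f2 `^ q.
  move=> h1 h2; rewrite -(ler_pM2l c_gt0) mulrDr -lee_fin EFinD.
  rewrite -stable_moment// -stable_moment_sub// -(stable_moment h2).
  rewrite -ge0_integralD//.
  - apply: integral_ge0_mono => w; rewrite lee_fin ?powR_ge0//.
    by have := @norm_powR_subadd _ (Z f1 w - Z f2 w) (Z f2 w) q q01'; rewrite subrK.
  - apply/measurable_EFinP; apply: measurable_abs_powR; exact: measurable_funB.
  - apply/measurable_EFinP; exact: measurable_abs_powR.
have E : Lalpha_norm alpha (fun s => f s - g s) = Lalpha_norm alpha (fun s => g s - f s).
  rewrite !Lalpha_normE; congr (fine _ `^ _); rewrite !power_integral.unlock.
  by apply: eq_integral => s _; rewrite distrC.
rewrite ler_norml; have := half f g hf hg; have := half g f hg hf; rewrite -E.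
by move=> h1 h2; apply/andP; split; lra.
Qed.

End Moment.
End StableIntegral.

(** * Norms of the kernels of the increments *)

Section IncrementNorms.
Context {R : realType}.

(** The exponent may depend on l: the increments of the LMSM correspond to
    h l = H((k+l)/N), and a constant h gives the field at frozen exponent. *)
Definition increment_kernel (alpha : R) (L N k : nat) (h : nat -> R) (s : R) : R :=
  \sum_(l < L.+1) diff_coef L l * lmsm_kernel alpha ((k + l)%:R / N%:R) (h l) s.

(** The frozen kernel cut at m/N to the left of k/N, which makes its support
    bounded. *)
Definition near_kernel (alpha : R) (L N k : nat) (h m : R) (s : R) : R :=
  if N%:R * s + - k%:R < - m then 0 else increment_kernel alpha L N k (fun=> h) s.

Lemma Lalpha_env_dom (alpha U k : R) (f : R -> R) (a : R) : 1 < alpha ->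
  env U k \in Lalpha alpha -> 0 <= a -> measurable_fun [set: R] f ->
  (forall s, `|f s| <= a * env U k s) ->
  f \in Lalpha alpha /\ Lalpha_norm alpha f <= a * Lalpha_norm alpha (env U k).
Proof.
move=> a1 hE a0 mf fE; apply: Lalpha_dom => // s.
by rewrite (ger0_norm (env_ge0 _ _ _)).
Qed.

Lemma measurable_increment_kernel (alpha : R) (L N k : nat) (h : nat -> R) :
  measurable_fun [set: R] (increment_kernel alpha L N k h).
Proof.
apply: measurable_sum => l; apply: measurable_funM => //.
exact: measurable_moving_kernel.
Qed.

Lemma measurable_near_kernel (alpha : R) (L N k : nat) (h m : R) :
  measurable_fun [set: R] (near_kernel alpha L N k h m).
Proof.
apply: measurable_fun_ifT => //; last exact: measurable_increment_kernel.
by apply: measurable_fun_ltr => //; apply: measurable_funD => //; exact: measurable_funM.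
Qed.

Lemma increment_kernelE (alpha : R) (L N k : nat) (v s : R) : (0 < L)%N -> (0 < N)%N ->
  increment_kernel alpha L N k (fun=> v) s =
  N%:R `^ (- (v - alpha^-1)) * phi L (v - alpha^-1) (N%:R * s + - k%:R).
Proof. by move=> L0 N0; rewrite -increment_kernel_scale. Qed.

(** The truncated kernel of index k lives on [(k-M)/N, (k+L)/N]. *)
Lemma near_kernel_disjoint (alpha : R) (L N k j M : nat) (v v' s : R) :
  (0 < L)%N -> (0 < N)%N -> (k + (M + L) <= j)%N ->
  near_kernel alpha L N k v M%:R s = 0 \/ near_kernel alpha L N j v' M%:R s = 0.
Proof.
move=> L0 N0 kj; have [far|near] := ltP (N%:R * s + - j%:R) (- M%:R : R).
  by right; rewrite /near_kernel far.
left; rewrite /near_kernel; case: ifP => // _.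
rewrite increment_kernelE// phi_right ?mulr0//.
have : k%:R + (M%:R + L%:R) <= j%:R :> R by rewrite -!natrD ler_nat.
lra.
Qed.

Lemma phi_norm_bounds (alpha h1 h2 : R) (L : nat) :
  1 < alpha -> (0 < L)%N -> alpha^-1 < h1 -> h1 <= h2 -> h2 < 1 ->
  exists2 C : R, 0 < C & forall v, h1 <= v <= h2 ->
    [/\ phi L (v - alpha^-1) \in Lalpha alpha,
        C^-1 <= Lalpha_norm alpha (phi L (v - alpha^-1)) <= C &
        forall v', h1 <= v' <= h2 ->
          Lalpha_norm alpha (fun s => phi L (v - alpha^-1) s - phi L (v' - alpha^-1) s)
          <= C * `|v - v'|].
Proof.
move=> a1 L0 ah1 h12 h21.
have ai : 0 < alpha^-1 by rewrite invr_gt0; lra.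
pose k1 := h1 - alpha^-1; pose k2 := h2 - alpha^-1.
pose k3 := k2 + (1 - h2) / 2.
have k10 : 0 < k1 by rewrite /k1; lra.
have k12 : k1 <= k2 by rewrite /k1 /k2; lra.
have k23 : k2 < k3 by rewrite /k3; lra.
have k31 : k3 <= 1 by rewrite /k3 /k2; lra.
have ak3 : alpha * (k3 - 1) < -1.
  have aa : alpha * alpha^-1 = 1 by rewrite mulfV// gt_eqF//; lra.
  rewrite /k3 /k2; have : 0 < (alpha - 1) * (1 - h2) by rewrite mulr_gt0//; lra.
  nra.
have hE : env L%:R k3 \in Lalpha alpha by apply: env_Lalpha.
set nE := Lalpha_norm alpha (env L%:R k3).
have nE0 : 0 <= nE by exact: Lalpha_norm_ge0.
set Ce := env_const L%:R k1 k2 k3.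
have Ce0 : 0 <= Ce by exact: env_const_ge0.
have dm0 := diff_mass_ge0 (R := R) L.
pose C1 : R := 2^-1 * (2^-1) `^ alpha^-1.
have C10 : 0 < C1 by rewrite mulr_gt0 ?powR_gt0.
pose C := C1^-1 + diff_mass L * (2 * Ce) * nE.
have dC : 0 <= diff_mass L * Ce * nE by rewrite !mulr_ge0.
have iC : 0 < C1^-1 by rewrite invr_gt0.
have C0 : 0 < C by rewrite /C; nra.
exists C => // v /andP[v1 v2].
have kv : k1 <= v - alpha^-1 <= k2 by rewrite /k1 /k2; lra.
have [ph pn] := @Lalpha_env_dom _ _ _ (phi L (v - alpha^-1)) (diff_mass L * Ce) a1 hE
  (mulr_ge0 dm0 Ce0) (measurable_phi L _)
  (fun s => @phi_le_env _ L k1 k2 k3 _ s L0 k10 k12 k23 k31 kv).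
split => //.
  apply/andP; split.
    have low := @phi_norm_lower _ alpha (v - alpha^-1) L a1 L0 _ ph.
    apply: le_trans (low _); last by lra.
    rewrite -[leRHS]invrK lef_pV2 ?posrE// ?invr_gt0// /C /C1; nra.
  by apply: le_trans pn _; rewrite /C -/nE; nra.
move=> v' /andP[v1' v2'].
have kv' : k1 <= v' - alpha^-1 <= k2 by rewrite /k1 /k2; lra.
have [|||_ h] := @Lalpha_env_dom _ _ _ (fun s => phi L (v - alpha^-1) s - phi L (v' - alpha^-1) s)
  (diff_mass L * (2 * Ce * `|v - v'|)) a1 hE.
- by rewrite !mulr_ge0.
- by apply: measurable_funB; exact: measurable_phi.
- move=> s; have := @phi_lipschitz _ L k1 k2 k3 _ _ s L0 k10 k12 k23 k31 kv kv'.
  by rewrite (_ : v - alpha^-1 - (v' - alpha^-1) = v - v'); last by lra.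
apply: le_trans h _; rewrite -/nE.
have := normr_ge0 (v - v'); rewrite /C => d0.
have -> : diff_mass L * (2 * Ce * `|v - v'|) * nE = diff_mass L * (2 * Ce) * nE * `|v - v'|.
  by ring.
by rewrite ler_wpM2r// lerDr ltW.
Qed.

(** In the order of the conclusions: the kernels are in L^alpha; replacing
    H((k+l)/N) by H(k/N) costs N^-rho; truncating at M/N costs a negative power
    of M, relative to the size N^-v; and the sizes of the truncated and of the
    frozen kernel are at most a constant times N^-v and exactly N^-v |phi|. *)
Lemma increment_norm_bounds (alpha h1 h2 cH rho : R) (H : R -> R) (L : nat) :
  1 < alpha -> (0 < L)%N -> alpha^-1 < h1 -> h1 <= h2 -> h2 < 1 ->
  (forall t : R, 0 <= t <= 1 -> h1 <= H t <= h2) ->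
  0 <= cH -> 0 < rho <= 1 ->
  (forall t1 t2 : R, 0 <= t1 <= 1 -> 0 <= t2 <= 1 ->
     `|H t1 - H t2| <= cH * `|t1 - t2| `^ rho) ->
  exists2 C : R, 0 < C & forall N k M : nat, (0 < N)%N -> (k + L <= N)%N -> (0 < M)%N ->
    let v := H (k%:R / N%:R) in
    let F := increment_kernel alpha L N k (fun l => H ((k + l)%:R / N%:R)) in
    let F0 := increment_kernel alpha L N k (fun=> v) in
    let G := near_kernel alpha L N k v M%:R in
    [/\ forall l, (l <= L)%N ->
          lmsm_kernel alpha ((k + l)%:R / N%:R) (H ((k + l)%:R / N%:R)) \in Lalpha alpha,
        F0 \in Lalpha alpha /\ G \in Lalpha alpha,
        Lalpha_norm alpha (fun s => F s - F0 s) <= C * N%:R `^ (- rho),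
        Lalpha_norm alpha (fun s => F0 s - G s) <=
          C * M%:R `^ (- ((1 - h2) / 2)) * N%:R `^ (- v) &
        Lalpha_norm alpha G <= C * N%:R `^ (- v) /\
        Lalpha_norm alpha F0 = N%:R `^ (- v) * Lalpha_norm alpha (phi L (v - alpha^-1))].
Proof.
move=> a1 L0 ah1 h12 h21 hH cH0 /andP[rho0 rho1] hHolder.
have ai : 0 < alpha^-1 by rewrite invr_gt0; lra.
pose k1 := h1 - alpha^-1; pose k2 := h2 - alpha^-1.
pose de := (1 - h2) / 2; pose k3 := k2 + de.
have k10 : 0 < k1 by rewrite /k1; lra.
have k12 : k1 <= k2 by rewrite /k1 /k2; lra.
have k23 : k2 < k3 by rewrite /k3 /de; lra.
have k31 : k3 <= 1 by rewrite /k3 /k2 /de; lra.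
have k3k2 : k3 - k2 = de by rewrite /k3; lra.
have ak3 : alpha * (k3 - 1) < -1.
  have aa : alpha * alpha^-1 = 1 by rewrite mulfV// gt_eqF//; lra.
  rewrite /k3 /k2 /de; have : 0 < (alpha - 1) * (1 - h2) by rewrite mulr_gt0//; lra.
  nra.
have hE : env L%:R k3 \in Lalpha alpha by apply: env_Lalpha.
set nE := Lalpha_norm alpha (env L%:R k3).
have nE0 : 0 <= nE by exact: Lalpha_norm_ge0.
set Ce := env_const L%:R k1 k2 k3.
have Ce0 : 0 <= Ce by exact: env_const_ge0.
have dm0 := diff_mass_ge0 (R := R) L.
pose A1 := diff_mass L * (2 * Ce * (cH * L%:R `^ rho)) * nE.
pose A2 := diff_mass L * L%:R * nE.
pose A3 := diff_mass L * Ce * nE.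
have A10 : 0 <= A1 by rewrite !mulr_ge0 ?powR_ge0.
have A20 : 0 <= A2 by rewrite !mulr_ge0.
have A30 : 0 <= A3 by rewrite !mulr_ge0.
pose C := A1 + A2 + A3 + 1.
have [C0 A1C A2C A3C] : [/\ 0 < C, A1 <= C, A2 <= C & A3 <= C] by rewrite /C; split; lra.
exists C => //.
move=> N k M N0 kLN M0 v F F0 G.
have Np : 0 < N%:R :> R by rewrite ltr0n.
have grid l : (l <= L)%N -> 0 <= ((k + l)%:R / N%:R : R) <= 1.
  move=> lL; rewrite divr_ge0//= ler_pdivrMr// mul1r ler_nat.
  by apply: leq_trans kLN; rewrite leq_add2l.
have gridL l : (l <= L)%N -> 0 <= ((k + l)%:R / N%:R : R) <= L%:R.
  by move=> /grid/andP[-> g1]; apply: le_trans g1 _; rewrite ler1n.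
have grid0 : 0 <= (k%:R / N%:R : R) <= 1 by rewrite -[k]addn0 grid.
have hv : h1 <= v <= h2 by exact: hH.
have kin u : h1 <= u <= h2 -> k1 <= u - alpha^-1 <= k2.
  by move=> /andP[u1 u2]; rewrite /k1 /k2 !lerD2r u1.
have kl l : (l <= L)%N -> h1 <= H ((k + l)%:R / N%:R) <= h2.
  by move=> /grid; exact: hH.
have hK l : (l <= L)%N ->
    lmsm_kernel alpha ((k + l)%:R / N%:R) (H ((k + l)%:R / N%:R)) \in Lalpha alpha.
  move=> lL; apply: (proj1 (@Lalpha_env_dom _ _ _ _ Ce a1 hE Ce0 _ _)).
    exact: measurable_moving_kernel.
  move=> s; apply: (@kernel_le_env _ L%:R k1 k2 k3 _ _ s) => //.
    exact: kin (kl _ lL).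
  exact: gridL.
pose c := N%:R `^ (- (v - alpha^-1)).
have c0 : 0 <= c by exact: powR_ge0.
have cN : c * N%:R `^ (- alpha^-1) = N%:R `^ (- v).
  by rewrite /c -powRD_gt0// opprB addrAC subrr add0r.
have [hEN nEN] := @Lalpha_affine _ alpha a1 (env L%:R k3) N%:R (- k%:R) Np hE.
rewrite -/nE in nEN.
(* comparison with the envelope at scale 1/N around k/N, of norm N^(-1/alpha) nE *)
have domN (f : R -> R) (a : R) : 0 <= a -> measurable_fun [set: R] f ->
    (forall s, `|f s| <= c * a * env L%:R k3 (N%:R * s + - k%:R)) ->
    f \in Lalpha alpha /\ Lalpha_norm alpha f <= a * nE * N%:R `^ (- v).
  move=> a0 mf fE.
  have [h1' h2'] := @Lalpha_dom _ alpha a1 f _ (c * a) (mulr_ge0 c0 a0) mf hEN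
    (fun s => eq_ind_r (fun z => `|f s| <= c * a * z) (fE s) (ger0_norm (env_ge0 _ _ _))).
  split => //; apply: le_trans h2' _; rewrite nEN -cN.
  by rewrite le_eqVlt; apply/orP; left; apply/eqP; ring.
have mF0 : measurable_fun [set: R] F0 by exact: measurable_increment_kernel.
have mF : measurable_fun [set: R] F by exact: measurable_increment_kernel.
have mG : measurable_fun [set: R] G by exact: measurable_near_kernel.
have F0E s : F0 s = c * phi L (v - alpha^-1) (N%:R * s + - k%:R).
  exact: increment_kernelE.
have F0_le s : `|F0 s| <= c * (diff_mass L * Ce) * env L%:R k3 (N%:R * s + - k%:R).
  rewrite F0E normrM (ger0_norm c0) -mulrA ler_wpM2l//.
  by apply: phi_le_env => //; exact: kin.
have G_le s : `|G s| <= c * (diff_mass L * Ce) * env L%:R k3 (N%:R * s + - k%:R).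
  rewrite /G /near_kernel; case: ifP => _; last exact: F0_le.
  by rewrite normr0 !mulr_ge0// env_ge0.
have dCe0 : 0 <= diff_mass L * Ce by exact: mulr_ge0.
have [F0L _] := domN _ _ dCe0 mF0 F0_le.
have [GL Gn] := domN _ _ dCe0 mG G_le.
have Nv0 : 0 <= N%:R `^ (- v) :> R by exact: powR_ge0.
split => //.
- have [|||_ h] := @Lalpha_env_dom _ _ _ (fun s => F s - F0 s)
    (diff_mass L * (2 * Ce * (cH * L%:R `^ rho)) * N%:R `^ (- rho)) a1 hE.
  + by rewrite !mulr_ge0 ?powR_ge0.
  + exact: measurable_funB.
  + move=> s; rewrite /F /F0 /increment_kernel -sumrB.
    under eq_bigr do rewrite -mulrBr.
    apply: le_trans (@sum_diff_bound _ _ (fun l =>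
      lmsm_kernel alpha ((k + l)%:R / N%:R) (H ((k + l)%:R / N%:R)) s -
      lmsm_kernel alpha ((k + l)%:R / N%:R) v s)
      (2 * Ce * (cH * L%:R `^ rho) * N%:R `^ (- rho) * env L%:R k3 s) _) _.
      move=> l lL.
      have lip := @kernel_lipschitz_env _ L%:R k1 k2 k3 (H ((k + l)%:R / N%:R) - alpha^-1)
        (v - alpha^-1) ((k + l)%:R / N%:R) s (ler0n _ _) k10 k12 k23 k31 (kin _ (kl _ lL))
        (kin _ hv) (gridL _ lL).
      apply: le_trans lip _; rewrite ler_wpM2r ?env_ge0//.
      rewrite -[leRHS]mulrA ler_wpM2l ?mulr_ge0//.
      rewrite (_ : _ - _ - _ = H ((k + l)%:R / N%:R) - H (k%:R / N%:R)); last by rewrite opprB addrA subrK.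
      apply: le_trans (hHolder _ _ (grid _ lL) grid0) _.
      rewrite -[leRHS]mulrA ler_wpM2l//.
      rewrite -mulrBl natrD addrAC subrr add0r normrM ger0_norm// ger0_norm ?invr_ge0 ?(ltW Np)//.
      rewrite powRM ?invr_ge0 ?(ltW Np)//; apply: ler_pM; rewrite ?powR_ge0//.
        by rewrite ge0_ler_powR ?nnegrE ?(ltW rho0)// ler_nat.
      by rewrite -(powR_inv1 (ltW Np)) -powRrM mulN1r.
    by rewrite le_eqVlt; apply/orP; left; apply/eqP; ring.
  apply: le_trans h _; rewrite -/nE.
  have -> : diff_mass L * (2 * Ce * (cH * L%:R `^ rho)) * N%:R `^ (- rho) * nE =
    A1 * N%:R `^ (- rho) by rewrite /A1; ring.
  by rewrite ler_wpM2r ?powR_ge0.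
- have Md0 : 0 <= M%:R `^ (- de) :> R by exact: powR_ge0.
  have [|||_ h] := domN (fun s => F0 s - G s) (diff_mass L * L%:R * M%:R `^ (- de)).
  + by rewrite !mulr_ge0.
  + exact: measurable_funB.
  + move=> s; rewrite /G /near_kernel; case: ifPn => far; last first.
      by rewrite subrr normr0 !mulr_ge0// env_ge0.
    rewrite subr0 F0E normrM (ger0_norm c0) -mulrA ler_wpM2l// -k3k2.
    by apply: (@phi_tail _ L k1) => //; [exact: kin|rewrite ler1n].
  apply: le_trans h _.
  have -> : diff_mass L * L%:R * M%:R `^ (- de) * nE * N%:R `^ (- v) =
    A2 * (M%:R `^ (- de) * N%:R `^ (- v)) by rewrite /A2; ring.
  by rewrite -mulrA ler_wpM2r ?mulr_ge0.
- split.
    by apply: le_trans Gn _; rewrite ler_wpM2r// -/A3.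
  have phL : phi L (v - alpha^-1) \in Lalpha alpha.
    apply: (proj1 (@Lalpha_env_dom _ _ _ _ (diff_mass L * Ce) a1 hE dCe0 _ _)).
      exact: measurable_phi.
    by move=> s; apply: phi_le_env => //; exact: kin.
  have [hP nP] := @Lalpha_affine _ alpha a1 _ N%:R (- k%:R) Np phL.
  have d1 s : `|F0 s| <= c * `|phi L (v - alpha^-1) (N%:R * s + - k%:R)|.
    by rewrite F0E normrM ger0_norm.
  have cgt0 : 0 < c by rewrite powR_gt0.
  have d2 s : `|phi L (v - alpha^-1) (N%:R * s + - k%:R)| <= c^-1 * `|F0 s|.
    by rewrite F0E normrM (ger0_norm c0) mulrA mulVf ?mul1r// gt_eqF.
  have [_ u1] := Lalpha_dom a1 c0 mF0 hP d1.
  have ci0 : 0 <= c^-1 by rewrite invr_ge0.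
  have mP := proj1 ((LalphaP a1 _).1 hP).
  have [_ u2] := Lalpha_dom a1 ci0 mP F0L d2.
  rewrite ler_pdivlMl// in u2.
  have -> : N%:R `^ (- v) * Lalpha_norm alpha (phi L (v - alpha^-1)) =
    c * Lalpha_norm alpha (fun s => phi L (v - alpha^-1) (N%:R * s + - k%:R)).
    by rewrite nP -cN mulrA.
  by apply/eqP; rewrite eq_le u1 u2.
Qed.

End IncrementNorms.

(** * The weak law for the power sums of the increments *)

Section LmsmWeakLaw.
Context {d : measure_display} {T : measurableType d} {R : realType}.
Variable P : probability T R.

Lemma powR_prod3 (a b c e : R) : 0 <= a -> 0 <= b -> 0 <= c ->
  (a * b * c) `^ e = a `^ e * b `^ e * c `^ e.
Proof. by move=> a0 b0 c0; rewrite !powRM ?mulr_ge0. Qed.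

(** The version X agrees with the stable integrals at each of the finitely many
    points of an increment, outside a negligible set. *)
Lemma lmsm_increment_stable (alpha : R) (Z : (R -> R) -> {RV P >-> R})
    (X : R -> R -> {RV P >-> R}) (H : R -> R) (L N k : nat) :
  1 < alpha -> SaS_random_measure alpha Z -> stable_field alpha Z X ->
  (forall t : R, 0 <= t <= 1 -> alpha^-1 < H t < 1) ->
  (0 < N)%N -> (k + L <= N)%N ->
  (forall l, (l <= L)%N ->
    lmsm_kernel alpha ((k + l)%:R / N%:R) (H ((k + l)%:R / N%:R)) \in Lalpha alpha) ->
  let F := increment_kernel alpha L N k (fun l => H ((k + l)%:R / N%:R)) in
  F \in Lalpha alpha /\
  {ae P, forall w, increment L (fun s : R => lmsm X H s w) N k = Z F w}.
Proof.
move=> a1 hZ hX hH N0 kLN hK F.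
have hK' l : (l < L.+1)%N ->
    lmsm_kernel alpha ((k + l)%:R / N%:R) (H ((k + l)%:R / N%:R)) \in Lalpha alpha.
  by rewrite ltnS; exact: hK.
have [FL FE] := stable_sum a1 hZ (diff_coef L) hK'.
split => //.
have each l : (l <= L)%N -> {ae P, forall w,
   lmsm X H ((k + l)%:R / N%:R) w =
   Z (lmsm_kernel alpha ((k + l)%:R / N%:R) (H ((k + l)%:R / N%:R))) w}.
  move=> lL; have grid : 0 <= ((k + l)%:R / N%:R : R) <= 1.
    rewrite divr_ge0//= ler_pdivrMr ?ltr0n// mul1r ler_nat.
    by apply: leq_trans kLN; rewrite leq_add2l.
  exact: hX.1 grid (hH _ grid).
have all_l : {ae P, forall w, forall l : 'I_L.+1,
   lmsm X H ((k + l)%:R / N%:R) w =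
   Z (lmsm_kernel alpha ((k + l)%:R / N%:R) (H ((k + l)%:R / N%:R))) w}.
  apply: filter_forall => l; apply: each; rewrite -ltnS; exact: ltn_ord.
move: FE all_l; apply: filterS2 => w -> E.
rewrite /increment; apply: eq_bigr => l _.
by rewrite E.
Qed.

Lemma square_scaling (e c n g : R) : g != 0 -> e * (c * n ^+ 2) = e * c / g ^+ 2 * (n * g) ^+ 2.
Proof. by move=> g0; field. Qed.

Lemma ratio_scaling (g h x y : R) : g != 0 -> h / g * x * (y * g) = x * y * h.
Proof. by move=> g0; field. Qed.

Lemma powR_square_exponent (v b x : R) : 0 < x ->
  (x `^ (- v)) `^ (2 * b) = x `^ (- (b * v)) ^+ 2.
Proof.
move=> x0; rewrite -powRrM (_ : - v * (2 * b) = - (b * v) * 2%:R); last by ring.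
by rewrite powRrM powR_mulrn// powR_ge0.
Qed.

Lemma combine_rates (lam r K1 W KK C : R) : lam <= r -> W <= KK * r -> 0 <= r -> 0 <= KK ->
  2 * K1 + 1 + KK <= C -> 2 * (K1 * r) + 2^-1 * (lam + W) <= C * r.
Proof.
move=> h1 h2 r0 k0 h3; apply: le_trans (ler_wpM2r r0 h3).
have kr := mulr_ge0 k0 r0; lra.
Qed.

Lemma half_le (x : R) : 0 <= x -> 2^-1 * x <= x.
Proof. lra. Qed.

Lemma exponent_hurst_gap (beta rho h2 v : R) : 0 < beta -> v <= h2 -> h2 < rho ->
  - rho * beta <= - (beta * v) + - (beta * (rho - h2) / 16).
Proof.
move=> b0 vh hr; have h1 : beta * v <= beta * h2 by rewrite ler_wpM2l// ltW.
have h3 : 0 <= beta * (rho - h2) by rewrite mulr_ge0 ?(ltW b0)//; lra.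
lra.
Qed.

Lemma exponent_truncation_gap (beta rho h2 : R) : 0 < beta -> h2 < 1 -> rho <= 1 ->
  1 / 8 * - ((1 - h2) / 2 * beta) <= - (beta * (rho - h2) / 16).
Proof.
move=> b0 h21 r1; have h3 : 0 <= beta * (1 - rho) by rewrite mulr_ge0 ?(ltW b0)//; lra.
lra.
Qed.

(** Since beta <= 1/4 and the exponents lie in (1/2, 1), the terms N^(-beta v)
    of a sum differ by factors of at most N^(1/8). *)
Lemma exponent_ratio (beta h1 h2 v v' : R) : 0 < beta <= 4^-1 -> 2^-1 < h1 -> h2 < 1 ->
  h1 <= v <= h2 -> h1 <= v' <= h2 -> - (beta * v) <= 1 / 8 + - (beta * v').
Proof.
move=> /andP[b0 b4] h12 h21 /andP[v1 v2] /andP[v1' v2'].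
have h3 : beta * (v' - v) <= beta * 2^-1 by rewrite ler_wpM2l ?(ltW b0)//; lra.
lra.
Qed.

(** The abstract weak law is applied with D the powers of the increments and W
    those of the integrals of the truncated kernels.  The first two moments of
    W are given by SaS_moment at the orders beta and 2 beta, both less than 1;
    the range of dependence and the ratios of the means are of order N^(1/8),
    which is beaten by #|A| >= N^(3/4). *)
Lemma lmsm_weak_law (alpha h1 h2 cH rho beta : R) (Z : (R -> R) -> {RV P >-> R})
    (X : R -> R -> {RV P >-> R}) (H : R -> R) (L : nat) :
  1 < alpha < 2 -> SaS_random_measure alpha Z -> stable_field alpha Z X ->
  (0 < L)%N -> alpha^-1 < h1 -> h1 <= h2 -> h2 < rho ->
  (forall t : R, 0 <= t <= 1 -> h1 <= H t <= h2) ->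
  0 <= cH -> rho <= 1 ->
  (forall t1 t2 : R, 0 <= t1 <= 1 -> 0 <= t2 <= 1 ->
     `|H t1 - H t2| <= cH * `|t1 - t2| `^ rho) ->
  0 < beta <= 4^-1 ->
  exists (g : R -> R) (C gam : R), [/\ 0 < C, 0 < gam,
    forall v, h1 <= v <= h2 -> C^-1 <= g v <= C,
    forall v v', h1 <= v <= h2 -> h1 <= v' <= h2 ->
      `|g v - g v'| <= C * `|v - v'| `^ beta &
    forall (N : nat) (A : {set 'I_(N - L).+1}), (L <= N)%N ->
      N%:R `^ (3 / 4) <= #|A|%:R :> R ->
      let mu k := N%:R `^ (- (beta * H (k%:R / N%:R))) * g (H (k%:R / N%:R)) in
      (\int[P]_w (`|\sum_(k in A) `|increment L (fun s : R => lmsm X H s w) N k| `^ beta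
                    - \sum_(k in A) mu k|)%:E <=
       (C * N%:R `^ (- gam) * \sum_(k in A) mu k)%:E)%E].
Proof.
move=> /andP[a1 a2] hZ hX L0 ah1 h12 h2rho hH cH0 rho1 hHolder b14.
have /andP[b0 b4] := b14.
have h21 : h2 < 1 by lra.
have ai : 2^-1 < alpha^-1 by rewrite ltf_pV2 ?posrE//; lra.
have h1half : 2^-1 < h1 by exact: lt_trans ah1.
have bq : 0 < beta < 1 by lra.
have bq2 : 0 < 2 * beta < 1 by lra.
have b01 : 0 < beta <= 1 by lra.
have rho01 : 0 < rho <= 1 by lra.
have [c [c0 hc]] := SaS_moment P a1 bq.
have [e [e0 he]] := SaS_moment P a1 bq2.
have [C1 C10 hphi] := phi_norm_bounds a1 L0 ah1 h12 h21.
have [C2 C20 hinc] := increment_norm_bounds a1 L0 ah1 h12 h21 hH cH0 rho01 hHolder.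
pose g v := c * Lalpha_norm alpha (phi L (v - alpha^-1)) `^ beta.
pose gmin := c * (C1^-1) `^ beta; pose gmax := c * C1 `^ beta.
have gmin0 : 0 < gmin by rewrite mulr_gt0 ?powR_gt0 ?invr_gt0.
have gmax0 : 0 < gmax by rewrite mulr_gt0 ?powR_gt0.
have gb v : h1 <= v <= h2 -> gmin <= g v <= gmax.
  move=> /hphi[_ /andP[p1 p2] _]; have i1 : 0 <= C1^-1 by rewrite invr_ge0 ltW.
  by rewrite /gmin /gmax !ler_wpM2l ?(ltW c0)// ge0_ler_powR ?nnegrE ?Lalpha_norm_ge0 ?(ltW b0) ?(ltW C10).
(* below the freezing rate beta (rho - h2), the truncation rate beta (1 - h2) / 16
   for a cut at N^(1/8), and the rate 1/4 of the variance term *)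
pose gam := beta * (rho - h2) / 16.
have gam0 : 0 < gam by rewrite divr_gt0// mulr_gt0//; lra.
have gam14 : gam <= 4^-1 by rewrite /gam; nra.
pose K1 := 2 * c * C2 `^ beta / gmin.
pose K2 := e * C2 `^ (2 * beta) / gmin ^+ 2.
pose KQ := gmax / gmin.
pose KL : R := (2 * (L + 2))%:R.
have K10 : 0 < K1 by rewrite divr_gt0// !mulr_gt0 ?powR_gt0.
have K20 : 0 < K2 by rewrite divr_gt0 ?exprn_gt0// mulr_gt0 ?powR_gt0.
have KQ0 : 0 < KQ by rewrite divr_gt0.
have KL0 : 0 < KL by rewrite ltr0n muln_gt0 addn_gt0 orbT.
have KK0 : 0 < KL * K2 * KQ := mulr_gt0 (mulr_gt0 KL0 K20) KQ0.
pose C := gmin^-1 + gmax + c * C1 `^ beta + 2 * K1 + 1 + KL * K2 * KQ.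
have cC1 : 0 < c * C1 `^ beta by [].
have ig : 0 < gmin^-1 by rewrite invr_gt0.
have [C0 Cmin Cmax Cc] : [/\ 0 < C, gmin^-1 <= C, gmax <= C & c * C1 `^ beta <= C].
  by rewrite /C; move: ig gmax0 cC1 K10 KK0; clear => *; split; lra.
exists g, C, gam; split => //.
- move=> v /gb/andP[g1 g2]; apply/andP; split; last exact: le_trans Cmax.
  by apply: le_trans g1; rewrite -[leRHS]invrK lef_pV2 ?posrE ?invr_gt0.
- move=> v v' hv hv'.
  have [p1 _ p3] := hphi v hv; have [p1' _ _] := hphi v' hv'.
  have D := Lalpha_norm_powR_dist a1 hZ bq c0 hc p1 p1'.
  rewrite /g -mulrBr normrM (gtr0_norm c0).
  apply: (@le_trans _ _ (c * (C1 * `|v - v'|) `^ beta)).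
    rewrite ler_wpM2l ?(ltW c0)//; apply: le_trans D _.
    rewrite ge0_ler_powR ?nnegrE ?Lalpha_norm_ge0 ?(ltW b0) ?mulr_ge0 ?(ltW C10)//.
    exact: p3.
  by rewrite powRM ?(ltW C10)// mulrA ler_wpM2r ?powR_ge0.
move=> N A LN hA.
have N0 : (0 < N)%N by exact: leq_trans L0 LN.
have Np : 0 < N%:R :> R by rewrite ltr0n.
have N1 : 1 <= N%:R :> R by rewrite ler1n.
pose Nb x := N%:R `^ x : R.
have Nb0 x : 0 < Nb x by exact: powR_gt0.
have NbD x y : Nb (x + y) = Nb x * Nb y by exact: powRD_gt0.
have Nble x y : x <= y -> Nb x <= Nb y by exact: ler_powR.
(* the truncation distance, of order N^(1/8) *)
pose Mt := (Num.truncn (Nb (1 / 8))).+1.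
have Mt0 : (0 < Mt)%N by [].
have MtN : Nb (1 / 8) <= Mt%:R by apply: ltW; exact: truncnS_gt.
have Mt_le : (2 * (Mt + L))%:R <= KL * Nb (1 / 8).
  have t1 : (Num.truncn (Nb (1 / 8)))%:R <= Nb (1 / 8).
    by rewrite truncn_le// ltW.
  have one : 1 <= Nb (1 / 8) by rewrite -[leLHS](powRr0 N%:R); apply: Nble; rewrite divr_ge0.
  have e1 : (2 * (Mt + L))%:R = 2 * ((Num.truncn (Nb (1 / 8)))%:R + 1 + L%:R) :> R.
    by rewrite natrM natrD natr1.
  have e2 : KL = 2 * (L%:R + 2) by rewrite /KL natrM natrD.
  have hl : L%:R * 1 <= L%:R * Nb (1 / 8) by rewrite ler_wpM2l.
  by rewrite e1 e2; move: t1 one hl; clear; lra.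
have kLN (k : 'I_(N - L).+1) : (k + L <= N)%N by rewrite -[leqRHS](subnK LN) leq_add2r -ltnS ltn_ord.
pose v (k : 'I_(N - L).+1) := H (k%:R / N%:R).
pose F (k : 'I_(N - L).+1) := increment_kernel alpha L N k (fun l => H ((k + l)%:R / N%:R)).
pose F0 (k : 'I_(N - L).+1) := increment_kernel alpha L N k (fun=> H (k%:R / N%:R)).
pose G (k : 'I_(N - L).+1) := near_kernel alpha L N k (H (k%:R / N%:R)) Mt%:R.
have hv (k : 'I_(N - L).+1) : h1 <= v k <= h2.
  apply: hH; rewrite divr_ge0//= ler_pdivrMr// mul1r ler_nat.
  by apply: leq_trans (kLN k); rewrite leq_addr.
pose mu (k : 'I_(N - L).+1) : R := N%:R `^ (- (beta * v k)) * g (v k).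
have muE (k : 'I_(N - L).+1) : mu k = Nb (- (beta * v k)) * g (v k) by [].
have mu0 (k : 'I_(N - L).+1) : 0 < mu k.
  rewrite mulr_gt0 ?powR_gt0//; have /andP[g1 _] := gb _ (hv k); exact: lt_le_trans g1.
have mu_lo (k : 'I_(N - L).+1) : Nb (- (beta * v k)) * gmin <= mu k.
  by rewrite muE ler_wpM2l ?(ltW (Nb0 _))//; have /andP[] := gb _ (hv k).
pose D (k : 'I_(N - L).+1) (w : T) : R := `|increment L (fun s : R => lmsm X H s w) N k| `^ beta.
pose W (k : 'I_(N - L).+1) (w : T) : R := `|Z (G k) w| `^ beta.
have hk (k : 'I_(N - L).+1) := hinc N k Mt N0 (kLN k) Mt0.
have FL (k : 'I_(N - L).+1) : F k \in Lalpha alpha /\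
   {ae P, forall w, increment L (fun s : R => lmsm X H s w) N k = Z (F k) w}.
  have [hK _ _ _ _] := hk k.
  have hH' (t : R) : 0 <= t <= 1 -> alpha^-1 < H t < 1.
    by move=> /hH/andP[t1 t2]; rewrite (lt_le_trans ah1 t1) (le_lt_trans t2 h21).
  exact: (lmsm_increment_stable a1 hZ hX hH' N0 (kLN k) hK).
have F0L (k : 'I_(N - L).+1) : F0 k \in Lalpha alpha by have [_ [? _] _ _ _] := hk k.
have GL (k : 'I_(N - L).+1) : G k \in Lalpha alpha by have [_ [_ ?] _ _ _] := hk k.
have dist1 (k : 'I_(N - L).+1) : Lalpha_norm alpha (fun s => F k s - F0 k s) `^ beta <=
    C2 `^ beta * (Nb (- (beta * v k)) * Nb (- gam)).
  have [_ _ n1 _ _] := hk k.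
  apply: (@le_trans _ _ ((C2 * Nb (- rho)) `^ beta)).
    by rewrite ge0_ler_powR ?nnegrE ?Lalpha_norm_ge0 ?(ltW b0) ?mulr_ge0 ?(ltW C20) ?(ltW (Nb0 _)).
  rewrite powRM ?(ltW C20) ?(ltW (Nb0 _))// ler_wpM2l ?powR_ge0//.
  rewrite -NbD -powRrM; apply: Nble.
  by apply: exponent_hurst_gap => //; have /andP[] := hv k.
have dist2 (k : 'I_(N - L).+1) : Lalpha_norm alpha (fun s => F0 k s - G k s) `^ beta <=
    C2 `^ beta * (Nb (- (beta * v k)) * Nb (- gam)).
  have [_ _ _ n1 _] := hk k.
  apply: (@le_trans _ _ ((C2 * Mt%:R `^ (- ((1 - h2) / 2)) * Nb (- v k)) `^ beta)).
    by rewrite ge0_ler_powR ?nnegrE ?Lalpha_norm_ge0 ?(ltW b0) ?mulr_ge0 ?powR_ge0 ?(ltW C20).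
  rewrite powR_prod3 ?powR_ge0 ?(ltW C20)// -mulrA ler_wpM2l ?powR_ge0// mulrC.
  apply: ler_pM; rewrite ?powR_ge0//; first by rewrite -powRrM mulNr mulrC.
  rewrite -powRrM.
  have -> : - ((1 - h2) / 2) * beta = - ((1 - h2) / 2 * beta) by ring.
  have x0 : 0 <= (1 - h2) / 2 * beta by rewrite mulr_ge0 ?(ltW b0)// divr_ge0// subr_ge0 ltW.
  apply: le_trans (ler_wpowRN (Nb0 _) MtN x0) _.
  by rewrite /Nb -powRrM; apply: Nble; exact: exponent_truncation_gap.
have mincr (k : 'I_(N - L).+1) : measurable_fun [set: T] (fun w => increment L (fun s : R => lmsm X H s w) N k).
  by apply: measurable_sum => l; apply: measurable_funM.
have tauE (k : 'I_(N - L).+1) : c * (C2 `^ beta * (Nb (- (beta * v k)) * Nb (- gam))) <=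
   2^-1 * (K1 * Nb (- gam)) * mu k.
  have -> : c * (C2 `^ beta * (Nb (- (beta * v k)) * Nb (- gam))) =
    2^-1 * (K1 * Nb (- gam)) * (Nb (- (beta * v k)) * gmin).
    by rewrite /K1; field; rewrite gt_eqF.
  have k0 : 0 <= 2^-1 * (K1 * Nb (- gam)).
    by apply: mulr_ge0 => //; apply: mulr_ge0; exact: ltW.
  by have := ler_wpM2l k0 (mu_lo k).
have muF0 (k : 'I_(N - L).+1) : mu k = c * Lalpha_norm alpha (F0 k) `^ beta.
  have [_ _ _ _ [_ F0n]] := hk k.
  rewrite /F0 F0n powRM ?Lalpha_norm_ge0 ?(ltW (Nb0 _))// -powRrM mulrCA.
  by congr (Nb _ * _); rewrite mulNr mulrC.
have main := @weak_law _ _ _ P _ A D W mu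
  (fun k => c * Lalpha_norm alpha (G k) `^ beta)
  (fun k => e * Lalpha_norm alpha (G k) `^ (2 * beta)) (Mt + L)
  (K1 * Nb (- gam)) K2 (KQ * Nb (1 / 8)) (Nb (- (1 / 4))).
suff S : (\int[P]_w (`|\sum_(k in A) D k w - \sum_(k in A) mu k|)%:E <=
    (C * Nb (- gam) * \sum_(k in A) mu k)%:E)%E by exact: S.
apply: le_trans; first (apply: main).
- by rewrite -(ltr0n R); apply: lt_le_trans hA; exact: Nb0.
- by rewrite mulr_ge0 ?(ltW K10) ?(ltW (Nb0 _)).
- exact: Nb0.
- exact: ltW.
- by rewrite mulr_ge0 ?(ltW KQ0) ?(ltW (Nb0 _)).
- exact: mu0.
- by move=> k; apply: measurable_abs_powR; exact: mincr.
- by move=> k; apply: measurable_abs_powR.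
- by move=> k w; exact: powR_ge0.
- by move=> k; exact: (stable_moment hZ hc (GL k)).
- move=> k; rewrite -(stable_moment hZ he (GL k)); apply: eq_integral => w _.
  by congr (_%:E); rewrite /W -powR_mulrn ?powR_ge0// -powRrM mulrC.
- move=> k j kj.
  have dis s : G k s = 0 \/ G j s = 0.
    case/orP: kj => kj; first by apply: near_kernel_disjoint => //; rewrite -addnA in kj *.
    by apply/or_comm; apply: near_kernel_disjoint.
  apply: etrans (stable_indep hZ beta (GL k) (GL j) dis) _.
  exact: (congr2 (fun a b : \bar R => (a * b)%E)
    (stable_moment hZ hc (GL k)) (stable_moment hZ hc (GL j))).
- move=> k; have [FkL Fae] := FL k.
  have -> : (\int[P]_w (`|D k w - W k w|)%:E =
      \int[P]_w (`| `|Z (F k) w| `^ beta - `|Z (G k) w| `^ beta|)%:E)%E.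
    apply: ge0_ae_eq_integral => //.
    + apply/measurable_EFinP; apply: (measurableT_comp (@normr_measurable R setT)).
      by apply: measurable_funB; apply: measurable_abs_powR; first exact: mincr.
    + apply/measurable_EFinP; apply: (measurableT_comp (@normr_measurable R setT)).
      by apply: measurable_funB; apply: measurable_abs_powR.
    + by apply: filterS Fae => w /= E _; rewrite /D /W E.
  apply: (@le_trans _ _ (\int[P]_w ((`|Z (F k) w - Z (F0 k) w| `^ beta)%:E +
      (`|Z (F0 k) w - Z (G k) w| `^ beta)%:E))%E).
    apply: integral_ge0_mono => w; rewrite lee_fin//.
    apply: le_trans (norm_powR_dist _ _ b01) _.
    have -> : Z (F k) w - Z (G k) w = (Z (F k) w - Z (F0 k) w) + (Z (F0 k) w - Z (G k) w).
      by rewrite addrA subrK.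
    exact: norm_powR_subadd.
  rewrite ge0_integralD//; first last.
  + by apply/measurable_EFinP; apply: measurable_abs_powR; exact: measurable_funB.
  + by apply/measurable_EFinP; apply: measurable_abs_powR; exact: measurable_funB.
  rewrite (stable_moment_sub a1 hZ hc FkL (F0L k)) (stable_moment_sub a1 hZ hc (F0L k) (GL k)).
  rewrite -EFinD lee_fin.
  have t1 := ler_wpM2l (ltW c0) (dist1 k); have t2 := ler_wpM2l (ltW c0) (dist2 k).
  apply: le_trans (lerD (le_trans t1 (tauE k)) (le_trans t2 (tauE k))) _.
  by rewrite -2!mulrDl (_ : 2^-1 + 2^-1 = 1 :> R) ?mul1r//; field.
- move=> k; rewrite muF0.
  rewrite -mulrBr normrM (gtr0_norm c0) distrC.
  apply: (@le_trans _ _ (c * Lalpha_norm alpha (fun s => F0 k s - G k s) `^ beta)).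
    by rewrite ler_wpM2l ?(ltW c0)//; exact: (Lalpha_norm_powR_dist a1 hZ bq c0 hc).
  have t2 := ler_wpM2l (ltW c0) (dist2 k); apply: le_trans t2 _.
  apply: le_trans (tauE k) _; rewrite -muF0.
  by apply: ler_wpM2r; [exact: ltW|apply: half_le; apply: mulr_ge0; exact: ltW].
- move=> k; have [_ _ _ _ [Gn _]] := hk k.
  apply: (@le_trans _ _ (e * (C2 * Nb (- v k)) `^ (2 * beta))).
    rewrite ler_wpM2l ?(ltW e0)// ge0_ler_powR ?nnegrE ?Lalpha_norm_ge0 ?mulr_ge0 ?(ltW b0) ?(ltW C20) ?(ltW (Nb0 _))//.
  have -> : e * (C2 * Nb (- v k)) `^ (2 * beta) = K2 * (Nb (- (beta * v k)) * gmin) ^+ 2.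
    have sq := powR_square_exponent (v k) beta Np.
    rewrite powRM ?(ltW C20) ?(ltW (Nb0 _))// /Nb sq.
    exact: square_scaling (lt0r_neq0 gmin0).
  apply: ler_wpM2l; first exact: ltW.
  have lo0 : 0 <= Nb (- (beta * v k)) * gmin by apply: mulr_ge0; exact: ltW.
  by rewrite ler_sqr ?nnegrE ?(ltW (mu0 _))//; exact: mu_lo.
- move=> k j; have /andP[_ gk] := gb _ (hv k); have /andP[gj _] := gb _ (hv j).
  apply: (@le_trans _ _ (Nb (- (beta * v k)) * gmax)).
    by apply: ler_wpM2l => //; exact: ltW.
  apply: (@le_trans _ _ (KQ * Nb (1 / 8) * (Nb (- (beta * v j)) * gmin))); last first.
    by apply: ler_wpM2l; [apply: mulr_ge0; exact: ltW|exact: mu_lo].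
  have -> : KQ * Nb (1 / 8) * (Nb (- (beta * v j)) * gmin) =
     Nb (1 / 8) * Nb (- (beta * v j)) * gmax.
    exact: ratio_scaling (lt0r_neq0 gmin0).
  rewrite ler_wpM2r ?(ltW gmax0)// -NbD; apply: Nble.
  exact: (exponent_ratio b14 h1half h21 (hv k) (hv j)).
rewrite lee_fin.
have s0 : 0 <= \sum_(k in A) mu k by apply: sumr_ge0 => k _; exact: ltW.
rewrite ler_wpM2r//.
have A0 : 0 < #|A|%:R :> R by apply: lt_le_trans hA; exact: Nb0.
have Ai : #|A|%:R^-1 <= Nb (- (3 / 4)).
  by rewrite /Nb powRN lef_pV2 ?posrE//; exact: Nb0.
have r1 : (2 * (Mt + L))%:R * K2 * (KQ * Nb (1 / 8)) / #|A|%:R / Nb (- (1 / 4)) <=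
   KL * K2 * KQ * Nb (- (1 / 4)).
  rewrite -[(Nb (- (1 / 4)))^-1]powRN opprK -/(Nb _).
  apply: (@le_trans _ _ ((KL * Nb (1 / 8)) * K2 * (KQ * Nb (1 / 8)) * Nb (- (3 / 4)) * Nb (1 / 4))).
    apply: ler_wpM2r; first exact: ltW.
    have K20' := ltW K20; have KQN : 0 <= KQ * Nb (1 / 8) by apply: mulr_ge0; exact: ltW.
    apply: ler_pM => //.
    - by apply: mulr_ge0 => //; apply: mulr_ge0.
    - by apply: ler_wpM2r => //; apply: ler_wpM2r.
  have E : Nb (1 / 8) * Nb (1 / 8) * Nb (- (3 / 4)) * Nb (1 / 4) = Nb (- (1 / 4)).
    by rewrite -!NbD; congr (Nb _); field.
  rewrite -E le_eqVlt; apply/orP; left; apply/eqP.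
  move: (Nb (1 / 8)) (Nb (- (3 / 4))) (Nb (1 / 4)) => x y z; ring.
have g4 : Nb (- (1 / 4)) <= Nb (- gam).
  by apply: Nble; rewrite lerN2 mul1r.
have KKN : KL * K2 * KQ * Nb (- (1 / 4)) <= KL * K2 * KQ * Nb (- gam).
  by apply: ler_wpM2l => //; exact: ltW.
apply: (@combine_rates (Nb (- (1 / 4))) (Nb (- gam)) K1 _ (KL * K2 * KQ)) => //.
- exact: le_trans r1 KKN.
- exact: ltW.
- exact: ltW.
rewrite /C; have := ltW ig; have := ltW gmax0; have := ltW cC1; clear; lra.
Qed.

End LmsmWeakLaw.

(** * Sums over the grids of mesh 1/N and 1/(2N) *)

Section Grid.
Context {R : realType}.

(** A window of length 1 contains at most one integer. *)
Lemma sum_unit_window (n : nat) (x : R) :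
  \sum_(k < n) ((x - 1 < k%:R) && (k%:R <= x))%:R <= 1 :> R.
Proof.
case: (pickP (fun k : 'I_n => (x - 1 < k%:R) && (k%:R <= x))) => [k0 h0|none].
  rewrite (bigD1 k0)//= h0 big1 ?addr0// => k kk0.
  case: (boolP (_ && _)) => //= /andP[h1 h2].
  case/andP: h0 => h01 h02; exfalso; move/negP: kk0; apply.
  apply/eqP; apply: val_inj => /=; apply/eqP; rewrite eqn_leq.
  by apply/andP; split; rewrite -ltnS -(ltr_nat R) -natr1; lra.
by rewrite big1// => k _; rewrite none.
Qed.

Lemma sum_tail_window (N L : nat) : (L <= N)%N ->
  \sum_(k < N.+1) (N - L < k)%N%:R <= L%:R :> R.
Proof.
move=> LN; rewrite -natr_sum ler_nat -(big_mkord xpredT (fun k => nat_of_bool (N - L < k)%N)).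
rewrite (@big_cat_nat _ _ _ (N - L).+1) //=; last by rewrite ltnS leq_subr.
rewrite big1_seq ?add0n; last first.
  by move=> k; rewrite mem_index_iota => /andP[_ /andP[_ h]]; rewrite ltnNge -ltnS h.
apply: (@leq_trans (\sum_((N - L).+1 <= k < N.+1) 1)).
  by apply: leq_sum => k _; exact: leq_b1.
by rewrite sum_nat_const_nat muln1 subSS subKn.
Qed.

Definition on_grid (L N : nat) (a b : R) (k : nat) : bool :=
  (k <= N - L)%N && (a <= k%:R / N%:R <= b).

Lemma sum_nu (L N : nat) (a b : R) (f : R -> R) :
  \sum_(k in nu L N `[a, b]) f (k%:R / N%:R) =
  \sum_(k < N.+1) (on_grid L N a b k)%:R * f (k%:R / N%:R).
Proof.
rewrite /nu; under eq_bigl do rewrite inE in_itv/=.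
rewrite (big_ord_widen_cond N.+1 (fun k => a <= k%:R / N%:R <= b)
   (fun k => f (k%:R / N%:R))) ?ltnS ?leq_subr//.
rewrite big_mkcond/=; apply: eq_bigr => k _.
rewrite /on_grid ltnS andbC; case: ifP => _; first by rewrite mul1r.
by rewrite mul0r.
Qed.

Lemma sum_even_odd (n : nat) (f : nat -> R) :
  \sum_(k < n.*2) f k = \sum_(k < n) (f (k.*2) + f (k.*2.+1)).
Proof.
elim: n => [|n IH]; first by rewrite !big_ord0.
by rewrite doubleS !big_ord_recr/= IH addrA.
Qed.

(** A point k/N and its child (2k+e)/(2N) are less than 1/N apart.  Exactly one
    of them can be selected only if k/N lies within 1/N of an end of [a, b], or
    if k is one of the last L indices. *)
Lemma on_grid_refine (L N k : nat) (e : bool) (a b : R) : (0 < L)%N -> (L <= N)%N ->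
  on_grid L N a b k != on_grid L (2 * N) a b (e + k.*2) ->
  1 <= (N - L < k)%N%:R + ((a * N%:R - 1 < k%:R) && (k%:R <= a * N%:R))%:R +
       ((b * N%:R - 1 < k%:R) && (k%:R <= b * N%:R))%:R :> R.
Proof.
move=> L0 LN mis.
have N0 : (0 < N)%N by exact: leq_trans L0 LN.
have Np : 0 < N%:R :> R by rewrite ltr0n.
have [kf|kn] := ltnP (N - L) k.
  by rewrite -addrA lerDl addr_ge0.
have xe : ((e + k.*2)%:R / (2 * N)%:R : R) = k%:R / N%:R + e%:R / (2 * N%:R).
  rewrite natrD natrM -muln2 natrM.
  by field; rewrite gt_eqF.
have le1 : (e + k.*2 <= 2 * N - L)%N by case: e {mis xe} => /=; lia.
move: mis; rewrite /on_grid kn le1 /= xe.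
have e01 : 0 <= e%:R / (2 * N%:R) :> R by rewrite divr_ge0// mulr_ge0// ltW.
have e1 : e%:R / (2 * N%:R) < N%:R^-1 :> R.
  rewrite invfM mulrA gtr_pMl ?invr_gt0//; case: (e) => /=; lra.
set x := k%:R / N%:R; set ee := e%:R / (2 * N%:R) in e01 e1 *.
have ee1 : ee * N%:R < 1 by rewrite -ltr_pdivlMr// div1r.
have kx : k%:R = x * N%:R by rewrite /x divfK// gt_eqF.
rewrite kx.
have [ax|xa] := leP a x; have [xb|bx] := leP x b => /=.
- have -> : a <= x + ee by lra.
  rewrite /=; case: (leP (x + ee) b) => // bx _.
  have -> : b * N%:R - 1 < x * N%:R.
    have : b * N%:R < (x + ee) * N%:R by rewrite ltr_pM2r.
    by rewrite mulrDl; lra.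
  have -> : x * N%:R <= b * N%:R by rewrite ler_pM2r.
  by rewrite /= lerDr addr_ge0.
- have -> : (x + ee <= b) = false by apply/negbTE; rewrite -ltNge; lra.
  by rewrite andbF.
- case: (leP a (x + ee)) => //= ax; case: (leP (x + ee) b) => // _ _.
  have -> : a * N%:R - 1 < x * N%:R.
    have := ler_wpM2r (ltW Np) ax; rewrite mulrDl; lra.
  have -> : x * N%:R <= a * N%:R by rewrite ler_pM2r// ltW.
  by rewrite /= add0r lerDl.
- have -> : (x + ee <= b) = false by apply/negbTE; rewrite -ltNge; lra.
  by rewrite andbF.
Qed.

(** Compare each k/N with its two children 2k/(2N) and (2k+1)/(2N).  Where
    both are selected the values of f differ by at most de f(k/N); at most
    L + 2 indices k are exceptional, and Mx S / #|nu| bounds f at each of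
    them. *)
Lemma grid_refine (L N : nat) (a b Mx de : R) (f : R -> R) :
  (0 < L)%N -> (L <= N)%N -> 0 <= a -> b <= 1 -> 0 <= de -> 0 <= Mx ->
  (0 < #|nu L N `[a, b]|)%N ->
  (forall t, 0 <= t <= 1 -> 0 <= f t) ->
  (forall s t, 0 <= s <= 1 -> 0 <= t <= 1 -> f s <= Mx * f t) ->
  (forall s t, 0 <= s <= 1 -> 0 <= t <= 1 -> `|s - t| <= N%:R^-1 ->
     `|f s - f t| <= de * f t) ->
  `|\sum_(k in nu L (2 * N) `[a, b]) f (k%:R / (2 * N)%:R) -
    2 * \sum_(k in nu L N `[a, b]) f (k%:R / N%:R)| <=
  (2 * de + (2 * L + 4)%:R * Mx / #|nu L N `[a, b]|%:R) *
    \sum_(k in nu L N `[a, b]) f (k%:R / N%:R).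
Proof.
move=> L0 LN a0 b1 de0 Mx0 nu0 f0 fM fde.
set S := \sum_(k in nu L N `[a, b]) f (k%:R / N%:R).
set S' := \sum_(k in nu L (2 * N) `[a, b]) _.
have N0 : (0 < N)%N by exact: leq_trans L0 LN.
have Np : 0 < N%:R :> R by rewrite ltr0n.
set n := #|_|%:R : R; have n0 : 0 < n by rewrite ltr0n.
have grid k N' : (0 < N')%N -> on_grid L N' a b k -> 0 <= (k%:R / N'%:R : R) <= 1.
  by move=> _ /andP[_ /andP[h1 h2]]; apply/andP; split; [exact: le_trans h1|exact: le_trans b1].
have fS t : 0 <= t <= 1 -> f t <= Mx * (S / n).
  move=> t01; rewrite mulrA ler_pdivlMr// mulrC mulr_natl -sumr_const /S mulr_sumr.
  apply: ler_sum => k; rewrite inE in_itv/= => /andP[h1 h2].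
  by apply: fM => //; apply/andP; split; [exact: le_trans h1|exact: le_trans b1].
have S0 : 0 <= S.
  apply: sumr_ge0 => k; rewrite inE in_itv/= => /andP[h1 h2]; apply: f0.
  by apply/andP; split; [exact: le_trans h1|exact: le_trans b1].
pose q : R := Mx * (S / n); have q0 : 0 <= q by rewrite mulr_ge0// divr_ge0// ltW.
pose chi k : R := (on_grid L N a b k)%:R.
pose w (k : nat) : R := (N - L < k)%N%:R + ((a * N%:R - 1 < k%:R) && (k%:R <= a * N%:R))%:R +
       ((b * N%:R - 1 < k%:R) && (k%:R <= b * N%:R))%:R.
have w0 k : 0 <= w k by rewrite !addr_ge0.
pose h (m : nat) := (on_grid L (2 * N) a b m)%:R * f (m%:R / (2 * N)%:R).
have S'E : S' = \sum_(k < N.+1) (h k.*2 + h k.*2.+1).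
  rewrite -(sum_even_odd N.+1 h) /S' sum_nu doubleS [RHS]big_ord_recr/=.
  have -> : h (N.*2.+1) = 0.
    rewrite /h /on_grid (_ : (N.*2 < _)%N = false) ?mul0r//.
    by rewrite ltnNge mul2n leq_subr.
  by rewrite addr0 /h mul2n.
have SE : 2 * S = \sum_(k < N.+1) (chi k * f (k%:R / N%:R) + chi k * f (k%:R / N%:R)).
  by rewrite /S sum_nu mulr_sumr; apply: eq_bigr => k _; rewrite -/(chi k) mulr2n mulrDl !mul1r.
have each (k : nat) (e : bool) :
    `|h (e + k.*2)%N - chi k * f (k%:R / N%:R)| <= chi k * (de * f (k%:R / N%:R)) + w k * q.
  have wq : 0 <= w k * q by exact: mulr_ge0.
  have [same|diff] := eqVneq (on_grid L N a b k) (on_grid L (2 * N) a b (e + k.*2)).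
    rewrite /h /chi -same; case: (boolP (on_grid L N a b k)) => [g|_]; last first.
      by rewrite !mul0r subrr normr0 add0r.
    rewrite !mul1r; apply: le_trans (fde _ _ _ _ _) _; last by rewrite lerDl.
    - by apply: grid; rewrite -?same ?muln_gt0.
    - exact: grid _ _ N0 g.
    - have -> : ((e + k.*2)%:R / (2 * N)%:R : R) - k%:R / N%:R = e%:R / (2 * N%:R).
        by rewrite natrD natrM -muln2 natrM; field; rewrite gt_eqF.
      rewrite ger0_norm; last by rewrite divr_ge0// mulr_ge0// ltW.
      by rewrite invfM mulrA ler_piMl ?invr_ge0 ?(ltW Np)//; case: (e) => /=; lra.
  have w1 : 1 <= w k by exact: (on_grid_refine L0 LN diff).
  have qw : q <= w k * q by rewrite ler_peMl.
  rewrite /h /chi; move: diff.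
  case: (boolP (on_grid L N a b k)) => g; case: (boolP (on_grid L (2 * N) a b (e + k.*2))) => g' // _.
    rewrite mul0r !mul1r sub0r normrN.
    have t01 : 0 <= (k%:R / N%:R : R) <= 1 := grid _ _ N0 g.
    rewrite ger0_norm ?f0//; apply: le_trans (fS _ t01) _.
    by apply: le_trans qw _; rewrite lerDr mulr_ge0// f0.
  rewrite !mul0r mul1r subr0 add0r.
  have t01 : 0 <= ((e + k.*2)%:R / (2 * N)%:R : R) <= 1.
    by apply: grid _ _ _ g'; rewrite muln_gt0.
  by rewrite ger0_norm ?f0//; exact: le_trans (fS _ t01) _.
have sumw : \sum_(k < N.+1) w k <= L%:R + 2.
  rewrite /w !big_split/=.
  have := sum_tail_window LN; have := sum_unit_window N.+1 (a * N%:R).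
  have := sum_unit_window N.+1 (b * N%:R); lra.
rewrite S'E SE -sumrB.
apply: le_trans (ler_norm_sum _ _ _) _.
apply: (@le_trans _ _ (\sum_(k < N.+1) (2 * de * (chi k * f (k%:R / N%:R)) + 2 * q * w k))).
  apply: ler_sum => k _.
  have e0 := each k false; have e1 := each k true.
  rewrite add0n in e0; rewrite add1n in e1.
  rewrite opprD addrACA; apply: le_trans (ler_normD _ _) _.
  apply: le_trans (lerD e0 e1) _; rewrite le_eqVlt; apply/orP; left; apply/eqP; ring.
rewrite big_split/= -!mulr_sumr -(sum_nu L N a b f) -/S.
rewrite [leRHS]mulrDl lerD2l.
apply: (@le_trans _ _ (2 * q * (L%:R + 2))).
  by rewrite ler_wpM2l// mulr_ge0.
rewrite /q natrD natrM le_eqVlt; apply/orP; left; apply/eqP.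
by field; rewrite gt_eqF.
Qed.

Lemma nu_card_lower (L N : nat) (a b : R) : (L <= N)%N -> (0 < N)%N -> 0 <= a -> b <= 1 ->
  N%:R * (b - a) - L%:R - 1 <= #|nu L N `[a, b]|%:R.
Proof.
move=> LN N0 a0 b1; have Np : 0 < N%:R :> R by rewrite ltr0n.
set x := N%:R * (b - a) - L%:R.
have [x0|x0] := leP 0 x; last first.
  by apply: le_trans (ler0n _ _); lra.
pose c := Num.truncn x; pose k0 := (Num.truncn (a * N%:R)).+1.
have cx : c%:R <= x by rewrite truncn_le.
have xc : x - 1 <= c%:R by have := truncnS_gt x; rewrite -natr1 -/c; lra.
have an0 : 0 <= a * N%:R by rewrite mulr_ge0// ltW.
have k01 : a * N%:R <= k0%:R by apply: ltW; exact: truncnS_gt.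
have k02 : k0%:R <= a * N%:R + 1.
  by rewrite /k0 -natr1 lerD2r truncn_le.
apply: le_trans xc _; rewrite ler_nat.
have bnd (i : 'I_c) : (k0 + i)%:R <= b * N%:R - L%:R.
  have ic : (i%:R + 1 : R) <= c%:R by rewrite natr1 ler_nat.
  rewrite natrD; move: cx; rewrite /x; lra.
have lt (i : 'I_c) : (k0 + i < (N - L).+1)%N.
  rewrite ltnS -(ler_nat R) natrB//; apply: le_trans (bnd i) _.
  by rewrite lerD2r ler_piMl// ltW.
pose f (i : 'I_c) : 'I_(N - L).+1 := Ordinal (lt i).
have finj : injective f by move=> i j /(congr1 val)/= /addnI; exact: val_inj.
rewrite -[c]card_ord -(card_imset _ finj); apply: subset_leq_card.
apply/fintype.subsetP => _ /imsetP[i _ ->]; rewrite inE in_itv/=.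
rewrite ler_pdivlMr// ler_pdivrMr// natrD; apply/andP; split.
  by rewrite (le_trans k01)// lerDl.
have := bnd i; rewrite natrD; have := ler0n R L; lra.
Qed.

End Grid.

(** * The logarithm of the truncated ratio *)

Section TruncatedRatio.
Context {R : realType}.

Lemma trunc_ratio_bounds (beta x : R) : 0 < beta ->
  2 `^ (beta / 2) <= trunc_ratio beta x <= 2 `^ beta.
Proof.
move=> b0; have h : 2 `^ (beta / 2) <= 2 `^ beta :> R by rewrite ler_powR//; lra.
by rewrite /trunc_ratio ge_min lexx /= le_min h /= le_max lexx orbT.
Qed.

Lemma ln2_gt0 : 0 < ln 2 :> R.
Proof. by rewrite ln_gt0// ltr1n. Qed.

Lemma Hhat_bounds (L : nat) (beta : R) (y : R -> R) (N : nat) (I : interval R) :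
  0 < beta -> 2^-1 <= Hhat L beta y N I <= 1.
Proof.
move=> b0; rewrite /Hhat /log2.
set x := (X in trunc_ratio _ X); have /andP[h1 h2] := @trunc_ratio_bounds beta x b0.
have t0 : 0 < trunc_ratio beta x by apply: lt_le_trans h1; rewrite powR_gt0.
have l2 := ln2_gt0.
have h1' : ln (2 `^ (beta / 2)) <= ln (trunc_ratio beta x) by rewrite ler_ln ?posrE ?powR_gt0.
have h2' : ln (trunc_ratio beta x) <= ln (2 `^ beta) by rewrite ler_ln ?posrE ?powR_gt0.
rewrite !ln_powR in h1' h2'.
have -> : beta^-1 * (ln (trunc_ratio beta x) / ln 2) = ln (trunc_ratio beta x) / (beta * ln 2).
  by field; rewrite !gt_eqF.
by rewrite ler_pdivlMr ?mulr_gt0// ler_pdivrMr ?mulr_gt0//; apply/andP; split; lra.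
Qed.

(** The truncation is a projection onto an interval that contains
    2^(beta H0), so it does not increase the distance to this value. *)
Lemma trunc_ratio_error (beta x H0 eta e : R) : 0 < beta -> 0 < x ->
  2^-1 <= H0 <= 1 -> 0 <= eta -> 0 <= e ->
  ln x <= beta * ln 2 * (H0 + eta) + e -> beta * ln 2 * (H0 - eta) - e <= ln x ->
  `|beta^-1 * log2 (trunc_ratio beta x) - H0| <= eta + e / (beta * ln 2).
Proof.
move=> b0 x0 /andP[H1 H2] eta0 e0 up lo; have l2 := ln2_gt0.
have bl : 0 < beta * ln 2 by exact: mulr_gt0.
have blH : beta * ln 2 * 2^-1 <= beta * ln 2 * H0 by rewrite ler_wpM2l// ltW.
have blH' : beta * ln 2 * H0 <= beta * ln 2 * 1 by rewrite ler_wpM2l// ltW.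
have bleta : 0 <= beta * ln 2 * eta by rewrite mulr_ge0// ltW.
pose t := trunc_ratio beta x.
have tE : ln t <= beta * ln 2 * (H0 + eta) + e /\ beta * ln 2 * (H0 - eta) - e <= ln t.
  rewrite /t /trunc_ratio; case: (leP x (2 `^ (beta / 2))) => xlo.
    rewrite min_r; last by rewrite ler_powR//; lra.
    have : ln x <= ln (2 `^ (beta / 2)) by rewrite ler_ln ?posrE ?powR_gt0.
    by rewrite ln_powR; split; lra.
  case: (leP (2 `^ beta) x) => xhi.
    have : ln (2 `^ beta) <= ln x by rewrite ler_ln ?posrE ?powR_gt0.
    by rewrite ln_powR; split; lra.
  by split.
have -> : beta^-1 * log2 t - H0 = (ln t - beta * ln 2 * H0) / (beta * ln 2).
  by rewrite /log2; field; rewrite !gt_eqF.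
rewrite normrM [X in _ * X]gtr0_norm ?invr_gt0// ler_pdivrMr// mulrDl divfK ?gt_eqF//.
by case: tE => u l; rewrite ler_norml; apply/andP; split; lra.
Qed.

Lemma norm_sub_le_mul (x y a e : R) : `|x - a * y| <= e * y ->
  (a - e) * y <= x /\ x <= (a + e) * y.
Proof. by rewrite ler_norml mulrBl mulrDl => /andP[h1 h2]; split; lra. Qed.

(** S/n and S'/n' are the empirical means at N and 2N.  Their ratio is
    mu / n divided by mu' / n', where n' is about 2n and mu' is between
    q1 2mu and q2 2mu, up to factors 1 + O(e); (1+e)(2+e) <= (1+4e)(1-e)(2-e)
    for e <= 1/8. *)
Lemma ln_ratio_bounds (S S' n n' mu mu' Sg q1 q2 e : R) :
  0 < n -> 0 < mu -> 0 < q1 -> 0 < q2 -> 0 <= e <= 8^-1 ->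
  `|S - mu| <= e * mu -> `|S' - mu'| <= e * mu' -> `|n' - 2 * n| <= e * n ->
  `|Sg - 2 * mu| <= e * mu -> q1 * Sg <= mu' -> mu' <= q2 * Sg ->
  [/\ 0 < (n^-1 * S) / (n'^-1 * S'),
      ln ((n^-1 * S) / (n'^-1 * S')) <= - ln q1 + 4 * e &
      - ln q2 - 4 * e <= ln ((n^-1 * S) / (n'^-1 * S'))].
Proof.
move=> n0 mu0 q10 q20 /andP[e0 e8].
have norm1 (x y : R) : `|x - y| <= e * y -> (1 - e) * y <= x /\ x <= (1 + e) * y.
  by move=> h; apply: norm_sub_le_mul; rewrite mul1r.
move=> /norm1[S1 S2] /norm1[S1' S2'] /norm_sub_le_mul[n1 n2] /norm_sub_le_mul[g1 g2] m1 m2.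
pose c := (1 + e) * (2 + e); pose cm := (1 - e) * (2 - e).
have e4 : 0 < 1 + 4 * e by apply: ltr_wpDr => //; exact: mulr_ge0.
have [e1 e2 e1' e2' ccm] : [/\ 0 < 1 - e, 0 < 2 - e, 0 < 1 + e, 0 < 2 + e &
    c <= (1 + 4 * e) * cm].
  by rewrite /c /cm; move: e0 e8; clear => e0 e8; split; try lra; nra.
have Sp : 0 < S by apply: lt_le_trans S1; exact: mulr_gt0.
have n'p : 0 < n' by apply: lt_le_trans n1; exact: mulr_gt0.
have Sg0 : 0 < Sg by apply: lt_le_trans g1; exact: mulr_gt0.
have mu'0 : 0 < mu' by apply: lt_le_trans m1; exact: mulr_gt0.
have S'p : 0 < S' by apply: lt_le_trans S1'; exact: mulr_gt0.
have E : (n^-1 * S) / (n'^-1 * S') = (n' * S) / (n * S').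
  by field; rewrite !gt_eqF.
have up : (n' * S) / (n * S') <= (1 + 4 * e) / q1.
  rewrite ler_pdivrMr ?mulr_gt0// mulrAC ler_pdivlMr//.
  apply: (@le_trans _ _ (((2 + e) * n) * ((1 + e) * mu) * q1)).
    by apply: ler_wpM2r; [exact: ltW|apply: ler_pM => //; exact: ltW].
  apply: (@le_trans _ _ ((1 + 4 * e) * (n * ((1 - e) * (q1 * ((2 - e) * mu)))))).
    have -> : (2 + e) * n * ((1 + e) * mu) * q1 = c * (n * mu * q1) by rewrite /c; ring.
    have -> : (1 + 4 * e) * (n * ((1 - e) * (q1 * ((2 - e) * mu)))) = (1 + 4 * e) * cm * (n * mu * q1).
      by rewrite /cm; ring.
    by apply: ler_wpM2r => //; apply: ltW; apply: mulr_gt0 => //; exact: mulr_gt0.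
  apply: ler_wpM2l; first exact: ltW.
  apply: ler_wpM2l; first exact: ltW.
  apply: le_trans S1'; apply: ler_wpM2l; first exact: ltW.
  by apply: le_trans m1; apply: ler_wpM2l => //; exact: ltW.
have lo : (n * S') / (n' * S) <= (1 + 4 * e) * q2.
  rewrite ler_pdivrMr ?mulr_gt0//.
  apply: (@le_trans _ _ (n * ((1 + e) * (q2 * ((2 + e) * mu))))).
    apply: ler_wpM2l; first exact: ltW.
    apply: le_trans S2' _; apply: ler_wpM2l; first exact: ltW.
    by apply: le_trans m2 _; apply: ler_wpM2l => //; exact: ltW.
  apply: (@le_trans _ _ ((1 + 4 * e) * q2 * (((2 - e) * n) * ((1 - e) * mu)))).
    have -> : n * ((1 + e) * (q2 * ((2 + e) * mu))) = c * (n * mu * q2) by rewrite /c; ring.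
    have -> : (1 + 4 * e) * q2 * ((2 - e) * n * ((1 - e) * mu)) = (1 + 4 * e) * cm * (n * mu * q2).
      by rewrite /cm; ring.
    by apply: ler_wpM2r => //; apply: ltW; apply: mulr_gt0 => //; exact: mulr_gt0.
  apply: ler_wpM2l; first by apply: ltW; exact: mulr_gt0.
  by apply: ler_pM => //; apply: ltW; exact: mulr_gt0.
have ln4 : ln (1 + 4 * e) <= 4 * e by apply: le_ln1Dx; apply: lt_le_trans (mulr_ge0 _ e0).
have r0 : 0 < (n' * S) / (n * S') by rewrite divr_gt0// mulr_gt0.
rewrite E; split => //.
- apply: le_trans (_ : ln ((1 + 4 * e) / q1) <= _).
    by rewrite ler_ln ?posrE// divr_gt0.
  by rewrite ln_div ?posrE// addrC lerD2l.
- have r0' : 0 < (n * S') / (n' * S) by rewrite divr_gt0// mulr_gt0.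
  have : ln ((n * S') / (n' * S)) <= ln ((1 + 4 * e) * q2).
    by rewrite ler_ln ?posrE// mulr_gt0.
  rewrite -[n * S' / _]invrK invf_div lnV ?posrE// lnM ?posrE// => h.
  by move: h ln4; clear; lra.
Qed.

End TruncatedRatio.

(** * Piecewise linear interpolation in the Hoelder norm *)

Section Interpolation.
Context {R : realType}.

(** The estimator of the function H for arbitrary values h on the
    blocks. *)
Definition interp (h : nat -> R) (theta t : R) : R :=
  let m := Num.truncn theta^-1 in
  if m.-1%:R * theta <= t then h m.-1 else
  let n := Num.truncn (t / theta) in
  let x := theta^-1 * (t - n%:R * theta) in
  (1 - x) * h n + x * h n.+1.

Lemma HtildeE (L : nat) (beta : R) (y : R -> R) (N : nat) (theta : R) :
  Htilde L beta y N theta = interp (fun n => Hhat L beta y N (block theta n)) theta.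
Proof. by []. Qed.

Section Error.
Variables (theta D : R) (h : nat -> R) (H : R -> R) (cH rho b : R).
Hypothesis theta01 : 0 < theta <= 1.
Local Notation m := (Num.truncn theta^-1).

Lemma block_count_gt0 : (0 < m)%N.
Proof.
by have /andP[t0 t1] := theta01; rewrite truncn_gt0 invf_ge1.
Qed.

Lemma last_node_le1 : m%:R * theta <= 1.
Proof.
have /andP[t0 t1] := theta01.
by rewrite -ler_pdivlMr// div1r truncn_le// invr_ge0 ltW.
Qed.

Lemma node_in_block (n : nat) : (n < m)%N -> n%:R * theta \in block theta n.
Proof.
have /andP[t0 t1] := theta01.
move=> nm; rewrite /block; case: ifP => h1; rewrite in_itv/=.
  by rewrite lexx/= ler_wpM2r ?(ltW t0)// ler_nat.
have -> : n = m.-1 by have := block_count_gt0; lia.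
rewrite lexx/=; apply: le_trans last_node_le1.
by rewrite ler_wpM2r ?(ltW t0)// ler_nat leq_pred.
Qed.

Lemma next_node_in_block (n : nat) : (n < m.-1)%N -> n.+1%:R * theta \in block theta n.
Proof.
have /andP[t0 t1] := theta01.
move=> nm; rewrite /block nm in_itv/= lexx andbT.
by rewrite ler_wpM2r ?(ltW t0)// ler_nat.
Qed.

Lemma node01 (n : nat) : (n < m)%N -> 0 <= n%:R * theta <= 1.
Proof.
have /andP[t0 t1] := theta01.
move=> nm; rewrite mulr_ge0 ?(ltW t0)//=; apply: le_trans last_node_le1.
by rewrite ler_wpM2r ?(ltW t0)// ler_nat ltnW.
Qed.

Lemma interp_cell (n : nat) (t : R) : (n < m.-1)%N ->
  n%:R * theta <= t <= n.+1%:R * theta ->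
  interp h theta t = h n + (t / theta - n%:R) * (h n.+1 - h n).
Proof.
have /andP[t0 t1] := theta01 => nm /andP[n1 n2].
rewrite /interp; case: ifPn => last.
  have nm' : n.+1 = m.-1.
    apply/eqP; rewrite eqn_leq nm/=.
    by have := le_trans last n2; rewrite ler_pM2r// ler_nat.
  have -> : t = n.+1%:R * theta by apply/eqP; rewrite eq_le n2 nm' last.
  by rewrite -nm' mulfK ?gt_eqF// -natr1; ring.
have [e|ne] := eqVneq t (n.+1%:R * theta).
  have -> : Num.truncn (t / theta) = n.+1 by rewrite e mulfK ?gt_eqF// natrK.
  by rewrite e mulfK ?gt_eqF// subrr mulr0 subr0 mul1r mul0r addr0 -natr1; ring.
have -> : Num.truncn (t / theta) = n.
  apply: truncn_def; rewrite ler_pdivlMr// ltr_pdivrMr// n1/= lt_neqAle ne.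
  exact: n2.
by field; rewrite gt_eqF.
Qed.

Lemma interp_last (t : R) : m.-1%:R * theta <= t -> interp h theta t = h m.-1.
Proof. by move=> h1; rewrite /interp h1. Qed.

Lemma cell_of (t : R) : 0 <= t -> t < m.-1%:R * theta ->
  exists2 n : nat, (n < m.-1)%N & n%:R * theta <= t < n.+1%:R * theta.
Proof.
have /andP[th0 th1] := theta01 => t0 tm.
exists (Num.truncn (t / theta)).
  rewrite -(ltr_nat R); apply: le_lt_trans (_ : t / theta < _).
    by rewrite truncn_le// divr_ge0// ltW.
  by rewrite ltr_pdivrMr.
rewrite -ler_pdivlMr// -ltr_pdivrMr// truncnS_gt truncn_le// divr_ge0// ltW//.
Qed.

Hypothesis D0 : 0 <= D.
Hypothesis hD : forall n t, (n < m)%N -> 0 <= t <= 1 -> t \in block theta n ->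
  `|h n - H t| <= D.
Hypothesis cH0 : 0 <= cH.
Hypothesis b_rho : 0 < b < rho.
Hypothesis rho1 : rho <= 1.
Hypothesis hHolder : forall t1 t2 : R, 0 <= t1 <= 1 -> 0 <= t2 <= 1 ->
  `|H t1 - H t2| <= cH * `|t1 - t2| `^ rho.

Lemma pred_ltn (n : nat) : (n < m.-1)%N -> (n.+1 < m)%N.
Proof. by have := block_count_gt0; case: (m) => // k _; rewrite ltnS. Qed.

(** Adjacent blocks share a node, at which both values are close to H. *)
Lemma jump_le (n : nat) : (n < m.-1)%N -> `|h n.+1 - h n| <= 2 * D.
Proof.
move=> nm; have nm1 := pred_ltn nm.
have n1 := node01 nm1.
have e1 := hD nm1 n1 (node_in_block nm1).
have e2 := hD (ltn_trans (ltnSn n) nm1) n1 (next_node_in_block nm).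
rewrite (_ : h n.+1 - h n = (h n.+1 - H (n.+1%:R * theta)) - (h n - H (n.+1%:R * theta))).
  by apply: le_trans (ler_normB _ _) _; move: (lerD e1 e2); rewrite mulr2n mulrDl mul1r.
by rewrite opprB addrA subrK.
Qed.

Lemma interp_cell_lip (n : nat) (s t : R) : (n < m.-1)%N ->
  n%:R * theta <= s -> s <= t -> t <= n.+1%:R * theta ->
  `|interp h theta s - interp h theta t| <= 2 * D / theta * (t - s).
Proof.
have /andP[th0 th1] := theta01 => nm ns st tn.
rewrite !(interp_cell nm); last 2 first.
- by rewrite ?(le_trans ns st) ?ns ?tn ?(le_trans st tn).
- by rewrite ?(le_trans ns st) ?ns ?tn ?(le_trans st tn).
rewrite (_ : _ - _ = (h n.+1 - h n) * ((s - t) / theta)); last by field; rewrite gt_eqF.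
have e : `|(s - t) / theta| = (t - s) / theta.
  have tv : 0 < theta^-1 by rewrite invr_gt0.
  have st0 : 0 <= t - s by rewrite subr_ge0.
  by rewrite normrM (gtr0_norm tv) distrC (ger0_norm st0).
have -> : 2 * D / theta * (t - s) = 2 * D * ((t - s) / theta) by field; rewrite gt_eqF.
rewrite normrM e; apply: ler_wpM2r; last exact: jump_le.
by rewrite divr_ge0 ?subr_ge0 ?(ltW th0).
Qed.

(** Two points less than theta apart lie in the same cell or in two adjacent
    ones, and the slope is at most 2 D / theta on each cell. *)
Lemma interp_lip (s t : R) : 0 <= s -> s < t -> t - s < theta ->
  `|interp h theta s - interp h theta t| <= 2 * D / theta * (t - s).
Proof.
have /andP[th0 th1] := theta01 => s0 st ts.
have K0 : 0 <= 2 * D / theta by rewrite divr_ge0 ?(ltW th0)// mulr_ge0.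
have [last|notlast] := leP (m.-1%:R * theta) s.
  by rewrite (interp_last last) (interp_last (le_trans last (ltW st))) subrr normr0
    mulr_ge0// subr_ge0 ltW.
have [n nm /andP[n1 n2]] := cell_of s0 notlast.
have [tn|nt] := leP t (n.+1%:R * theta); first exact: (interp_cell_lip nm n1 (ltW st) tn).
have e1 := interp_cell_lip nm n1 (ltW n2) (lexx _).
set z := n.+1%:R * theta in n2 nt e1 *.
have e2 : `|interp h theta z - interp h theta t| <= 2 * D / theta * (t - z).
  have [last|nm2] := leqP m.-1 n.+1.
    have zm : m.-1%:R * theta <= z by rewrite ler_wpM2r ?(ltW th0)// ler_nat.
    by rewrite (interp_last zm) (interp_last (le_trans zm (ltW nt))) subrr normr0
      mulr_ge0// subr_ge0 ltW.
  apply: (interp_cell_lip nm2) => //; first exact: ltW.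
  rewrite -[n.+2%:R]natr1 mulrDl mul1r -/z.
  have h1 : t < s + theta by rewrite -ltrBlDl.
  by apply: ltW; apply: lt_le_trans h1 _; rewrite lerD2r ltW.
rewrite (_ : interp h theta s - interp h theta t =
  (interp h theta s - interp h theta z) + (interp h theta z - interp h theta t)); last first.
  by rewrite addrA subrK.
apply: le_trans (ler_normD _ _) _; apply: le_trans (lerD e1 e2) _.
by rewrite -mulrDr addrC addrA subrK.
Qed.

Lemma interp_sup (t : R) : 0 <= t <= 1 ->
  `|interp h theta t - H t| <= D + cH * theta `^ rho.
Proof.
have /andP[th0 th1] := theta01 => t01; have /andP[t0 t1] := t01.
have c0 : 0 <= cH * theta `^ rho by rewrite mulr_ge0 ?powR_ge0.
have rho0 : 0 <= rho by have /andP[b1 b2] := b_rho; exact: ltW (lt_trans b1 b2).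
have [last|notlast] := leP (m.-1%:R * theta) t.
  rewrite interp_last//; apply: le_trans (_ : D <= _); last by rewrite lerDl.
  apply: hD => //; first by rewrite ltn_predL block_count_gt0.
  by rewrite /block ltnn in_itv/= last.
have [n nm /andP[n1 n2]] := cell_of t0 notlast.
have nm1 := pred_ltn nm.
rewrite (interp_cell nm); last by rewrite n1 ltW.
set x := t / theta - n%:R.
have x0 : 0 <= x by rewrite subr_ge0 ler_pdivlMr.
have x1 : x <= 1 by rewrite lerBlDr addrC natr1 ler_pdivrMr// ltW.
have e1 : `|h n - H t| <= D.
  apply: hD => //; first exact: ltn_trans (ltnSn n) nm1.
  by rewrite /block nm in_itv/= n1 ltW.
have e2 : `|h n.+1 - H t| <= D + cH * theta `^ rho.
  have z01 := node01 nm1.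
  have f1 := hD nm1 z01 (node_in_block nm1).
  have f2 := hHolder z01 t01.
  rewrite (_ : h n.+1 - H t = (h n.+1 - H (n.+1%:R * theta)) + (H (n.+1%:R * theta) - H t)).
    apply: le_trans (ler_normD _ _) _; apply: lerD => //; apply: le_trans f2 _.
    rewrite ler_wpM2l// ge0_ler_powR ?nnegrE ?(ltW th0)//.
    rewrite ger0_norm ?subr_ge0 ?(ltW n2)//.
    by rewrite -natr1 mulrDl mul1r lerBlDl lerD2r.
  by rewrite addrA subrK.
rewrite (_ : _ - _ = (1 - x) * (h n - H t) + x * (h n.+1 - H t)); last by ring.
apply: le_trans (ler_normD _ _) _; rewrite !normrM (ger0_norm x0) ger0_norm ?subr_ge0//.
apply: (@le_trans _ _ ((1 - x) * (D + cH * theta `^ rho) + x * (D + cH * theta `^ rho))).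
  apply: lerD; last exact: ler_wpM2l.
  by apply: ler_wpM2l; [rewrite subr_ge0|apply: le_trans e1 _; rewrite lerDl].
by rewrite -mulrDl subrK mul1r.
Qed.

(** For points at distance u >= theta the sup bound and u^-b <= theta^-b are
    enough.  For u < theta, the slope 2 D / theta and the Hoelder bound of H
    give 2 D u^(1-b) / theta + cH u^(rho-b), which is increasing in u as
    b < rho <= 1. *)
Lemma interp_holder_norm :
  (holder_norm b (fun t => interp h theta t - H t)%R <=
   (3 * (D + cH * theta `^ rho) * theta `^ (- b))%:E)%E.
Proof.
have /andP[th0 th1] := theta01; have /andP[b0 brho] := b_rho.
have b1 : b < 1 by exact: lt_le_trans rho1.
set B := D + cH * theta `^ rho.
have B0 : 0 <= B by rewrite addr_ge0// mulr_ge0 ?powR_ge0.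
have tb1 : 1 <= theta `^ (- b).
  rewrite powRN invf_ge1 ?powR_gt0//; apply: (@le_trans _ _ (1 `^ b)); last by rewrite powR1.
  by rewrite ge0_ler_powR ?nnegrE ?(ltW b0) ?(ltW th0).
have tb0 : 0 <= theta `^ (- b) by exact: powR_ge0.
have sup : (sup_norm (fun t => interp h theta t - H t)%R <= B%:E)%E.
  by apply: ge_ereal_sup => _ [t t01 <-]; rewrite lee_fin; exact: interp_sup.
have sem : (ereal_sup [set z | exists t1 t2 : R, [/\ 0 <= t1, t1 < t2, t2 <= 1 &
     z = (`|interp h theta t1 - H t1 - (interp h theta t2 - H t2)| / `|t1 - t2| `^ b)%:E]]%R
     <= (2 * B * theta `^ (- b))%:E)%E.
  apply: ge_ereal_sup => _ [t1 [t2 [t10 t12 t21 ->]]]; rewrite lee_fin.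
  have u0 : 0 < t2 - t1 by rewrite subr_gt0.
  have t1I : 0 <= t1 <= 1 by rewrite t10 (le_trans (ltW t12)).
  have t2I : 0 <= t2 <= 1 by rewrite t21 (le_trans t10 (ltW t12)).
  rewrite (distrC t1) (gtr0_norm u0) ler_pdivrMr ?powR_gt0//.
  have [big|small] := leP theta (t2 - t1).
    apply: le_trans (ler_normB _ _) _.
    apply: le_trans (lerD (interp_sup t1I) (interp_sup t2I)) _; rewrite -/B.
    have tu : 1 <= theta `^ (- b) * (t2 - t1) `^ b.
      rewrite powRN mulrC ler_pdivlMr ?powR_gt0// mul1r.
      by rewrite ge0_ler_powR ?nnegrE ?(ltW b0) ?(ltW th0) ?(ltW u0).
    have BB0 : 0 <= 2 * B by rewrite mulr_ge0.
    have := ler_wpM2l BB0 tu; rewrite mulr1 mulrA; apply: le_trans.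
    by rewrite mulrDl mul1r.
  have lip := interp_lip t10 t12 small.
  have hol := hHolder t1I t2I; rewrite (distrC t1) (gtr0_norm u0) in hol.
  rewrite (_ : interp h theta t1 - H t1 - (interp h theta t2 - H t2) =
    (interp h theta t1 - interp h theta t2) - (H t1 - H t2)); last by ring.
  apply: le_trans (ler_normB _ _) _; apply: le_trans (lerD lip hol) _.
  set u := t2 - t1 in u0 small *.
  have ub : u = u `^ (1 - b) * u `^ b by rewrite -powRD_gt0// subrK powRr1// ltW.
  have urho : u `^ rho = u `^ (rho - b) * u `^ b by rewrite -powRD_gt0// subrK.
  have tht : theta `^ (1 - b) = theta * theta `^ (- b).
    by rewrite powRD_gt0// powRr1// ltW.
  have thr : theta `^ (rho - b) = theta `^ rho * theta `^ (- b) by rewrite powRD_gt0.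
  have p1 : u `^ (1 - b) <= theta * theta `^ (- b).
    by rewrite -tht; apply: ge0_ler_powR; rewrite ?nnegrE ?subr_ge0; exact: ltW.
  have p2 : u `^ (rho - b) <= theta `^ rho * theta `^ (- b).
    by rewrite -thr; apply: ge0_ler_powR; rewrite ?nnegrE ?subr_ge0; exact: ltW.
  rewrite [X in _ * X + _]ub urho !mulrA -mulrDl ler_wpM2r ?powR_ge0//.
  apply: (@le_trans _ _ (2 * D / theta * (theta * theta `^ (- b)) +
     cH * (theta `^ rho * theta `^ (- b)))).
    apply: lerD; rewrite ler_wpM2l// divr_ge0 ?(ltW th0)// mulr_ge0//.
  have -> : 2 * D / theta * (theta * theta `^ (- b)) + cH * (theta `^ rho * theta `^ (- b)) =
     (2 * D + cH * theta `^ rho) * theta `^ (- b) by field; rewrite gt_eqF.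
  rewrite ler_wpM2r// /B mulrDr lerD2l -[leLHS]mul1r ler_wpM2r ?mulr_ge0 ?powR_ge0//.
  by rewrite ler1n.
rewrite /holder_norm; apply: le_trans (leeD sup sem) _.
rewrite -EFinD lee_fin.
have BB : B <= B * theta `^ (- b) by rewrite ler_peMr.
have -> : 3 * B * theta `^ (- b) = B * theta `^ (- b) + 2 * B * theta `^ (- b) by ring.
by rewrite lerD2r.
Qed.

End Error.
End Interpolation.

(** * The estimator on one block *)

Section BlockError.
Context {R : realType}.

(** The approximate mean of |d_(N,k)|^beta, for t = k/N. *)
Definition mean_size (beta : R) (g H : R -> R) (N : nat) (t : R) : R :=
  N%:R `^ (- (beta * H t)) * g (H t).

Section Regularity.
Variables (beta C h1 h2 cH rho : R) (g H : R -> R) (N : nat).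
Hypothesis beta14 : 0 < beta <= 4^-1.
Hypothesis C0 : 0 < C.
Hypothesis h1half : 2^-1 < h1.
Hypothesis h2one : h2 < 1.
Hypothesis gC : forall v, h1 <= v <= h2 -> C^-1 <= g v <= C.
Hypothesis g_dist : forall v v', h1 <= v <= h2 -> h1 <= v' <= h2 ->
  `|g v - g v'| <= C * `|v - v'| `^ beta.
Hypothesis hH : forall t : R, 0 <= t <= 1 -> h1 <= H t <= h2.
Hypothesis cH0 : 0 <= cH.
Hypothesis rho_half : 2^-1 < rho.
Hypothesis hHolder : forall t1 t2 : R, 0 <= t1 <= 1 -> 0 <= t2 <= 1 ->
  `|H t1 - H t2| <= cH * `|t1 - t2| `^ rho.
Hypothesis N0 : (0 < N)%N.
Local Notation f := (mean_size beta g H N).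

Let Np : 0 < N%:R :> R. Proof. by rewrite ltr0n. Qed.
Let N1 : 1 <= N%:R :> R. Proof. by rewrite ler1n. Qed.
Let b0 : 0 < beta. Proof. by case/andP: beta14. Qed.

Lemma mean_size_gt0 (t : R) : 0 <= t <= 1 -> 0 < f t.
Proof.
move=> /hH/gC/andP[g1 _]; rewrite mulr_gt0 ?powR_gt0//.
by apply: lt_le_trans g1; rewrite invr_gt0.
Qed.

Lemma g_comparable (s t : R) : 0 <= s <= 1 -> 0 <= t <= 1 -> g (H s) <= C ^+ 2 * g (H t).
Proof.
move=> /hH/gC/andP[_ gs] /hH/gC/andP[gt _].
apply: le_trans gs _; rewrite expr2 -mulrA.
rewrite -[leLHS]mulr1; apply: ler_wpM2l; first exact: ltW.
by have := ler_wpM2l (ltW C0) gt; rewrite mulfV// gt_eqF.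
Qed.

Lemma size_comparable (s t : R) : 0 <= s <= 1 -> 0 <= t <= 1 ->
  N%:R `^ (- (beta * H s)) <= N%:R `^ (1 / 8) * N%:R `^ (- (beta * H t)).
Proof.
move=> hs ht; rewrite -powRD_gt0//; apply: ler_powR => //.
exact: exponent_ratio beta14 h1half h2one (hH hs) (hH ht).
Qed.

Lemma mean_size_comparable (s t : R) : 0 <= s <= 1 -> 0 <= t <= 1 ->
  f s <= C ^+ 2 * N%:R `^ (1 / 8) * f t.
Proof.
move=> hs ht; rewrite /mean_size.
have -> : C ^+ 2 * N%:R `^ (1 / 8) * (N%:R `^ (- (beta * H t)) * g (H t)) =
  N%:R `^ (1 / 8) * N%:R `^ (- (beta * H t)) * (C ^+ 2 * g (H t)) by ring.
apply: ler_pM; rewrite ?powR_ge0//.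
- have /hH/gC/andP[gs _] := hs; apply: le_trans gs; rewrite invr_ge0; exact: ltW.
- exact: size_comparable.
- exact: g_comparable.
Qed.

(** The exponent of N changes by beta cH N^-rho at most, so the power of N
    changes by a factor 1 + O(N^(-rho) ln N), and g(H) changes by
    O(N^(-rho beta)).  The factor N^(1/8) from comparing powers is absorbed as
    rho (1 - beta) > 1/8. *)
Lemma mean_size_lipschitz (s t : R) : 1 <= ln (N%:R : R) -> 0 <= s <= 1 -> 0 <= t <= 1 ->
  `|s - t| <= N%:R^-1 ->
  `|f s - f t| <= (2 * cH * C ^+ 2 + C ^+ 2 * cH `^ beta) *
     (ln (N%:R : R) * N%:R `^ (- (rho * beta))) * f t.
Proof.
move=> l1 hs ht st; set l := ln (N%:R : R) in l1 *.
have /andP[_ b4] := beta14.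
set As := N%:R `^ (- (beta * H s)); set At := N%:R `^ (- (beta * H t)).
set r := N%:R `^ (- (rho * beta)).
have r0 : 0 <= r by exact: powR_ge0.
have At0 : 0 <= At by exact: powR_ge0.
have gs0 : 0 <= g (H s).
  have /hH/gC/andP[gs _] := hs; apply: le_trans gs; rewrite invr_ge0; exact: ltW.
have gt0 : 0 <= g (H t).
  have /hH/gC/andP[gs _] := ht; apply: le_trans gs; rewrite invr_ge0; exact: ltW.
have l0 : 0 <= l by exact: le_trans l1.
have dH : `|H s - H t| <= cH * N%:R `^ (- rho).
  apply: le_trans (hHolder hs ht) _; rewrite ler_wpM2l//.
  apply: (@le_trans _ _ (N%:R^-1 `^ rho)).
    by rewrite ge0_ler_powR ?nnegrE ?invr_ge0 ?(ltW Np)//; apply: ltW; apply: lt_trans rho_half.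
  by rewrite -(powR_inv1 (ltW Np)) -powRrM mulN1r.
have dA : `|As - At| <= 2 * cH * (l * r) * At.
  rewrite /As /At !powR_expR//; apply: le_trans (norm_expR_sub _ _) _.
  rewrite -!powR_expR// -/As -/At -mulrBl normrM (ger0_norm l0) opprK addrC -mulrBr normrM distrC.
  rewrite (gtr0_norm b0).
  have sumA : As + At <= 2 * N%:R `^ (1 / 8) * At.
    have one : 1 <= N%:R `^ (1 / 8) :> R.
      by rewrite -[leLHS](powRr0 N%:R); apply: ler_powR => //; rewrite divr_ge0.
    have := size_comparable hs ht; rewrite -/As -/At => h8.
    have hAt := ler_wpM2r At0 one; rewrite (mul1r At) in hAt.
    rewrite (_ : 2 * N%:R `^ (1 / 8) * At = N%:R `^ (1 / 8) * At + N%:R `^ (1 / 8) * At); last by ring.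
    exact: (lerD h8 hAt).
  have dHl : beta * `|H s - H t| * l <= beta * (cH * N%:R `^ (- rho)) * l.
    by apply: ler_wpM2r => //; apply: ler_wpM2l => //; exact: ltW.
  apply: le_trans (ler_pM _ _ dHl sumA) _; rewrite ?mulr_ge0 ?addr_ge0 ?powR_ge0 ?(ltW b0)//.
  have -> : beta * (cH * N%:R `^ (- rho)) * l * (2 * N%:R `^ (1 / 8) * At) =
    beta * (2 * cH * (l * (N%:R `^ (- rho) * N%:R `^ (1 / 8))) * At) by ring.
  apply: (@le_trans _ _ (1 * (2 * cH * (l * (N%:R `^ (- rho) * N%:R `^ (1 / 8))) * At))).
    rewrite ler_wpM2r ?mulr_ge0 ?powR_ge0//; lra.
  rewrite mul1r ler_wpM2r// ler_wpM2l ?mulr_ge0// ler_wpM2l// -powRD_gt0// /r.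
  apply: ler_powR => //.
  have : rho * beta <= rho * 4^-1 by rewrite ler_wpM2l// ltW// (lt_trans _ rho_half).
  move: rho_half; lra.
have dg : `|g (H s) - g (H t)| <= C ^+ 2 * cH `^ beta * r * g (H t).
  apply: le_trans (g_dist (hH hs) (hH ht)) _.
  apply: (@le_trans _ _ (C * (cH `^ beta * r))).
    rewrite ler_wpM2l ?(ltW C0)//.
    apply: (@le_trans _ _ ((cH * N%:R `^ (- rho)) `^ beta)).
      by rewrite ge0_ler_powR ?nnegrE ?mulr_ge0 ?powR_ge0 ?(ltW b0).
    by rewrite powRM ?powR_ge0// -powRrM mulNr.
  have -> : C ^+ 2 * cH `^ beta * r * g (H t) = C * (cH `^ beta * r) * (C * g (H t)) by ring.
  rewrite ler_peMr ?mulr_ge0 ?powR_ge0 ?(ltW C0)//.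
  have /hH/gC/andP[gt _] := ht.
  by have := ler_wpM2l (ltW C0) gt; rewrite mulfV// gt_eqF.
have gst := g_comparable hs ht.
rewrite /mean_size -/As -/At.
have -> : As * g (H s) - At * g (H t) = (As - At) * g (H s) + At * (g (H s) - g (H t)) by ring.
apply: le_trans (ler_normD _ _) _; rewrite !normrM (ger0_norm gs0) (ger0_norm At0).
have k0 : 0 <= 2 * cH * (l * r) * At by rewrite !mulr_ge0.
have t1 : `|As - At| * g (H s) <= 2 * cH * (l * r) * At * (C ^+ 2 * g (H t)).
  exact: ler_pM.
have t2 : At * `|g (H s) - g (H t)| <= At * (C ^+ 2 * cH `^ beta * (l * r) * g (H t)).
  have rl : r <= l * r by rewrite ler_peMl.
  apply: ler_wpM2l => //; apply: le_trans dg _; apply: ler_wpM2r => //.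
  by apply: ler_wpM2l => //; rewrite mulr_ge0 ?powR_ge0 ?sqr_ge0.
apply: le_trans (lerD t1 t2) _; rewrite le_eqVlt; apply/orP; left; apply/eqP; ring.
Qed.

End Regularity.

(** By grid_refine applied to f = mean_size and to f = 1, the sums of the means
    and the numbers of points double up to a factor 1 + O(e) from N to 2N,
    while mean_size at 2N is 2^(-beta H) times that at N, with H within eta of
    H t0. *)
Lemma block_error (L : nat) (beta C h1 h2 cH rho : R) (g H : R -> R) (N : nat)
    (y : R -> R) (lo hi e eta t0 : R) :
  0 < beta <= 4^-1 -> 0 < C -> 2^-1 < h1 -> h2 < 1 ->
  (forall v, h1 <= v <= h2 -> C^-1 <= g v <= C) ->
  (forall v v', h1 <= v <= h2 -> h1 <= v' <= h2 -> `|g v - g v'| <= C * `|v - v'| `^ beta) ->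
  (forall t : R, 0 <= t <= 1 -> h1 <= H t <= h2) ->
  0 <= cH -> 2^-1 < rho ->
  (forall t1 t2 : R, 0 <= t1 <= 1 -> 0 <= t2 <= 1 ->
     `|H t1 - H t2| <= cH * `|t1 - t2| `^ rho) ->
  (0 < L)%N -> (L <= N)%N -> 1 <= ln (N%:R : R) ->
  0 <= lo -> hi <= 1 -> lo <= t0 <= hi -> 0 <= eta ->
  (forall t, lo <= t <= hi -> `|H t - H t0| <= eta) ->
  0 <= e <= 8^-1 -> (0 < #|nu L N `[lo, hi]|)%N ->
  (2 * L + 4)%:R * (C ^+ 2 * N%:R `^ (1 / 8) + 1) / #|nu L N `[lo, hi]|%:R <= e / 2 ->
  2 * ((2 * cH * C ^+ 2 + C ^+ 2 * cH `^ beta) * (ln (N%:R : R) * N%:R `^ (- (rho * beta)))) <= e / 2 ->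
  `|\sum_(k in nu L N `[lo, hi]) `|increment L y N k| `^ beta -
    \sum_(k in nu L N `[lo, hi]) mean_size beta g H N (k%:R / N%:R)| <=
    e * \sum_(k in nu L N `[lo, hi]) mean_size beta g H N (k%:R / N%:R) ->
  `|\sum_(k in nu L (2 * N) `[lo, hi]) `|increment L y (2 * N) k| `^ beta -
    \sum_(k in nu L (2 * N) `[lo, hi]) mean_size beta g H (2 * N) (k%:R / (2 * N)%:R)| <=
    e * \sum_(k in nu L (2 * N) `[lo, hi]) mean_size beta g H (2 * N) (k%:R / (2 * N)%:R) ->
  `|Hhat L beta y N `[lo, hi] - H t0| <= eta + 4 * e / (beta * ln 2).
Proof.
move=> b14 C0 h1half h2one gC g_dist hH cH0 rho_half hHolder L0 LN l1 lo0 hi1 t0I eta0 hEta e08.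
move=> nu0 gridC gridD; have /andP[b0 b4] := b14; have /andP[e0 e8] := e08.
have N0 : (0 < N)%N by exact: leq_trans L0 LN.
have Np : 0 < N%:R :> R by rewrite ltr0n.
pose f := mean_size beta g H N.
set S := \sum_(k in nu L N `[lo, hi]) `|increment L y N k| `^ beta.
set S' := \sum_(k in nu L (2 * N) `[lo, hi]) `|increment L y (2 * N) k| `^ beta.
set mu := \sum_(k in nu L N `[lo, hi]) mean_size beta g H N (k%:R / N%:R).
set mu' := \sum_(k in nu L (2 * N) `[lo, hi]) mean_size beta g H (2 * N) (k%:R / (2 * N)%:R).
move=> hS hS'.
set n := #|nu L N `[lo, hi]|%:R : R.
set n' := #|nu L (2 * N) `[lo, hi]|%:R : R.
have n0 : 0 < n by rewrite ltr0n.
have I01 t : lo <= t <= hi -> 0 <= t <= 1.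
  by move=> /andP[h h']; rewrite (le_trans lo0 h) (le_trans h' hi1).
have fpos := mean_size_gt0 beta C0 gC hH N0.
have CN0 : 0 <= C ^+ 2 * N%:R `^ (1 / 8) by rewrite mulr_ge0 ?powR_ge0 ?sqr_ge0.
have Ln0 : 0 <= (2 * L + 4)%:R / n :> R by rewrite divr_ge0// ltW.
have mu0 : 0 < mu.
  have [k0 k0A] : exists k0, k0 \in nu L N `[lo, hi] by apply/set0Pn; rewrite -card_gt0.
  have pos k : k \in nu L N `[lo, hi] -> 0 < f (k%:R / N%:R).
    by rewrite inE in_itv/= => /I01; exact: fpos.
  rewrite /mu (bigD1 k0)//= ltr_pwDl ?pos//; apply: sumr_ge0 => k /andP[kA _].
  exact: ltW (pos _ kA).
pose Sg := \sum_(k in nu L (2 * N) `[lo, hi]) f (k%:R / (2 * N)%:R).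
pose de := (2 * cH * C ^+ 2 + C ^+ 2 * cH `^ beta) * (ln (N%:R : R) * N%:R `^ (- (rho * beta))).
have de0 : 0 <= de.
  have l0 : 0 <= ln (N%:R : R) by exact: le_trans l1.
  apply: mulr_ge0; last by rewrite mulr_ge0 ?powR_ge0.
  have C20 := sqr_ge0 C.
  apply: addr_ge0; first by apply: mulr_ge0 => //; exact: mulr_ge0.
  by apply: mulr_ge0 => //; exact: powR_ge0.
have hSg : `|Sg - 2 * mu| <= e * mu.
  have := @grid_refine _ L N lo hi (C ^+ 2 * N%:R `^ (1 / 8)) de f L0 LN lo0 hi1 de0 CN0 nu0
    (fun t h => ltW (fpos t h))
    (@mean_size_comparable beta C h1 h2 g H N b14 C0 h1half h2one gC hH N0)
    (fun s t hs ht => @mean_size_lipschitz beta C h1 h2 cH rho g H N b14 C0 h1half h2one gC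
       g_dist hH cH0 rho_half hHolder N0 s t l1 hs ht).
  rewrite -/Sg -/mu -/n => h; apply: le_trans h _; rewrite ler_wpM2r ?(ltW mu0)//.
  apply: (@le_trans _ _ (e / 2 + e / 2)); last by rewrite -splitr.
  apply: lerD => //; apply: le_trans gridC; rewrite -/n.
  by rewrite ler_wpM2r ?invr_ge0 ?(ltW n0)// ler_wpM2l// lerDl.
have hn : `|n' - 2 * n| <= e * n.
  have := @grid_refine _ L N lo hi 1 0 (fun=> 1) L0 LN lo0 hi1 (lexx _) ler01 nu0.
  rewrite !sumr_const -/n -/n' => h; apply: le_trans (h _ _ _) _.
  - by move=> *; rewrite ler01.
  - by move=> *; rewrite mulr1.
  - by move=> *; rewrite subrr normr0 mul0r.
  rewrite ler_wpM2r ?(ltW n0)// mulr0 add0r.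
  apply: (@le_trans _ _ (e / 2)); last by rewrite ler_pdivrMr// ler_peMr// ler1n.
  apply: le_trans gridC; rewrite -/n.
  by rewrite ler_wpM2r ?invr_ge0 ?(ltW n0)// ler_wpM2l// lerDr.
pose q1 : R := 2 `^ (- (beta * (H t0 + eta))); pose q2 : R := 2 `^ (- (beta * (H t0 - eta))).
have q10 : 0 < q1 by rewrite powR_gt0.
have q20 : 0 < q2 by rewrite powR_gt0.
have scale t : mean_size beta g H (2 * N) t = 2 `^ (- (beta * H t)) * f t.
  by rewrite /mean_size natrM powRM// mulrA.
have term k : k \in nu L (2 * N) `[lo, hi] ->
   q1 * f (k%:R / (2 * N)%:R) <= mean_size beta g H (2 * N) (k%:R / (2 * N)%:R) <=
   q2 * f (k%:R / (2 * N)%:R).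
  rewrite inE in_itv/= => kI; rewrite scale.
  have fk := ltW (fpos _ (I01 _ kI)); have := hEta _ kI; rewrite ler_norml => /andP[d1 d2].
  rewrite lerBlDr in d2; rewrite lerBrDr addrC in d1.
  rewrite !ler_wpM2r//; rewrite ler_powR ?ler1n// lerN2 ler_wpM2l ?(ltW b0)//.
  by rewrite addrC.
have m1 : q1 * Sg <= mu'.
  by rewrite /Sg mulr_sumr; apply: ler_sum => k /term/andP[].
have m2 : mu' <= q2 * Sg.
  by rewrite /Sg mulr_sumr; apply: ler_sum => k /term/andP[].
have [x0 up lw] := ln_ratio_bounds n0 mu0 q10 q20 e08 hS hS' hn hSg m1 m2.
have HI := hH _ (I01 _ t0I).
have H01 : 2^-1 <= H t0 <= 1.
  case/andP: HI => H1 H2; apply/andP; split; [exact: le_trans (ltW h1half) H1|exact: le_trans H2 (ltW h2one)].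
have e40 : 0 <= 4 * e by rewrite mulr_ge0.
rewrite /q1 ln_powR in up; rewrite /q2 ln_powR in lw.
apply: (trunc_ratio_error b0 x0 H01 eta0 e40).
- by apply: le_trans up _; rewrite lerD2r le_eqVlt; apply/orP; left; apply/eqP; ring.
- by apply: le_trans lw; rewrite lerD2r le_eqVlt; apply/orP; left; apply/eqP; ring.
Qed.

End BlockError.

(** * Asymptotics of the block length *)

Section Asymptotics.
Context {R : realType}.

Lemma ln_large (c : R) : \forall N \near \oo, c <= ln (N%:R : R).
Proof.
near=> N.
have h : expR c <= N%:R by near: N; exact: nbhs_infty_ger.
by rewrite -[c]expRK ler_ln ?posrE ?expR_gt0//; apply: lt_le_trans h; exact: expR_gt0.
Unshelve. all: by end_near. Qed.

(** Every power of ln N is negligible against every power of N, through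
    ln N <= N^e / e. *)
Lemma ln_pow_small (K g c : R) (k : nat) : 0 < g -> 0 < c ->
  \forall N \near \oo, K * ln (N%:R : R) ^+ k * N%:R `^ (- g) <= c.
Proof.
move=> g0 c0.
pose e := g / (2 * k.+1%:R).
have k1 : 0 < k.+1%:R :> R by rewrite ltr0n.
have e0 : 0 < e by rewrite divr_gt0// mulr_gt0.
have ek : e * k%:R <= g / 2.
  rewrite /e invfM !mulrA -mulrA ler_piMr ?divr_ge0 ?(ltW g0)//.
  by rewrite mulrC ler_pdivrMr// mul1r ler_nat.
pose M := `|K| * e^-1 ^+ k.
have M0 : 0 <= M by rewrite mulr_ge0// exprn_ge0// invr_ge0 ltW.
have g2 : 0 < g / 2 by rewrite divr_gt0.
near=> N.
have N1 : 1 <= N%:R :> R by rewrite ler1n; near: N; exact: nbhs_infty_gt.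
have Np : 0 < N%:R :> R by exact: lt_le_trans N1.
have h : ((M + 1) / c) `^ (2 / g) <= N%:R by near: N; exact: nbhs_infty_ger.
have Mc : 0 <= (M + 1) / c by rewrite divr_ge0 ?addr_ge0// ltW.
have h2 : M <= c * N%:R `^ (g / 2).
  have := @ge0_ler_powR _ (g / 2) (ltW g2) _ _ _ _ h.
  rewrite !nnegrE powR_ge0 (ltW Np) -powRrM (_ : 2 / g * (g / 2) = 1); last first.
    by field; rewrite gt_eqF.
  rewrite powRr1// ler_pdivrMr// mulrC => /(_ isT isT); apply: le_trans.
  by rewrite lerDl.
have l0 : 0 <= ln (N%:R : R) by exact: ln_ge0.
have lk : ln (N%:R : R) ^+ k <= e^-1 ^+ k * N%:R `^ (g / 2).
  apply: (@le_trans _ _ ((e^-1 * N%:R `^ e) ^+ k)).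
    by apply: lerXn2r; rewrite ?nnegrE ?mulr_ge0 ?powR_ge0 ?invr_ge0 ?(ltW e0)//; exact: ln_le_powR.
  rewrite exprMn ler_wpM2l ?exprn_ge0 ?invr_ge0 ?(ltW e0)//.
  by rewrite -powR_mulrn ?powR_ge0// -powRrM; apply: ler_powR.
apply: (@le_trans _ _ (`|K| * (e^-1 ^+ k * N%:R `^ (g / 2)) * N%:R `^ (- g))).
  rewrite ler_wpM2r ?powR_ge0//; apply: le_trans (ler_norm _) _.
  by rewrite normrM (ger0_norm (exprn_ge0 k l0)) ler_wpM2l.
have -> : `|K| * (e^-1 ^+ k * N%:R `^ (g / 2)) * N%:R `^ (- g) = M * N%:R `^ (- (g / 2)).
  rewrite /M -!mulrA -powRD_gt0//; do 2 congr (_ * _).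
  by congr (_ `^ _); field.
by rewrite powRN ler_pdivrMr ?powR_gt0.
Unshelve. all: by end_near. Qed.

Lemma kappa0_gt0 (L N0 : nat) : is_N0 R L N0 -> 0 < kappa0 L N0 :> R.
Proof.
move=> [/andP[h _] _].
have -> : kappa0 L N0 = 18^-1 * (9 * L.+1%:R * N0%:R^-1 * ln (N0%:R : R) ^+ 2).
  by rewrite /kappa0; move: (N0%:R^-1) (ln _) => x y; field.
by rewrite mulr_gt0.
Qed.

Lemma theta_asymptotics (L N0 : nat) : is_N0 R L N0 ->
  \forall N \near \oo, [/\ kappa0 L N0 / ln (N%:R : R) <= theta L N0 N,
    theta L N0 N <= (kappa0 L N0 + 1) / ln (N%:R : R) & theta L N0 N <= 1 :> R].
Proof.
move=> /kappa0_gt0 k0.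
near=> N.
have N1 : 1 <= N%:R :> R by rewrite ler1n; near: N; exact: nbhs_infty_gt.
have Np : 0 < N%:R :> R by exact: lt_le_trans N1.
have l1 : kappa0 L N0 + 1 <= ln (N%:R : R) by near: N; exact: ln_large.
have s : 4 * L.+1%:R * ln (N%:R : R) ^+ 3 * N%:R `^ (- 1) <= 1.
  by near: N; exact: ln_pow_small.
set l := ln (N%:R : R) in l1 s *.
have l0 : 0 < l by apply: lt_le_trans l1; rewrite addr_gt0.
have up : theta L N0 N <= (kappa0 L N0 + 1) / l.
  rewrite /theta -/l (mulrDl (kappa0 L N0)) lerD2l ler_pdivlMr//.
  rewrite powR_inv1 ?(ltW Np)// in s; apply: le_trans s.
  by rewrite le_eqVlt; apply/orP; left; apply/eqP; ring.
split => //.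
- rewrite /theta -/l lerDl; apply: mulr_ge0; last exact: sqr_ge0.
  by apply: mulr_ge0; [apply: mulr_ge0|rewrite invr_ge0 ltW].
- by apply: le_trans up _; rewrite ler_pdivrMr// mul1r.
Unshelve. all: by end_near. Qed.

End Asymptotics.

(** * The Hoelder norm of the error along one path *)

Section PathError.
Context {R : realType}.

Lemma block_interval (th : R) (n : nat) : 0 < th <= 1 -> (n < Num.truncn th^-1)%N ->
  exists lo hi : R, [/\ block th n = `[lo, hi], 0 <= lo, hi <= 1,
    th <= hi - lo & hi - lo <= 2 * th].
Proof.
move=> th01 nm; have /andP[th0 th1] := th01.
have m1 := last_node_le1 th01; have m0 := block_count_gt0 th01.
rewrite /block; set m := Num.truncn th^-1 in nm m1 m0 *.
have mS : m%:R = m.-1%:R + 1 :> R by rewrite natr1 prednK.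
case: ifP => h.
  exists (n%:R * th), (n.+1%:R * th); split => //.
  - by rewrite mulr_ge0// ltW.
  - by apply: le_trans m1; rewrite ler_wpM2r ?(ltW th0)// ler_nat.
  - by rewrite -natr1 mulrDl mul1r addrC addKr.
  - by rewrite -natr1 mulrDl mul1r addrC addKr ler_peMl ?(ltW th0)// ler1n.
exists (m.-1%:R * th), 1; split => //.
- by rewrite mulr_ge0// ltW.
- by move: m1; rewrite mS mulrDl mul1r lerBrDr addrC.
- have : 1 < (m%:R + 1) * th by rewrite -ltr_pdivrMr// div1r natr1 truncnS_gt.
  by rewrite mS => h1; rewrite lerBlDr -mulrDl ltW// addrC -[2]natr1 addrA.
Qed.

Lemma holder_norm_ge0 (b : R) (f : R -> R) : (0 <= holder_norm b f)%E.
Proof.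
apply: adde_ge0; apply: le_ereal_sup_tmp.
  by exists (`|f 0|)%:E; [exists 0 => //=; rewrite lexx ler01|rewrite lee_fin].
exists (`|f 0 - f 1| / `|0 - 1| `^ b)%:E.
  by exists 0, 1; split => //; exact: ltr01.
by rewrite lee_fin divr_ge0// powR_ge0.
Qed.

Lemma holder_norm_powR_le (b p a : R) (f : R -> R) : 0 <= p -> 0 <= a ->
  (holder_norm b f <= a%:E)%E -> (holder_norm b f `^ p <= (a `^ p)%:E)%E.
Proof.
move=> p0 a0 fa; rewrite -poweR_EFin; apply: gt0_ler_poweR => //.
- by rewrite in_itv/= holder_norm_ge0 leey.
- by rewrite in_itv/= lee_fin a0 leey.
Qed.

Definition power_sum (L : nat) (beta : R) (y : R -> R) (N : nat) (I : interval R) : R :=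
  \sum_(k in nu L N I) `|increment L y N k| `^ beta.

Definition mean_sum (L : nat) (beta : R) (g H : R -> R) (N : nat) (I : interval R) : R :=
  \sum_(k in nu L N I) mean_size beta g H N (k%:R / N%:R).

Definition rel_error (L : nat) (beta : R) (g H y : R -> R) (N : nat) (I : interval R) : R :=
  `|power_sum L beta y N I - mean_sum L beta g H N I| / mean_sum L beta g H N I.

Definition total_error (L : nat) (beta : R) (g H y : R -> R) (N : nat) (th : R) : R :=
  \sum_(n < Num.truncn th^-1)
    (rel_error L beta g H y N (block th n) + rel_error L beta g H y (2 * N) (block th n)).

Lemma mean_sum_gt0 (L : nat) (beta C h1 h2 : R) (g H : R -> R) (th : R) (N n : nat) :
  0 < C -> (forall v, h1 <= v <= h2 -> C^-1 <= g v <= C) ->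
  (forall t : R, 0 <= t <= 1 -> h1 <= H t <= h2) -> 0 < th <= 1 -> (0 < N)%N ->
  (n < Num.truncn th^-1)%N -> (0 < #|nu L N (block th n)|)%N ->
  0 < mean_sum L beta g H N (block th n).
Proof.
move=> C0 gC hH th01 N0 nm nu0; have [lo [hi [bE lo0 hi1 _ _]]] := block_interval th01 nm.
have [k0 k0A] : exists k0, k0 \in nu L N (block th n) by apply/set0Pn; rewrite -card_gt0.
have pos k : k \in nu L N (block th n) -> 0 < mean_size beta g H N (k%:R / N%:R).
  rewrite inE bE in_itv/= => /andP[u v]; apply: (mean_size_gt0 beta C0 gC hH N0).
  by rewrite (le_trans lo0 u) (le_trans v hi1).
rewrite /mean_sum (bigD1 k0)//= ltr_pwDl ?pos//; apply: sumr_ge0 => k /andP[kA _].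
exact: ltW (pos _ kA).
Qed.

(** If the total error is at most e, so is the relative error on each block, and
    block_error applies.  Otherwise the estimator and H, both in [1/2, 1], are
    at distance less than 1, and 1 <= R / e for the total error R.  The sum of
    the two bounds holds in both cases. *)
Lemma path_error (L : nat) (beta C h1 h2 cH rho : R) (g H : R -> R) (N : nat)
    (y : R -> R) (e th b p : R) :
  0 < beta <= 4^-1 -> 0 < C -> 2^-1 < h1 -> h2 < 1 ->
  (forall v, h1 <= v <= h2 -> C^-1 <= g v <= C) ->
  (forall v v', h1 <= v <= h2 -> h1 <= v' <= h2 -> `|g v - g v'| <= C * `|v - v'| `^ beta) ->
  (forall t : R, 0 <= t <= 1 -> h1 <= H t <= h2) ->
  0 <= cH -> 2^-1 < rho -> rho <= 1 ->
  (forall t1 t2 : R, 0 <= t1 <= 1 -> 0 <= t2 <= 1 ->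
     `|H t1 - H t2| <= cH * `|t1 - t2| `^ rho) ->
  (0 < L)%N -> (L <= N)%N -> 1 <= ln (N%:R : R) ->
  0 < e <= 8^-1 -> 0 < th <= 1 -> 0 < b < rho -> 0 < p ->
  (forall n, (n < Num.truncn th^-1)%N ->
     N%:R `^ (7 / 8) <= #|nu L N (block th n)|%:R :> R) ->
  (forall n, (n < Num.truncn th^-1)%N -> (0 < #|nu L (2 * N) (block th n)|)%N) ->
  (2 * L + 4)%:R * (C ^+ 2 * N%:R `^ (1 / 8) + 1) / N%:R `^ (7 / 8) <= e / 2 ->
  2 * ((2 * cH * C ^+ 2 + C ^+ 2 * cH `^ beta) * (ln (N%:R : R) * N%:R `^ (- (rho * beta)))) <= e / 2 ->
  (holder_norm b (fun t => Htilde L beta y N th t - H t)%R `^ p <=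
   ((3 * (cH * (2 * th) `^ rho + 4 * e / (beta * ln 2) + cH * th `^ rho) * th `^ (- b)) `^ p +
    (3 * (1 + cH * th `^ rho) * th `^ (- b)) `^ p *
      (e^-1 * total_error L beta g H y N th))%:E)%E.
Proof.
move=> b14 C0 h1half h2one gC g_dist hH cH0 rho_half rho1 hHolder L0 LN l1 e08 th01 brho p0.
move=> nuN nu2N gridC gridD.
have /andP[b0 b4] := b14; have /andP[e0 e8] := e08; have /andP[th0 th1] := th01.
have N0 : (0 < N)%N by exact: leq_trans L0 LN.
have N20 : (0 < 2 * N)%N by rewrite muln_gt0.
have Np : 0 < N%:R :> R by rewrite ltr0n.
have l2 : 0 < ln 2 :> R by exact: ln2_gt0.
set D := cH * (2 * th) `^ rho + 4 * e / (beta * ln 2).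
have D0 : 0 <= D.
  apply: addr_ge0; first by rewrite mulr_ge0 ?powR_ge0.
  by apply: divr_ge0; apply: mulr_ge0 => //; exact: ltW.
have cth : 0 <= cH * th `^ rho by rewrite mulr_ge0 ?powR_ge0.
have A0 : 0 <= 3 * (D + cH * th `^ rho) * th `^ (- b).
  by apply: mulr_ge0; [apply: mulr_ge0 => //; exact: addr_ge0|exact: powR_ge0].
have B0 : 0 <= 3 * (1 + cH * th `^ rho) * th `^ (- b).
  by apply: mulr_ge0; [apply: mulr_ge0 => //; exact: addr_ge0|exact: powR_ge0].
have nuN0 n : (n < Num.truncn th^-1)%N -> (0 < #|nu L N (block th n)|)%N.
  by move=> /nuN h; rewrite -(ltr0n R); apply: lt_le_trans h; exact: powR_gt0.
have mN n (nm : (n < Num.truncn th^-1)%N) := mean_sum_gt0 beta C0 gC hH th01 N0 nm (nuN0 n nm).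
have m2N n (nm : (n < Num.truncn th^-1)%N) := mean_sum_gt0 beta C0 gC hH th01 N20 nm (nu2N n nm).
have r0 n : (n < Num.truncn th^-1)%N -> 0 <= rel_error L beta g H y N (block th n).
  by move=> nm; apply: divr_ge0 => //; exact: ltW (mN n nm).
have r20 n : (n < Num.truncn th^-1)%N -> 0 <= rel_error L beta g H y (2 * N) (block th n).
  by move=> nm; apply: divr_ge0 => //; exact: ltW (m2N n nm).
have T0 : 0 <= total_error L beta g H y N th.
  by apply: sumr_ge0 => n _; apply: addr_ge0; [exact: r0|exact: r20].
rewrite HtildeE.
have [Te|eT] := leP (total_error L beta g H y N th) e.
  apply: (@le_trans _ _ ((3 * (D + cH * th `^ rho) * th `^ (- b)) `^ p)%:E); last first.
    rewrite lee_fin lerDl; apply: mulr_ge0; first exact: powR_ge0.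
    by apply: mulr_ge0 => //; rewrite invr_ge0 ltW.
  apply: holder_norm_powR_le => //; first exact: ltW.
  apply: interp_holder_norm => // n t nm t01 tn.
  have small : rel_error L beta g H y N (block th n) +
      rel_error L beta g H y (2 * N) (block th n) <= e.
    apply: le_trans Te; rewrite /total_error (bigD1 (Ordinal nm))//= lerDl.
    by apply: sumr_ge0 => k _; apply: addr_ge0; [exact: r0|exact: r20].
  have s1 : rel_error L beta g H y N (block th n) <= e.
    by apply: le_trans small; rewrite lerDl r20.
  have s2 : rel_error L beta g H y (2 * N) (block th n) <= e.
    by apply: le_trans small; rewrite lerDr r0.
  rewrite /rel_error ler_pdivrMr ?mN// in s1; rewrite /rel_error ler_pdivrMr ?m2N// in s2.
  have nN := nuN n nm; have nN0 := nuN0 n nm.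
  have [lo [hi [bE lo0 hi1 _ len]]] := block_interval th01 nm.
  rewrite bE in s1 s2 tn nN nN0 *; rewrite in_itv/= in tn.
  have eta0 : 0 <= cH * (2 * th) `^ rho by rewrite mulr_ge0 ?powR_ge0.
  have e08' : 0 <= e <= 8^-1 by rewrite (ltW e0).
  apply: (block_error (C := C) (h1 := h1) (h2 := h2) (cH := cH) (rho := rho) (g := g)) => //.
  - move=> s /andP[s3 s4]; apply: le_trans (hHolder _ _ _ _) _ => //.
      by rewrite (le_trans lo0 s3) (le_trans s4 hi1).
    apply: ler_wpM2l => //; apply: ge0_ler_powR; rewrite ?nnegrE//.
    + by apply: ltW; apply: lt_trans rho_half.
    + by rewrite mulr_ge0// ltW.
    + apply: le_trans len; case/andP: tn => t3 t4.
      by rewrite ler_norml opprB; apply/andP; split; apply: lerB.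
  - apply: le_trans gridC; apply: ler_wpM2l.
      by apply: mulr_ge0 => //; rewrite addr_ge0// mulr_ge0 ?powR_ge0 ?sqr_ge0.
    by rewrite lef_pV2 ?posrE ?powR_gt0// ltr0n.
apply: (@le_trans _ _ ((3 * (1 + cH * th `^ rho) * th `^ (- b)) `^ p)%:E).
  apply: holder_norm_powR_le => //; first exact: ltW.
  apply: interp_holder_norm => // n t nm t01 tn.
  have /andP[u1 u2] := Hhat_bounds L y N (block th n) b0.
  have /andP[u3 u4] := hH t t01.
  have u5 := le_trans (ltW h1half) u3; have u6 := le_trans u4 (ltW h2one).
  have i0 : 0 <= 2^-1 :> R by [].
  rewrite ler_norml; apply/andP; split.
    by apply: (@le_trans _ _ (0 - 1)); [rewrite sub0r|apply: lerB => //; exact: le_trans u1].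
  by apply: (@le_trans _ _ (1 - 0)); [apply: lerB => //; exact: le_trans u5|rewrite subr0].
rewrite lee_fin; apply: (@le_trans _ _ ((3 * (1 + cH * th `^ rho) * th `^ (- b)) `^ p * 1)).
  by rewrite mulr1.
apply: (@le_trans _ _ ((3 * (1 + cH * th `^ rho) * th `^ (- b)) `^ p *
      (e^-1 * total_error L beta g H y N th))); last by rewrite lerDr powR_ge0.
apply: ler_wpM2l; first exact: powR_ge0.
by rewrite mulrC ler_pdivlMr// mul1r ltW.
Qed.

End PathError.

(** * Rates of convergence and expectations *)

Section Rates.
Context {R : realType}.
Variables (cH k0 rho b p beta th l : R).

(** All the terms are at most a constant times th^rho, including e = 1/l, as
    l^-1 <= th / k0 and th <= 1. *)
Lemma main_rate : 0 <= cH -> 0 < k0 -> 0 < b < rho -> rho <= 1 -> 0 < p -> 0 < beta ->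
  1 <= l -> k0 / l <= th -> th <= (k0 + 1) / l -> th <= 1 ->
  (3 * (cH * (2 * th) `^ rho + 4 * l^-1 / (beta * ln 2) + cH * th `^ rho) * th `^ (- b)) `^ p <=
  (3 * (3 * cH + 4 / (k0 * (beta * ln 2))) * (k0 + 1) `^ (rho - b)) `^ p * l `^ (- (p * (rho - b))).
Proof.
move=> cH0 k00 /andP[b0 brho] rho1 p0 be0 l1 th_lo th_up th1.
have l0 : 0 < l by exact: lt_le_trans l1.
have th0 : 0 < th by apply: lt_le_trans th_lo; exact: divr_gt0.
have bl : 0 < beta * ln 2 by apply: mulr_gt0 => //; exact: ln2_gt0.
have rho0 : 0 < rho by exact: lt_trans brho.
have k01 : 0 < k0 + 1 by exact: addr_gt0.
have rb0 : 0 <= rho - b by rewrite subr_ge0 ltW.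
pose x := th `^ rho; have x0 : 0 <= x by exact: powR_ge0.
have u1 : (2 * th) `^ rho <= 2 * x.
  rewrite powRM ?(ltW th0)//; apply: ler_wpM2r => //.
  by rewrite -[leRHS]powRr1//; apply: ler_powR => //; rewrite ler1n.
have thx : th <= x.
  rewrite -[leLHS]powRr1 ?(ltW th0)//; apply: ger_powR => //.
  by rewrite th0 th1.
have u2 : 4 * l^-1 / (beta * ln 2) <= 4 / (k0 * (beta * ln 2)) * x.
  have -> : 4 / (k0 * (beta * ln 2)) * x = 4 * (x / k0) / (beta * ln 2).
    by field; rewrite !gt_eqF//; exact: ln2_gt0.
  apply: ler_wpM2r; first by rewrite invr_ge0 ltW.
  apply: ler_wpM2l => //; rewrite ler_pdivlMr// mulrC.
  exact: le_trans th_lo thx.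
set K := 3 * cH + 4 / (k0 * (beta * ln 2)).
have K0 : 0 <= K.
  apply: addr_ge0; first exact: mulr_ge0.
  by rewrite divr_ge0// mulr_ge0// ltW.
have inner : cH * (2 * th) `^ rho + 4 * l^-1 / (beta * ln 2) + cH * x <= K * x.
  have -> : K * x = cH * (2 * x) + 4 / (k0 * (beta * ln 2)) * x + cH * x by rewrite /K; ring.
  by rewrite lerD2r; apply: lerD => //; exact: ler_wpM2l.
have split : x * th `^ (- b) <= (k0 + 1) `^ (rho - b) * l `^ (- (rho - b)).
  rewrite /x -powRD_gt0//.
  apply: (@le_trans _ _ (((k0 + 1) / l) `^ (rho - b))).
    by apply: ge0_ler_powR; rewrite ?nnegrE ?divr_ge0 ?(ltW th0) ?(ltW k01) ?(ltW l0).
  rewrite powRM ?invr_ge0 ?(ltW k01) ?(ltW l0)// -(powR_inv1 (ltW l0)) -powRrM mulN1r.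
  exact: lexx.
rewrite -/x.
apply: (@le_trans _ _ ((3 * K * (k0 + 1) `^ (rho - b) * l `^ (- (rho - b))) `^ p)).
  apply: ge0_ler_powR; rewrite ?nnegrE ?(ltW p0)//.
  - apply: mulr_ge0; last exact: powR_ge0.
    apply: mulr_ge0 => //; apply: addr_ge0; last exact: mulr_ge0.
    apply: addr_ge0; first by rewrite mulr_ge0 ?powR_ge0.
    by rewrite divr_ge0 ?(ltW bl)// mulr_ge0// invr_ge0 ltW.
  - by apply: mulr_ge0; [apply: mulr_ge0; [exact: mulr_ge0|exact: powR_ge0]|exact: powR_ge0].
  apply: (@le_trans _ _ (3 * (K * x) * th `^ (- b))).
    by apply: ler_wpM2r; [exact: powR_ge0|exact: ler_wpM2l].
  have -> : 3 * (K * x) * th `^ (- b) = 3 * K * (x * th `^ (- b)) by ring.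
  have -> : 3 * K * (k0 + 1) `^ (rho - b) * l `^ (- (rho - b)) =
    3 * K * ((k0 + 1) `^ (rho - b) * l `^ (- (rho - b))) by ring.
  by apply: ler_wpM2l => //; exact: mulr_ge0.
rewrite powRM ?powR_ge0//; last by apply: mulr_ge0; [exact: mulr_ge0|exact: powR_ge0].
by rewrite -powRrM mulNr [_ * p]mulrC.
Qed.

(** A polynomial bound in l is enough here, since this term is multiplied by a
    negative power of N. *)
Lemma crude_rate : 0 <= cH -> 0 < k0 -> 0 < b < rho -> rho <= 1 -> 0 < p <= 4 ->
  1 <= l -> k0 / l <= th -> th <= 1 ->
  (3 * (1 + cH * th `^ rho) * th `^ (- b)) `^ p <=
  ((1 + 3 * (1 + cH) / k0) * l) ^+ 4.
Proof.
move=> cH0 k00 /andP[b0 brho] rho1 /andP[p0 p4] l1 th_lo th1.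
have l0 : 0 < l by exact: lt_le_trans l1.
have th0 : 0 < th by apply: lt_le_trans th_lo; exact: divr_gt0.
have rho0 : 0 <= rho by apply: ltW; exact: lt_trans brho.
have b1 : b <= 1 by apply: ltW; exact: lt_le_trans rho1.
set K := 3 * (1 + cH) / k0.
have K0 : 0 <= K by rewrite divr_ge0 ?(ltW k00)// mulr_ge0// addr_ge0.
have one : 1 <= (1 + K) * l.
  by rewrite -[leLHS]mulr1; apply: ler_pM => //; rewrite lerDl.
have x1 : th `^ rho <= 1.
  by rewrite -(powRr0 th); apply: ger_powR; rewrite ?th0.
have thb : th `^ (- b) <= l / k0.
  apply: (@le_trans _ _ (th `^ (- 1))).
    by apply: ger_powR; rewrite ?th0// lerN2.
  rewrite powR_inv1 ?(ltW th0)// -[l / k0]invrK lef_pV2 ?posrE ?invr_gt0 ?divr_gt0//.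
  by rewrite invf_div.
have B0 : 0 <= 3 * (1 + cH * th `^ rho) * th `^ (- b).
  apply: mulr_ge0; last exact: powR_ge0.
  by apply: mulr_ge0 => //; apply: addr_ge0 => //; apply: mulr_ge0 => //; exact: powR_ge0.
have le : 3 * (1 + cH * th `^ rho) * th `^ (- b) <= (1 + K) * l.
  apply: (@le_trans _ _ (K * l)); last first.
    by apply: ler_wpM2r; [exact: ltW|rewrite lerDr].
  have -> : K * l = 3 * (1 + cH) * (l / k0) by rewrite /K; ring.
  apply: ler_pM => //.
  - by apply: mulr_ge0 => //; apply: addr_ge0 => //; apply: mulr_ge0 => //; exact: powR_ge0.
  - exact: powR_ge0.
  - by apply: ler_wpM2l => //; rewrite lerD2l -[leRHS]mulr1; exact: ler_wpM2l.
apply: (@le_trans _ _ (((1 + K) * l) `^ p)).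
  by apply: ge0_ler_powR; rewrite ?nnegrE ?(ltW p0)//; exact: le_trans one.
rewrite -powR_mulrn; last by exact: le_trans one.
exact: ler_powR.
Qed.

End Rates.

Section Expectation.
Context {d : measure_display} {T : measurableType d} {R : realType} (P : probability T R).

Lemma integral_affine_le (f : T -> \bar R) (g : T -> R) (a k M : R) :
  0 <= a -> 0 <= k -> measurable_fun [set: T] g -> (forall w, 0 <= g w) ->
  (forall w, 0 <= f w)%E -> (forall w, f w <= (a + k * g w)%:E)%E ->
  (\int[P]_w (g w)%:E <= M%:E)%E -> (\int[P]_w f w <= (a + k * M)%:E)%E.
Proof.
move=> a0 k0 mg g0 f0 fg gM.
apply: (@le_trans _ _ (\int[P]_w (a%:E + k%:E * (g w)%:E))%E).
  by apply: integral_ge0_mono.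
rewrite ge0_integralD//; first last.
- by apply: measurable_funeM; exact/measurable_EFinP.
- by move=> w _; rewrite mule_ge0// lee_fin.
rewrite integral_cst//= probability_setT mule1 ge0_integralZl_EFin//; [|by move=> w _; rewrite lee_fin|exact/measurable_EFinP].
by rewrite EFinD EFinM leeD2l// lee_wpmul2l// lee_fin.
Qed.

Variables (L : nat) (beta C gam : R) (g H : R -> R) (X : R -> R -> {RV P >-> R}).
Local Notation path w := (fun s : R => lmsm X H s w).

Lemma measurable_power_sum (N : nat) (I : interval R) :
  measurable_fun [set: T] (fun w => power_sum L beta (path w) N I).
Proof.
apply: measurable_sum_cond => k; apply: measurable_abs_powR.
by apply: measurable_sum => j; apply: measurable_funM.
Qed.

Lemma measurable_rel_error (N : nat) (I : interval R) :
  measurable_fun [set: T] (fun w => rel_error L beta g H (path w) N I).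
Proof.
apply: measurable_funM => //; apply: (measurableT_comp (@normr_measurable R setT)).
by apply: measurable_funB => //; exact: measurable_power_sum.
Qed.

Hypothesis weak : forall (N : nat) (A : {set 'I_(N - L).+1}), (L <= N)%N ->
  N%:R `^ (3 / 4) <= #|A|%:R :> R ->
  (\int[P]_w (`|\sum_(k in A) `|increment L (path w) N k| `^ beta
                - \sum_(k in A) mean_size beta g H N (k%:R / N%:R)|)%:E <=
   (C * N%:R `^ (- gam) * \sum_(k in A) mean_size beta g H N (k%:R / N%:R))%:E)%E.

Lemma rel_error_integral (N : nat) (I : interval R) : (L <= N)%N ->
  N%:R `^ (3 / 4) <= #|nu L N I|%:R :> R -> 0 < mean_sum L beta g H N I ->
  (\int[P]_w (rel_error L beta g H (path w) N I)%:E <= (C * N%:R `^ (- gam))%:E)%E.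
Proof.
move=> LN nuN m0; have h := weak LN nuN.
set mu := mean_sum L beta g H N I in m0 *.
rewrite -/(mean_sum L beta g H N I) -/mu in h.
under eq_integral do rewrite /rel_error -/mu mulrC EFinM.
have i0 : 0 <= mu^-1 by rewrite invr_ge0 ltW.
rewrite ge0_integralZl_EFin//; last first.
  apply/measurable_EFinP; apply: (measurableT_comp (@normr_measurable R setT)).
  by apply: measurable_funB => //; exact: measurable_power_sum.
have -> : (C * N%:R `^ (- gam))%:E = (mu^-1%:E * (C * N%:R `^ (- gam) * mu)%:E)%E.
  by rewrite -EFinM; congr (_%:E); field; rewrite gt_eqF.
by apply: lee_wpmul2l; [rewrite lee_fin|exact: h].
Qed.

Lemma total_error_integral (N : nat) (th : R) : (L <= N)%N -> 0 <= C -> 0 <= gam ->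
  (0 < N)%N ->
  (forall n, (n < Num.truncn th^-1)%N ->
    [/\ N%:R `^ (3 / 4) <= #|nu L N (block th n)|%:R :> R,
        (2 * N)%:R `^ (3 / 4) <= #|nu L (2 * N) (block th n)|%:R :> R,
        0 < mean_sum L beta g H N (block th n) &
        0 < mean_sum L beta g H (2 * N) (block th n)]) ->
  (\int[P]_w (total_error L beta g H (path w) N th)%:E <=
   ((Num.truncn th^-1)%:R * (2 * (C * N%:R `^ (- gam))))%:E)%E.
Proof.
move=> LN C0 gam0 N0 hn.
have rel0 N' n w : 0 < mean_sum L beta g H N' (block th n) ->
    0 <= rel_error L beta g H (path w) N' (block th n).
  by move=> m0; apply: divr_ge0 => //; exact: ltW.
rewrite /total_error integral_EFin_sum; last 2 first.
- by move=> n; apply: measurable_funD; exact: measurable_rel_error.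
- by move=> n w; have [_ _ m1 m2] := hn n (ltn_ord n); apply: addr_ge0; exact: rel0.
apply: (@le_trans _ _ (\sum_(n < Num.truncn th^-1) (2 * (C * N%:R `^ (- gam)))%:E)%E).
  apply: lee_sum => n _; have [c1 c2 m1 m2] := hn n (ltn_ord n).
  under eq_integral do rewrite EFinD.
  rewrite ge0_integralD//; first last.
  - by apply/measurable_EFinP; exact: measurable_rel_error.
  - by move=> w _; rewrite lee_fin; exact: rel0.
  - by apply/measurable_EFinP; exact: measurable_rel_error.
  - by move=> w _; rewrite lee_fin; exact: rel0.
  have LN2 : (L <= 2 * N)%N by apply: leq_trans LN _; rewrite leq_pmull.
  apply: le_trans (leeD (rel_error_integral LN c1 m1) (rel_error_integral LN2 c2 m2)) _.
  rewrite -EFinD lee_fin.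
  have : C * (2 * N)%:R `^ (- gam) <= C * N%:R `^ (- gam).
    apply: ler_wpM2l => //; apply: ler_wpowRN => //; first by rewrite ltr0n.
    by rewrite ler_nat leq_pmull.
  by move=> h; rewrite [leRHS]mulr_natl mulr2n lerD2l.
by rewrite sumEFin lee_fin sumr_const card_ord -[leLHS]mulr_natl.
Qed.

End Expectation.

(** A block of length th contains M th - L - 1 points at least, and th >= k0 / l
    is much larger than N^(-1/8). *)
Lemma block_card (R : realType) (L N M : nat) (k0 th l : R) (n : nat) :
  (0 < L)%N -> (L <= N)%N -> (N <= M)%N -> 0 < l -> k0 / l <= th -> 0 < th <= 1 ->
  (L + 2)%:R * l * N%:R `^ (- (1 / 8)) <= k0 -> (n < Num.truncn th^-1)%N ->
  M%:R `^ (7 / 8) <= #|nu L M (block th n)|%:R :> R.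
Proof.
move=> L0 LN NM l0 th_lo th01 small nm.
have N0 : (0 < N)%N by exact: leq_trans L0 LN.
have M0 : (0 < M)%N by exact: leq_trans N0 NM.
have Np : 0 < N%:R :> R by rewrite ltr0n.
have Mp : 0 < M%:R :> R by rewrite ltr0n.
have [lo [hi [-> lo0 hi1 len _]]] := block_interval th01 nm.
apply: le_trans (nu_card_lower (leq_trans LN NM) M0 lo0 hi1).
have one : 1 <= M%:R `^ (7 / 8) :> R.
  by rewrite -[leLHS](powRr0 M%:R); apply: ler_powR; rewrite ?ler1n// divr_ge0.
have Ml : M%:R * th <= M%:R * (hi - lo) by apply: ler_wpM2l => //; exact: ltW.
have kl : (L + 2)%:R * N%:R `^ (- (1 / 8)) <= th.
  by apply: le_trans th_lo; rewrite ler_pdivlMr// mulrAC.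
have NMp : M%:R `^ (- (1 / 8)) <= N%:R `^ (- (1 / 8)) :> R.
  by apply: ler_wpowRN; rewrite ?ler_nat// divr_ge0.
have E : M%:R `^ (7 / 8) = M%:R * M%:R `^ (- (1 / 8)) :> R.
  rewrite -{2}[M%:R](powRr1 (ltW Mp)) -powRD_gt0//.
  by congr (_ `^ _); field.
have main : (L + 2)%:R * M%:R `^ (7 / 8) <= M%:R * th.
  rewrite E mulrCA; apply: ler_wpM2l; first exact: ltW.
  by apply: le_trans kl; apply: ler_wpM2l.
have Lone : L%:R * 1 <= L%:R * M%:R `^ (7 / 8) :> R by apply: ler_wpM2l.
rewrite natrD in main.
move: main Lone one Ml; move: (M%:R `^ (7 / 8)) => z; rewrite mulrDl mulr1; clear.
move: (M%:R * th) (M%:R * (hi - lo)) (L%:R * z) (L%:R : R) => u v x y; lra.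
Qed.

(** * The logarithmic rate *)

Theorem corollary2p1 (d : measure_display) (T : measurableType d)
  (R : realType) (P : probability T R)
  (alpha : R) (halpha : 1 < alpha < 2)
  (Z : (R -> R) -> {RV P >-> R}) (hZ : SaS_random_measure alpha Z)
  (X : R -> R -> {RV P >-> R}) (hX : stable_field alpha Z X)
  (H : R -> R)
  (hH : exists h1 h2 : R, [/\ alpha^-1 < h1, h1 <= h2, h2 < 1 &
     forall t : R, 0 <= t <= 1 -> h1 <= H t <= h2])
  (cH rhoH : R)
  (hHolder : forall t1 t2 : R, 0 <= t1 <= 1 -> 0 <= t2 <= 1 ->
     `|H t1 - H t2| <= cH * `|t1 - t2| `^ rhoH)
  (hrho1 : rhoH <= 1)
  (hrhoH : sup [set H t | t in [set t : R | 0 <= t <= 1]] < rhoH)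
  (L : nat) (hL : (2 <= L)%N)
  (N0 : nat) (hN0 : is_N0 R L N0)
  (b : R) (hb : 0 < b < rhoH / (1 + rhoH))
  (beta : R) (hbeta : 0 < beta <= 4^-1)
  (p : R) (hp : 0 < p <= 4) :
  exists kappa : R, 0 < kappa /\
  exists C : R, \forall N \near \oo,
    (\int[P]_w
       (holder_norm b (fun t : R =>
          Htilde L beta (fun s : R => lmsm X H s w) N (theta L N0 N) t - H t)%R
        `^ p)
     <= (C * ln (N%:R : R) `^ (- kappa))%:E)%E.
Proof.
have le78 : 3 / 4 <= 7 / 8 :> R by lra.
have [h1 [h2 [ah1 h12 h21 hHb]]] := hH.
have /andP[a1 a2] := halpha.
have /andP[p0 p4] := hp; have /andP[be0 be4] := hbeta; have /andP[b0 brr] := hb.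
have L0 : (0 < L)%N by exact: ltn_trans hL.
have I0 : 0 <= (0 : R) <= 1 by rewrite lexx ler01.
have I1 : 0 <= (1 : R) <= 1 by rewrite lexx ler01.
set hs := sup [set H t | t in [set t : R | 0 <= t <= 1]] in hrhoH.
have Hub : ubound [set H t | t in [set t : R | 0 <= t <= 1]] h2.
  by move=> _ [t /hHb/andP[_ h] <-].
have Hs t : 0 <= t <= 1 -> H t <= hs.
  by move=> t01; apply: ub_le_sup; [exists h2|exists t].
have hs2 : hs <= h2 by apply: ge_sup => //; exists (H 0), 0.
have h1s : h1 <= hs by have /andP[h _] := hHb _ I0; exact: le_trans h (Hs _ I0).
have hs1 : hs < 1 by exact: le_lt_trans h21.
have HI t : 0 <= t <= 1 -> h1 <= H t <= hs.
  by move=> t01; have /andP[h _] := hHb _ t01; rewrite h Hs.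
have ai : 2^-1 < alpha^-1 by rewrite ltf_pV2 ?posrE//; exact: lt_trans a1.
have h1half : 2^-1 < h1 by exact: lt_trans ah1.
have rho_half : 2^-1 < rhoH by exact: lt_trans h1half (le_lt_trans h1s hrhoH).
have rho0 : 0 < rhoH by apply: lt_trans rho_half.
have brho : b < rhoH.
  by apply: lt_le_trans brr _; rewrite ler_pdivrMr ?addr_gt0// ler_peMr ?(ltW rho0)// lerDl ltW.
have cH0 : 0 <= cH.
  have := hHolder _ _ I0 I1; rewrite sub0r normrN normr1 powR1 mulr1.
  exact: le_trans.
have bI : 0 < b < rhoH by rewrite b0.
have [g [C [gam [C0 gam0 gC g_dist weak]]]] :=
  lmsm_weak_law halpha hZ hX L0 ah1 h1s hrhoH HI cH0 hrho1 hHolder hbeta.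
have k00 := kappa0_gt0 hN0.
set k0 := kappa0 L N0 in k00.
(* K1 (ln N)^-kappa bounds the first term of path_error; the second one is at most
   K3 (ln N)^6 N^-gam, which is below (ln N)^-4 *)
pose K1 := (3 * (3 * cH + 4 / (k0 * (beta * ln 2))) * (k0 + 1) `^ (rhoH - b)) `^ p.
pose K2 := 1 + 3 * (1 + cH) / k0.
pose K3 := K2 ^+ 4 * (2 * C / k0).
pose Kg := 2 * cH * C ^+ 2 + C ^+ 2 * cH `^ beta.
exists (p * (rhoH - b)); split; first by rewrite mulr_gt0// subr_gt0.
exists (K1 + 1).
near=> N.
have LN : (L <= N)%N by near: N; exact: nbhs_infty_ge.
have N0' : (0 < N)%N by exact: leq_trans LN.
have N1 : 1 <= N%:R :> R by rewrite ler1n.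
have l8 : 8 <= ln (N%:R : R) by near: N; exact: ln_large.
have [th_lo th_up th1] : [/\ k0 / ln (N%:R : R) <= theta L N0 N,
    theta L N0 N <= (k0 + 1) / ln (N%:R : R) & theta L N0 N <= 1 :> R].
  by near: N; exact: theta_asymptotics.
have s1 : (L + 2)%:R * ln (N%:R : R) ^+ 1 * N%:R `^ (- (1 / 8)) <= k0.
  by near: N; exact: ln_pow_small.
have s2 : 2 * (2 * L + 4)%:R * (C ^+ 2 + 1) * ln (N%:R : R) ^+ 1 * N%:R `^ (- (3 / 4)) <= 1.
  by near: N; exact: ln_pow_small.
have s3 : 4 * Kg * ln (N%:R : R) ^+ 2 * N%:R `^ (- (rhoH * beta)) <= 1.
  by near: N; apply: ln_pow_small => //; exact: mulr_gt0.
have s4 : K3 * ln (N%:R : R) ^+ 10 * N%:R `^ (- gam) <= 1.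
  by near: N; exact: ln_pow_small.
clear - le78 s1 s2 s3 s4 th_lo th_up th1 l8 N1 N0' LN weak gC g_dist C0 gam0 k00 bI cH0 rho0 rho_half
  h1half HI hs1 L0 p0 p4 hp hbeta be0 be4 hrho1 hHolder b0 brho.
set l := ln (N%:R : R) in l8 th_lo th_up s1 s2 s3 s4 *.
set th := theta L N0 N in th_lo th_up th1 *.
have l1 : 1 <= l by apply: le_trans l8; rewrite ler1n.
have l0 : 0 < l by exact: lt_le_trans l1.
have Np : 0 < N%:R :> R by exact: lt_le_trans N1.
have th0 : 0 < th by apply: lt_le_trans th_lo; exact: divr_gt0.
have th01 : 0 < th <= 1 by rewrite th0.
(* the threshold on the total error is 1 / ln N *)
have e8 : 0 < l^-1 <= 8^-1 by rewrite invr_gt0 l0 lef_pV2 ?posrE.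
have small : (L + 2)%:R * l * N%:R `^ (- (1 / 8)) <= k0 by rewrite -[X in _ * X * _]expr1.
have card1 n (nm : (n < Num.truncn th^-1)%N) := block_card L0 LN (leqnn N) l0 th_lo th01 small nm.
have N2 : (N <= 2 * N)%N by rewrite leq_pmull.
have card2 n (nm : (n < Num.truncn th^-1)%N) := block_card L0 LN N2 l0 th_lo th01 small nm.
have N20 : (0 < 2 * N)%N by exact: leq_trans N2.
have p34 (M c : nat) : (0 < M)%N -> M%:R `^ (7 / 8) <= c%:R :> R -> M%:R `^ (3 / 4) <= c%:R :> R.
  move=> M0; apply: le_trans; apply: ler_powR => //; by rewrite ler1n.
have cpos (M c : nat) : (0 < M)%N -> M%:R `^ (7 / 8) <= c%:R :> R -> (0 < c)%N.
  by move=> M0 h; rewrite -(ltr0n R); apply: lt_le_trans h; rewrite powR_gt0// ltr0n.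
have mean_pos M n : (0 < M)%N -> (n < Num.truncn th^-1)%N ->
    (0 < #|nu L M (block th n)|)%N -> 0 < mean_sum L beta g H M (block th n).
  by move=> M0 nm nu0; exact: (mean_sum_gt0 beta C0 gC HI th01 M0 nm nu0).
have gridC : (2 * L + 4)%:R * (C ^+ 2 * N%:R `^ (1 / 8) + 1) / N%:R `^ (7 / 8) <= l^-1 / 2.
  have one : 1 <= N%:R `^ (1 / 8) :> R.
    by rewrite -[leLHS](powRr0 N%:R); apply: ler_powR; rewrite // divr_ge0.
  rewrite -invfM -[leRHS]mul1r ler_pdivlMr ?mulr_gt0//.
  apply: le_trans s2; rewrite expr1.
  have -> : N%:R `^ (- (3 / 4)) = N%:R `^ (1 / 8) / N%:R `^ (7 / 8) :> R.
    by rewrite -powRN -powRD_gt0//; congr (_ `^ _); field.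
  have -> : 2 * (2 * L + 4)%:R * (C ^+ 2 + 1) * l * (N%:R `^ (1 / 8) / N%:R `^ (7 / 8)) =
    (2 * L + 4)%:R * (C ^+ 2 * N%:R `^ (1 / 8) + N%:R `^ (1 / 8)) / N%:R `^ (7 / 8) * (l * 2).
    by move: (N%:R `^ (1 / 8)) (N%:R `^ (7 / 8))^-1 => x y; ring.
  apply: ler_wpM2r; first by rewrite mulr_ge0// ltW.
  apply: ler_wpM2r; first by rewrite invr_ge0 powR_ge0.
  by apply: ler_wpM2l => //; rewrite lerD2l.
have gridD : 2 * (Kg * (l * N%:R `^ (- (rhoH * beta)))) <= l^-1 / 2.
  rewrite -invfM -[leRHS]mul1r ler_pdivlMr ?mulr_gt0//.
  apply: le_trans s3; rewrite le_eqVlt; apply/orP; left; apply/eqP.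
  by move: (N%:R `^ _) => x; ring.
have pe w := path_error (fun s : R => lmsm X H s w) hbeta C0 h1half hs1 gC g_dist HI cH0
  rho_half hrho1 hHolder L0 LN l1 e8 th01 bI p0 card1
  (fun n nm => cpos _ _ N20 (card2 n nm)) gridC gridD.
have main := main_rate cH0 k00 bI hrho1 p0 be0 l1 th_lo th_up th1.
have crude := crude_rate cH0 k00 bI hrho1 hp l1 th_lo th1.
rewrite -/K1 -/K2 in main crude.
have Eint := total_error_integral weak LN (ltW C0) (ltW gam0) N0'
  (fun n nm => And4 (p34 _ _ N0' (card1 n nm)) (p34 _ _ N20 (card2 n nm))
     (mean_pos N n N0' nm (cpos _ _ N0' (card1 n nm)))
     (mean_pos (2 * N)%N n N20 nm (cpos _ _ N20 (card2 n nm)))).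
set A := K1 * l `^ (- (p * (rhoH - b))) in main.
set B := (K2 * l) ^+ 4 in crude.
have A0 : 0 <= A by rewrite mulr_ge0 ?powR_ge0.
have K20 : 0 <= K2.
  apply: addr_ge0 => //; apply: divr_ge0; last exact: ltW.
  by apply: mulr_ge0 => //; exact: addr_ge0.
have B0 : 0 <= B * l.
  apply: mulr_ge0; last exact: ltW.
  by apply: exprn_ge0; apply: mulr_ge0 => //; exact: ltW.
apply: (le_trans (integral_affine_le A0 B0 _ _ _ _ Eint)).
- apply: measurable_sum => n.
  by apply: measurable_funD; exact: measurable_rel_error.
- move=> w; apply: sumr_ge0 => n _; have nm := ltn_ord n.
  by apply: addr_ge0; apply: divr_ge0 => //; apply: ltW; apply: mean_pos => //;
    [exact: cpos _ _ N0' (card1 n nm)|exact: cpos _ _ N20 (card2 n nm)].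
- by move=> w; exact: poweR_ge0.
- move=> w; apply: le_trans (pe w) _; rewrite lee_fin.
  rewrite invrK -[B * l * _]mulrA; apply: lerD; first exact: main.
  apply: ler_wpM2r; last exact: crude.
  apply: mulr_ge0; first exact: ltW.
  apply: sumr_ge0 => n _; have nm := ltn_ord n.
  by apply: addr_ge0; apply: divr_ge0 => //; apply: ltW; apply: mean_pos => //;
    [exact: cpos _ _ N0' (card1 n nm)|exact: cpos _ _ N20 (card2 n nm)].
rewrite lee_fin (mulrDl K1) mul1r; apply: lerD; first exact: lexx.
have mle : (Num.truncn th^-1)%:R <= l / k0.
  apply: (@le_trans _ _ th^-1); first by rewrite truncn_le// invr_ge0 ltW.
  by rewrite -[leRHS]invrK lef_pV2 ?posrE ?invr_gt0 ?divr_gt0// invf_div.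
have CN0 : 0 <= 2 * (C * N%:R `^ (- gam)).
  by apply: mulr_ge0 => //; apply: mulr_ge0; [exact: ltW|exact: powR_ge0].
apply: (@le_trans _ _ (B * l * (l / k0 * (2 * (C * N%:R `^ (- gam)))))).
  by apply: ler_wpM2l => //; apply: ler_wpM2r.
have l4 : l `^ (- 4) <= l `^ (- (p * (rhoH - b))).
  apply: ler_powR => //; rewrite lerN2 -[leRHS]mulr1; apply: ler_pM => //.
  - exact: ltW.
  - by rewrite subr_ge0 ltW.
  - by apply: le_trans hrho1; rewrite gerBl ltW.
apply: le_trans l4.
have l4E : l `^ (- 4) = (l ^+ 4)^-1 by rewrite powRN powR_mulrn// ltW.
have l4p : 0 < l ^+ 4 by exact: exprn_gt0.
rewrite l4E -[leRHS]mul1r ler_pdivlMr//; apply: le_trans s4.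
rewrite le_eqVlt; apply/orP; left; apply/eqP; rewrite /B /K3.
by field; rewrite gt_eqF.
Unshelve. all: by end_near. Qed.
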